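(* Let $\{Z(t),\varphi(t)\}$ be the regulated Markov-modulated Brownian motion and let $\boldsymbol G^*(x)$ be the row vector with components $G^*_i(x)=\lim_{t\to\infty}\mathrm P[Z(t)\le x,\varphi(t)=i]$, $x\ge 0$. Let $q>0$. Then $$\boldsymbol G^*(x)=\gamma^*_\rho\,\boldsymbol\rho^*(-U(q))^{-1}\Theta^{-1}(-K)^{-1}(I-e^{Kx})\Theta^{-1},$$ where $\boldsymbol\rho^*$ is the solution of $\boldsymbol\rho^*(-U(q))^{-1}U=\boldsymbol 0$, $\boldsymbol\rho^*\boldsymbol 1=1$, and $\gamma^*_\rho=2(\boldsymbol\rho^*\boldsymbol m^* )^{-1}$ is the normalizing constant, with $\boldsymbol m^*=2(-U(q))^{-1}\Theta^{-1}(-K)^{-1}\Theta^{-1}\boldsymbol 1$. It is also given by $$\boldsymbol G^*(x)=\gamma^*_\nu\,\boldsymbol\nu(-K)^{-1}(I-e^{Kx})\Theta^{-1},$$ independently of $q$, where $\boldsymbol\nu$ is the solution of the system $\boldsymbol\nu\Theta U=\boldsymbol 0$, $\boldsymbol\nu\boldsymbol 1=1$, and $\gamma^*_\nu=(\boldsymbol\nu(-K)^{-1}\Theta^{-1}\boldsymbol 1)^{-1}$.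
   Context: Setting: $\mathcal M=\{1,\dots,m\}$, $m<\infty$; $\{\varphi(t)\}$ is an irreducible continuous-time Markov chain on $\mathcal M$ with generator $Q$ and stationary probability vector $\boldsymbol\alpha$ ($\boldsymbol\alpha Q=\boldsymbol 0$, $\boldsymbol\alpha\boldsymbol 1=1$). For $i\in\mathcal M$, $\mu_i\in\mathbb R$ and $\sigma_i>0$; the stationary drift is strictly negative: $\sum_i\alpha_i\mu_i<0$. $\{W(t)\}$ is a standard Brownian motion independent of $\varphi$, $X(t)=\int_0^t\mu_{\varphi(s)}\,\mathrm ds+\int_0^t\sigma_{\varphi(s)}\,\mathrm dW(s)$, and the regulated process is $Z(t)=X(t)+|\inf_{0\le s\le t}X(s)|$. Matrices: $D=\mathrm{diag}(\mu_1,\dots,\mu_m)$, $\Theta=\mathrm{diag}(\sigma_1,\dots,\sigma_m)$. For $q>0$, $U(q)$ is the unique matrix solution of $\tfrac12\Theta^2X^2+DX+(Q-qI)=0$ all of whose eigenvalues have strictly negative real parts; $U=U(0)$ is the unique solution for $q=0$ having one eigenvalue equal to $0$ and all others with strictly negative real parts ($U$ is an irreducible generator). $K=\Theta U\Theta^{-1}+2\Theta^{-2}D$. $\boldsymbol 1$ is the column vector of ones, $\boldsymbol 0$ the zero vector; $\boldsymbol\rho^*,\boldsymbol\nu,\boldsymbol\alpha$ are row vectors. *)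

(* Defs.v *)
From HB Require Import structures.
From mathcomp Require Import all_boot all_order all_algebra.
From mathcomp Require Import all_classical all_reals all_analysis.
From mathcomp Require Import complex.
Set Implicit Arguments.
Unset Strict Implicit.
Unset Printing Implicit Defensive.
Import Order.TTheory GRing.Theory Num.Theory.
Import numFieldNormedType.Exports.
Local Open Scope classical_set_scope.
Local Open Scope ring_scope.

Definition ones (R : realType) (m : nat) : 'cV[R]_m := const_mx 1.

Definition expmx (R : realType) (m : nat) (A : 'M[R]_m) : 'M[R]_m :=
  \matrix_(i, j) limn (series (fun k : nat => (A ^+ k) i j / k`!%:R)).

Definition eigenvalueC (R : realType) (m : nat) (A : 'M[R]_m) (z : R[i]) : Prop :=
  eigenvalue (map_mx (real_complex R) A) z.

Definition spectrum_neg (R : realType) (m : nat) (A : 'M[R]_m) : Prop :=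
  forall z, eigenvalueC A z -> complex.Re z < 0.

(* Eigenvalues are counted with algebraic multiplicity. *)
Definition spectrum_one0_neg (R : realType) (m : nat) (A : 'M[R]_m) : Prop :=
  mup 0 (char_poly A) = 1%N /\
  forall z, eigenvalueC A z -> z != 0 -> complex.Re z < 0.

Definition is_generator (R : realType) (m : nat) (Q : 'M[R]_m) : Prop :=
  (forall i j, i != j -> 0 <= Q i j) /\ Q *m ones R m = 0.

Definition is_irreducible (R : realType) (m : nat) (Q : 'M[R]_m) : Prop :=
  forall i j, connect (fun k l => (k != l) && (0 < Q k l)) i j.

Definition is_stationary (R : realType) (m : nat) (Q : 'M[R]_m)
    (alpha : 'rV[R]_m) : Prop :=
  [/\ forall i, 0 <= alpha 0 i, alpha *m Q = 0 & \sum_i alpha 0 i = 1].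

(* (1/2) Theta^2 X^2 + D X + (Q - q I) = 0, with D = diag mu,
   Theta = diag sigma. *)
Definition quad_solution (R : realType) (m : nat) (mu sigma : 'rV[R]_m)
    (Q : 'M[R]_m) (q : R) (X : 'M[R]_m) : Prop :=
  2^-1 *: (diag_mx sigma *m diag_mx sigma *m (X *m X)) + diag_mx mu *m X
    + (Q - q%:M) = 0.

(* U(q), q > 0: the conditions determine the matrix. *)
Definition is_Uq (R : realType) (m : nat) (mu sigma : 'rV[R]_m)
    (Q : 'M[R]_m) (q : R) (Uq : 'M[R]_m) : Prop :=
  quad_solution mu sigma Q q Uq /\ spectrum_neg Uq.

Definition is_U0 (R : realType) (m : nat) (mu sigma : 'rV[R]_m)
    (Q U : 'M[R]_m) : Prop :=
  quad_solution mu sigma Q 0 U /\ spectrum_one0_neg U.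

Definition Kmx (R : realType) (m : nat) (mu sigma : 'rV[R]_m)
    (U : 'M[R]_m) : 'M[R]_m :=
  diag_mx sigma *m U *m invmx (diag_mx sigma)
    + 2 *: (invmx (diag_mx sigma *m diag_mx sigma) *m diag_mx mu).

Section Processes.
Context (R : realType) (d : measure_display) (Omega : measurableType d)
  (P : probability Omega R) (m : nat).
Implicit Types (phi : R -> Omega -> 'I_m) (W Z : R -> {RV P >-> R}).

(* Processes are indexed by all of R, but only times t >= 0 are meaningful. *)

Definition cadlag_step (f : R -> 'I_m) : Prop :=
  (forall t : R, 0 <= t -> \forall s \near t^'+, f s = f t) /\
  (forall t : R, 0 < t -> exists i, \forall s \near t^'-, f s = i).

(* Markov chain with generator Q and arbitrary initial law: transition
   matrices are exp(tQ), and paths are almost surely right-continuous with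
   left limits in the discrete state space. *)
Definition is_ctmc (Q : 'M[R]_m) phi : Prop :=
  [/\ forall (t : R) i, 0 <= t -> measurable [set w | phi t w = i],
      forall (n : nat) (t : nat -> R) (i : nat -> 'I_m),
        0 <= t 0%N -> (forall k, t k <= t k.+1) ->
        P [set w | forall k, (k <= n)%N -> phi (t k) w = i k] =
          (P [set w | phi (t 0%N) w = i 0%N] *
           (\prod_(k < n)
              expmx ((t k.+1 - t k) *: Q) (i k) (i k.+1))%:E)%E
    & {ae P, forall w, cadlag_step (phi ^~ w)}].

Definition increment W (s t : R) (w : Omega) : R := W t w - W s w.

Definition is_brownian W : Prop :=
  [/\ {ae P, forall w, W 0 w = 0},
      forall (s t : R) (B : set R), 0 <= s -> s < t -> measurable B ->
        P [set w | B (increment W s t w)] = normal_prob 0 (Num.sqrt (t - s)) B,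
      forall (n : nat) (t : nat -> R) (B : nat -> set R),
        0 <= t 0%N -> (forall k, t k <= t k.+1) ->
        (forall k, measurable (B k)) ->
        P [set w | forall k, (k < n)%N -> B k (increment W (t k) (t k.+1) w)] =
          (\prod_(k < n) P [set w | B k (increment W (t k) (t k.+1) w)])%E
    & {ae P, forall w, {within `[0, +oo[, continuous (fun t : R => W t w : R)}}].

Definition events_of_chain phi : set (set Omega) :=
  <<s [set A | exists (t : R) i, 0 <= t /\ A = [set w | phi t w = i]] >>.

Definition events_of_real W : set (set Omega) :=
  <<s [set A | exists (t : R) (B : set R),
         [/\ 0 <= t, measurable B & A = W t @^-1` B]] >>.

Definition independent_processes phi W : Prop :=
  forall A B, events_of_chain phi A -> events_of_real W B ->
    P (A `&` B) = (P A * P B)%E.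

(* int_0^t sigma_phi(s) dW(s). The integrand is almost surely a step function
   with finitely many jumps on [0, t] and is independent of W, so the Ito
   integral is the pathwise limit of the left-endpoint sums. *)
Definition step_stoch_integral (sigma : 'rV[R]_m) phi W (t : R) (w : Omega) : R :=
  limn (fun n : nat => \sum_(k < n)
    sigma 0 (phi (t * k%:R / n%:R) w) *
    increment W (t * k%:R / n%:R) (t * k.+1%:R / n%:R) w).

Definition mmbm (mu sigma : 'rV[R]_m) phi W (t : R) (w : Omega) : R :=
  (\int[lebesgue_measure]_(s in `[0, t]) mu 0 (phi s w))
  + step_stoch_integral sigma phi W t w.

Definition regulate (x : R -> R) (t : R) : R :=
  x t + `| inf [set x s | s in `[0, t]] |.

(* Equality with the regulated path is up to indistinguishability. *)
Definition is_regulated_mmbm (mu sigma : 'rV[R]_m) phi W Z : Prop :=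
  {ae P, forall w, forall t : R, 0 <= t ->
     Z t w = regulate (fun s => mmbm mu sigma phi W s w) t}.

(* The row vector G( . ) is the entrywise limiting law of (Z(t), phi(t)). *)
Definition limit_law phi Z (x : R) (G : 'rV[R]_m) : Prop :=
  forall i : 'I_m,
    fine (P [set w | Z t w <= x /\ phi t w = i]) @[t --> +oo] --> G 0 i.

End Processes.

Definition mstar (R : realType) (m : nat) (sigma : 'rV[R]_m)
    (Uq K : 'M[R]_m) : 'cV[R]_m :=
  2 *: (invmx (- Uq) *m invmx (diag_mx sigma) *m invmx (- K)
        *m invmx (diag_mx sigma) *m ones R m).

Definition gamma_rho (R : realType) (m : nat) (sigma : 'rV[R]_m)
    (Uq K : 'M[R]_m) (rho : 'rV[R]_m) : R :=
  2 * ((rho *m mstar sigma Uq K) 0 0)^-1.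

Definition gamma_nu (R : realType) (m : nat) (sigma : 'rV[R]_m)
    (K : 'M[R]_m) (nu : 'rV[R]_m) : R :=
  ((nu *m invmx (- K) *m invmx (diag_mx sigma) *m ones R m) 0 0)^-1.

(* Main.v *)
Require Import Defs.
From HB Require Import structures.
From mathcomp Require Import all_boot all_order all_algebra.
From mathcomp Require Import all_classical all_reals all_analysis.
From mathcomp Require Import measurable_realfun.
From mathcomp Require Import ring lra zify complex.

(** With L = Theta K Theta^-1, both expressions equal alpha (I - e^{Lx}): the
left null space of U is a line, and it contains nu Theta, rho^* (-U(q))^-1 and
alpha L Theta^2. So the claim is P[Z(t) > y, phi(t) = i] -> F_i(y) for
F(y) = alpha e^{Ly}, the decaying solution of F'' Theta^2 / 2 - F' D + F Q = 0
with F(0) = alpha.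

On a grid of step h replace Z by the reflected walk
Y_{k+1} = max(Y_k + mu h + sigma N_k, 0), with N_k the Brownian increments. The
tail T_k(y)_i = P[Y_k > y, phi(kh) = i] obeys a one-step recursion for y >= 0 and
equals P[phi(kh) = i] for y < 0. By a third-order Taylor expansion and the
monotonicity of the recursion, T_k lies, up to O(k h^{3/2}), between
(1 - eps) F - d R and (1 + eps) F + d R, where R = e^{-theta y} a is a strict
supersolution, available for small theta > 0 because the drift is negative, and
d decays in time. For fixed t, Y_n -> Z(t) almost surely as h = t / n -> 0,
since the paths of phi are step functions and those of W are continuous; then
let t tend to infinity. *)

Set Implicit Arguments.
Unset Strict Implicit.
Unset Printing Implicit Defensive.
Import Order.TTheory GRing.Theory Num.Theory.
Import numFieldNormedType.Exports.
Local Open Scope classical_set_scope.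
Local Open Scope ring_scope.

(** * Matrix exponential *)

Section MatrixNorm.
Context {R : realType}.

(** [U] is given only by its equation and its spectrum, so its structure has to be derived: a
    maximum principle shows that its flow preserves nonnegativity, hence that [U] is an irreducible
    generator. It follows that [L] is nonnegative off the diagonal and, by the sign of the drift,
    that [alpha *m L] is negative entrywise. So F is nonnegative, decreasing and exponentially
    small, and it exceeds alpha just to the left of 0.

    For y < 0 the barriers are compared with the law of the chain; this replaces a boundary
    condition at 0. There F lies above alpha, which suits the upper barrier, whereas the lower
    barrier needs F evaluated at a shifted argument. The factors 1 - eps and 1 + eps absorb the
    distance of the chain from stationarity at late times; the multiple of R covers the early times
    and the initial values.

    The third absolute moment of a Gaussian step is of order h^{3/2}, so the t / h steps up to time
    t cost t sqrt h. This vanishes for fixed t only, which dictates the order of the two limits. *)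

Definition nrm m n (A : 'M[R]_(m, n)) : R := \sum_i \sum_j `|A i j|.

Lemma nrm_ge0 m n (A : 'M[R]_(m, n)) : 0 <= nrm A.
Proof. by apply: sumr_ge0 => i _; apply: sumr_ge0. Qed.

Lemma row_le_nrm m n (A : 'M[R]_(m, n)) i : \sum_j `|A i j| <= nrm A.
Proof.
rewrite /nrm (bigD1 i)//= lerDl.
by apply: sumr_ge0 => k _; apply: sumr_ge0.
Qed.

Lemma entry_le_nrm m n (A : 'M[R]_(m, n)) i j : `|A i j| <= nrm A.
Proof.
apply: (le_trans _ (row_le_nrm A i)); rewrite (bigD1 j)//= lerDl.
exact: sumr_ge0.
Qed.

Lemma nrmZ m n (a : R) (A : 'M[R]_(m, n)) : nrm (a *: A) = `|a| * nrm A.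
Proof.
rewrite /nrm mulr_sumr; apply: eq_bigr => i _; rewrite mulr_sumr.
by apply: eq_bigr => j _; rewrite mxE normrM.
Qed.

Lemma mulmx_entry_le m n p (A : 'M[R]_(m, n)) (B : 'M[R]_(n, p)) (b : R) i j :
  (forall k, `|B k j| <= b) -> `|(A *m B) i j| <= nrm A * b.
Proof.
move=> Bb; rewrite mxE (le_trans (ler_norm_sum _ _ _))//.
apply: (@le_trans _ _ (\sum_k `|A i k| * b)).
  by apply: ler_sum => k _; rewrite normrM ler_wpM2l.
case: n A B Bb => [|n] A B Bb.
  by rewrite !big_ord0 /nrm big1 ?mul0r// => k _; rewrite big_ord0.
rewrite -mulr_suml ler_wpM2r ?row_le_nrm//.
exact: le_trans (Bb ord0).
Qed.

Lemma expr_entry_le m (A : 'M[R]_m) k i j : `|(A ^+ k) i j| <= nrm A ^+ k.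
Proof.
elim: k i j => [|k IH] i j; first by rewrite expr0 mxE; case: eqP; rewrite ?normr1 ?normr0.
by rewrite exprS (exprS (nrm A)); apply: mulmx_entry_le.
Qed.

Lemma expr_row_le m (A : 'M[R]_m) k i : \sum_j `|(A ^+ k) i j| <= nrm A ^+ k.
Proof.
elim: k i => [|k IH] i.
  rewrite !expr0 (bigD1 i)//= big1 ?addr0 => [|j ji]; rewrite mxE ?eqxx ?normr1//.
  by rewrite eq_sym (negbTE ji) normr0.
rewrite (exprS (nrm A)); under eq_bigr do rewrite exprS mxE.
apply: (@le_trans _ _ (\sum_j \sum_k0 `|A i k0| * `|(A ^+ k) k0 j|)).
  apply: ler_sum => j _; apply: le_trans (ler_norm_sum _ _ _) _.
  by apply: ler_sum => l _; rewrite normrM.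
rewrite exchange_big/=; under eq_bigr do rewrite -mulr_sumr.
apply: (@le_trans _ _ (\sum_l `|A i l| * nrm A ^+ k)).
  by apply: ler_sum => l _; rewrite ler_wpM2l.
by rewrite -mulr_suml ler_wpM2r ?row_le_nrm// exprn_ge0 ?nrm_ge0.
Qed.

End MatrixNorm.

Section MatrixExponential.
Context {R : realType}.

Definition expps m n (A : 'M[R]_m) : 'M[R]_m :=
  \sum_(0 <= k < n) (k`!%:R^-1 *: A ^+ k).

Definition exps (n : nat) (a : R) : R := \sum_(0 <= k < n) (k`!%:R^-1 * a ^+ k).

Lemma expps_entry m n (A : 'M[R]_m) i j :
  expps n A i j = series (fun k => (A ^+ k) i j / k`!%:R) n.
Proof.
by rewrite /expps summxE /series /=; apply: eq_bigr => k _; rewrite mxE mulrC.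
Qed.

Lemma exps_series n (a : R) : exps n a = series (exp_coeff a) n.
Proof. by rewrite /exps /series/=; apply: eq_bigr => k _; rewrite mulrC. Qed.

Lemma exps_cvg (a : R) : exps n a @[n --> \oo] --> expR a.
Proof.
rewrite (_ : (fun n => _) = series (exp_coeff a)); last first.
  by apply/funext => n; rewrite exps_series.
exact: is_cvg_series_exp_coeff.
Qed.

Lemma exps_le_expR n (a : R) : 0 <= a -> exps n a <= expR a.
Proof.
move=> a0; rewrite -(cvg_lim (@Rhausdorff R) (@exps_cvg a)).
apply: limr_ge; first exact: cvgP (@exps_cvg a).
near=> k; have nk : (n <= k)%N by near: k; exact: nbhs_infty_ge.
rewrite /exps [leRHS](big_cat_nat _ nk)//= lerDl sumr_ge0// => i _.
by rewrite mulr_ge0 ?exprn_ge0// invr_ge0.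
Unshelve. all: by end_near. Qed.

Lemma is_cvg_expmx m (A : 'M[R]_m) i j :
  cvgn (series (fun k => (A ^+ k) i j / k`!%:R)).
Proof.
apply: normed_cvg; apply: series_le_cvg (is_cvg_series_exp_coeff (nrm A)) => k /=.
  exact: normr_ge0.
  by rewrite /exp_coeff/= mulr_ge0 ?exprn_ge0 ?nrm_ge0 ?invr_ge0.
rewrite normrM (@ger0_norm _ k`!%:R^-1) ?invr_ge0// /exp_coeff/=.
by rewrite ler_wpM2r ?invr_ge0 ?expr_entry_le.
Qed.

Lemma expps_cvg m (A : 'M[R]_m) i j : expps n A i j @[n --> \oo] --> expmx A i j.
Proof.
rewrite (_ : (fun n => _) = series (fun k => (A ^+ k) i j / k`!%:R)); last first.
  by apply/funext => n; rewrite expps_entry.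
rewrite [X in _ --> X]mxE; exact: is_cvg_expmx.
Qed.

(** The Cauchy product of two partial sums, cut into the antidiagonals i + j < n and the corner i +
    j >= n, which has to be shown negligible. *)
Lemma sum_triangle (V : zmodType) (G : nat -> nat -> V) n :
  \sum_(0 <= i < n) \sum_(0 <= j < n) G i j =
  \sum_(0 <= k < n) \sum_(0 <= i < k.+1) G i (k - i)%N +
  \sum_(0 <= i < n) \sum_(n - i <= j < n) G i j.
Proof.
have -> : \sum_(0 <= k < n) \sum_(0 <= i < k.+1) G i (k - i)%N =
          \sum_(0 <= i < n) \sum_(0 <= j < n - i) G i j.
  elim: n => [|n IH]; first by rewrite !big_nil.
  rewrite big_nat_recr//= IH [in RHS]big_nat_recr//= subSnn big_nat1.
  rewrite [X in _ + X = _]big_nat_recr//= subnn addrA; congr (_ + _).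
  rewrite -big_split/= big_nat [RHS]big_nat; apply: eq_bigr => i /andP[_ ilt].
  by rewrite subSn ?(ltnW ilt)// big_nat_recr.
rewrite -big_split/=; apply: eq_bigr => i _.
by rewrite -big_cat_nat//= leq_subr.
Qed.

Lemma exps_mul n (a b : R) :
  exps n a * exps n b = exps n (a + b) +
  \sum_(0 <= i < n) \sum_(n - i <= j < n)
     (i`!%:R^-1 * j`!%:R^-1) * (a ^+ i * b ^+ j).
Proof.
rewrite {1}/exps mulr_suml; under eq_bigr => i _.
  rewrite mulr_sumr; under eq_bigr => j _ do rewrite mulrACA; over.
rewrite sum_triangle; congr (_ + _); apply: eq_bigr => k _.
rewrite addrC exprDn big_mkord mulr_sumr; apply: eq_bigr => -[i/= ik] _.
rewrite (mulrC (b ^+ _)) -(mulr_natl _ 'C(k, i)) [RHS]mulrA; congr (_ * _).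
have kf : k`!%:R != 0 :> R by rewrite pnatr_eq0 -lt0n fact_gt0.
have f1 : i`!%:R != 0 :> R by rewrite pnatr_eq0 -lt0n fact_gt0.
have f2 : (k - i)`!%:R != 0 :> R by rewrite pnatr_eq0 -lt0n fact_gt0.
rewrite -(bin_fact (ik : (i <= k)%N)) !natrM in kf *.
have bf : ('C(k, i))%:R != 0 :> R by move: kf; rewrite mulf_eq0 negb_or => /andP[].
by field; rewrite ?bf ?f1 ?f2.
Qed.

Lemma expps_mul m n (A B : 'M[R]_m) : GRing.comm A B ->
  expps n A * expps n B = expps n (A + B) +
  \sum_(0 <= i < n) \sum_(n - i <= j < n)
     (i`!%:R^-1 * j`!%:R^-1) *: (A ^+ i * B ^+ j).
Proof.
move=> cAB.
have ZM (a b : R) (X Y : 'M[R]_m) : (a *: X) * (b *: Y) = (a * b) *: (X * Y).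
  by rewrite -[LHS]scalemxAl -[in LHS]scalemxAr scalerA.
rewrite {1}/expps mulr_suml; under eq_bigr => i _.
  rewrite mulr_sumr; under eq_bigr => j _ do rewrite ZM; over.
rewrite sum_triangle; congr (_ + _); apply: eq_bigr => k _.
rewrite [A + B]addrC exprDn_comm; last exact: commr_sym.
rewrite big_mkord scaler_sumr; apply: eq_bigr => -[i/= ik] _.
rewrite -(commrX _ (commr_sym (commrX _ (commr_sym cAB)))).
rewrite -[_ *+ 'C(k, i)]scaler_nat [RHS]scalerA; congr (_ *: _).
have kf : k`!%:R != 0 :> R by rewrite pnatr_eq0 -lt0n fact_gt0.
have f1 : i`!%:R != 0 :> R by rewrite pnatr_eq0 -lt0n fact_gt0.
have f2 : (k - i)`!%:R != 0 :> R by rewrite pnatr_eq0 -lt0n fact_gt0.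
rewrite -(bin_fact (ik : (i <= k)%N)) !natrM in kf *.
have bf : ('C(k, i))%:R != 0 :> R by move: kf; rewrite mulf_eq0 negb_or => /andP[].
by field; rewrite ?bf ?f1 ?f2.
Qed.

Lemma mulmx_cvg {T : Type} {F : set_system T} {FF : Filter F} m n p
    (X : T -> 'M[R]_(m, n)) (Y : T -> 'M[R]_(n, p)) (X0 : 'M[R]_(m, n)) (Y0 : 'M[R]_(n, p)) :
  (forall i j, X t i j @[t --> F] --> X0 i j) ->
  (forall i j, Y t i j @[t --> F] --> Y0 i j) ->
  forall i j, (X t *m Y t) i j @[t --> F] --> (X0 *m Y0) i j.
Proof.
move=> XX YY i j; rewrite [X in _ --> X]mxE.
rewrite (_ : (fun t => _) = fun t => \sum_k X t i k * Y t k j); last first.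
  by apply/funext => t; rewrite mxE.
by apply: cvg_big => [|k _]; [exact: add_continuous|]; apply: cvgM.
Qed.

(** The corner left over in [expps_mul] is bounded entrywise by the corner in [exps_mul] taken at
    the norms of A and B. The latter tends to 0 by the addition formula for the real exponential. *)
Lemma expmxD m (A B : 'M[R]_m) : GRing.comm A B ->
  expmx (A + B) = expmx A *m expmx B.
Proof.
move=> cAB; apply/matrixP => i j.
have h1 : (expps n A *m expps n B) i j @[n --> \oo] --> (expmx A *m expmx B) i j.
  by apply: mulmx_cvg => k l; exact: expps_cvg.
apply/eqP; rewrite -subr_eq0; apply/eqP.
suff : (expps n (A + B) i j - (expps n A *m expps n B) i j) @[n --> \oo] --> 0.
  by apply: (cvg_unique (@Rhausdorff R)); apply: cvgB; [exact: expps_cvg|].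
pose a := nrm A; pose b := nrm B.
have bnd n : `|expps n (A + B) i j - (expps n A *m expps n B) i j| <=
    exps n a * exps n b - exps n (a + b).
  have -> : expps n A *m expps n B = expps n A * expps n B by [].
  rewrite expps_mul// exps_mul mxE opprD addrA subrr add0r normrN.
  rewrite [leRHS]addrAC subrr add0r summxE.
  apply: le_trans (ler_norm_sum _ _ _) _; apply: ler_sum => k _.
  rewrite summxE; apply: le_trans (ler_norm_sum _ _ _) _; apply: ler_sum => l _.
  rewrite mxE normrM ger0_norm ?mulr_ge0 ?invr_ge0//.
  rewrite ler_wpM2l ?mulr_ge0 ?invr_ge0// mxE.
  apply: le_trans (ler_norm_sum _ _ _) _.
  apply: (@le_trans _ _ (\sum_p `|(A ^+ k) i p| * b ^+ l)).
    by apply: ler_sum => p _; rewrite normrM ler_wpM2l ?expr_entry_le.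
  by rewrite -mulr_suml ler_wpM2r ?expr_row_le// exprn_ge0 ?nrm_ge0.
have lim0 : exps n a * exps n b - exps n (a + b) @[n --> \oo] --> 0.
  rewrite -(subrr (expR (a + b))) {1}expRD; apply: cvgB; last exact: exps_cvg.
  by apply: cvgM; exact: exps_cvg.
apply: norm_cvg0; apply: (squeeze_cvgr _ (cvg_cst 0) lim0).
by near=> n; rewrite normr_ge0 bnd.
Unshelve. all: by end_near. Qed.

(** Bounding (p + k)! below by k! pulls [nrm A ^+ p] out of the remainder. The cases p = 0, 1, 2, 3
    give boundedness, continuity, and the expansions of first and second order. *)
Lemma expmx_tail m (A : 'M[R]_m) p i j :
  `|(expmx A - expps p A) i j| <= nrm A ^+ p * expR (nrm A).
Proof.
have h : `|expps n A i j - expps p A i j| @[n --> \oo] --> `|(expmx A - expps p A) i j|.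
  rewrite !mxE; apply: cvg_norm; apply: cvgB; last exact: cvg_cst.
  by have := @expps_cvg _ A i j; rewrite [X in _ --> X]mxE.
rewrite -(cvg_lim (@Rhausdorff R) h); apply: limr_le; first exact: cvgP h.
near=> n; have pn : (p <= n)%N by near: n; exact: nbhs_infty_ge.
rewrite /expps (big_cat_nat _ pn)//= mxE addrAC subrr add0r summxE.
apply: le_trans (ler_norm_sum _ _ _) _.
apply: (@le_trans _ _ (nrm A ^+ p * exps (n - p) (nrm A))); last first.
  by rewrite ler_wpM2l ?exprn_ge0 ?nrm_ge0// exps_le_expR// nrm_ge0.
rewrite /exps -{1}(add0n p) big_addn mulr_sumr; apply: ler_sum => k _.
rewrite mxE normrM ger0_norm ?invr_ge0// mulrCA -exprD addnC.
apply: ler_pM; rewrite ?invr_ge0// ?expr_entry_le//.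
rewrite lef_pV2 ?posrE ?ltr0n ?fact_gt0// ler_nat addnC.
by apply: leq_fact; rewrite leq_addr.
Unshelve. all: by end_near. Qed.

Lemma expps2 m (A : 'M[R]_m) : expps 2 A = 1%:M + A.
Proof.
rewrite /expps !big_nat_recr//= big_nil add0r expr0 expr1 !fact0.
by rewrite /= invr1 !scale1r.
Qed.

Lemma expps3 m (A : 'M[R]_m) : expps 3 A = 1%:M + A + 2^-1 *: (A *m A).
Proof. by rewrite /expps big_nat_recr//= -/(expps 2 A) expps2 expr2. Qed.

(** With [S] a row or a column and a zero 1 x 1 matrix on the other side it yields vectors fixed by
    a flow; with [S] invertible it conjugates two flows. *)
Lemma expmx_intertwine m n (A : 'M[R]_m) (B : 'M[R]_n) (S : 'M[R]_(m, n)) :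
  A *m S = S *m B -> expmx A *m S = S *m expmx B.
Proof.
move=> AS.
have pow k : A ^+ k *m S = S *m B ^+ k.
  elim: k => [|k IH]; first by rewrite !expr0 mul1mx mulmx1.
  by rewrite exprS exprS -[LHS]mulmxA IH mulmxA AS -[LHS]mulmxA.
have eps k : expps k A *m S = S *m expps k B.
  rewrite /expps mulmx_suml mulmx_sumr; apply: eq_bigr => l _.
  by rewrite -scalemxAl pow scalemxAr.
apply/matrixP => i j.
have h1 : (expps n A *m S) i j @[n --> \oo] --> (expmx A *m S) i j.
  by apply: mulmx_cvg => k l; [exact: expps_cvg|exact: cvg_cst].
have h2 : (S *m expps n B) i j @[n --> \oo] --> (S *m expmx B) i j.
  by apply: mulmx_cvg => k l; [exact: cvg_cst|exact: expps_cvg].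
apply: (cvg_unique (@Rhausdorff R) h1).
by rewrite (_ : (fun n => _) = (fun n => (S *m expps n B) i j)) //; apply/funext => k; rewrite eps.
Qed.

Lemma expmx0 m : expmx (0 : 'M[R]_m) = 1%:M.
Proof.
rewrite -[RHS]addr0 -expps2.
apply/matrixP => i j; apply/eqP; rewrite -subr_eq0 -normr_le0.
have := @expmx_tail _ (0 : 'M[R]_m) 2 i j.
have -> : nrm (0 : 'M[R]_m) = 0 by rewrite -(scale0r (0 : 'M[R]_m)) nrmZ normr0 mul0r.
rewrite expr0n mul0r; apply: le_trans.
by rewrite [in leRHS]mxE [X in _ <= `|_ + X|]mxE.
Qed.

Lemma expmx_scalar m (a : R) : expmx (a%:M : 'M[R]_m) = (expR a)%:M.
Proof.
apply/matrixP => i j; rewrite [RHS]mxE.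
have h := @expps_cvg _ (a%:M : 'M[R]_m) i j.
apply: (cvg_unique (@Rhausdorff R) h).
have E n : expps n (a%:M : 'M[R]_m) i j = exps n a *+ (i == j).
  rewrite /expps summxE /exps -sumrMnl; apply: eq_bigr => k _.
  rewrite mxE; have -> : (a%:M : 'M[R]_m) ^+ k = (a ^+ k)%:M.
    elim: k => [|k IH]; first by rewrite !expr0.
    by rewrite !exprS IH scalar_mxM.
  by rewrite mxE -mulrnAr.
rewrite (_ : (fun n => _) = (fun n => exps n a *+ (i == j))); last exact/funext.
by case: (i == j); [exact: exps_cvg|exact: cvg_cst].
Qed.

Lemma comm_scaler_mx m (A : 'M[R]_m) (s t : R) : GRing.comm (s *: A) (t *: A).
Proof.
rewrite /GRing.comm -[LHS]scalemxAl -[RHS]scalemxAl -[in LHS]scalemxAr -[in RHS]scalemxAr.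
by rewrite !scalerA mulrC.
Qed.

Lemma expmx_addt m (A : 'M[R]_m) (s t : R) :
  expmx ((s + t) *: A) = expmx (s *: A) *m expmx (t *: A).
Proof. by rewrite scalerDl expmxD//; exact: comm_scaler_mx. Qed.

Lemma expmx_comm m (A : 'M[R]_m) (t : R) : expmx (t *: A) *m A = A *m expmx (t *: A).
Proof. by apply: expmx_intertwine; rewrite -scalemxAl scalemxAr. Qed.

Lemma expmx_tail2 m (A : 'M[R]_m) t i j : `|t| <= 1 ->
  `|(expmx (t *: A) - 1%:M - t *: A) i j| <= t ^+ 2 * (nrm A ^+ 2 * expR (nrm A)).
Proof.
move=> t1; have := @expmx_tail _ (t *: A) 2 i j.
rewrite expps2 opprD addrA => /le_trans; apply.
rewrite nrmZ exprMn real_normK ?num_real// -mulrA ler_wpM2l ?sqr_ge0//.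
by rewrite ler_wpM2l ?sqr_ge0// ler_expR ler_piMl ?nrm_ge0.
Qed.

Lemma expmx_tail3 m (A : 'M[R]_m) t i j : `|t| <= 1 ->
  `|(expmx (t *: A) - 1%:M - t *: A - (t ^+ 2 / 2) *: (A *m A)) i j| <=
  `|t| ^+ 3 * (nrm A ^+ 3 * expR (nrm A)).
Proof.
move=> t1; have := @expmx_tail _ (t *: A) 3 i j.
rewrite expps3 -scalemxAl -scalemxAr !scalerA !opprD !addrA.
rewrite (_ : 2^-1 * t * t = t ^+ 2 / 2); last by rewrite expr2; ring.
move=> /le_trans; apply.
rewrite nrmZ exprMn -mulrA ler_wpM2l ?exprn_ge0//.
by rewrite ler_wpM2l ?exprn_ge0 ?nrm_ge0// ler_expR ler_piMl ?nrm_ge0.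
Qed.

(** There is no cancellation in the series of a nonnegative matrix, so each single term is a lower
    bound. A positive entry in one power therefore makes the entry of the exponential positive. *)
Lemma expmx_ge0 m (A : 'M[R]_m) : (forall i j, 0 <= A i j) ->
  forall k i j, k`!%:R^-1 * (A ^+ k) i j <= expmx A i j.
Proof.
move=> A0.
have P k i j : 0 <= (A ^+ k) i j.
  elim: k i j => [|k IH] i j; first by rewrite expr0 mxE.
  by rewrite exprS mxE sumr_ge0// => l _; rewrite mulr_ge0.
move=> k i j; have h := @expps_cvg _ A i j.
rewrite -(cvg_lim (@Rhausdorff R) h); apply: limr_ge; first exact: cvgP h.
near=> n; have kn : (k < n)%N by near: n; exact: nbhs_infty_gt.
rewrite /expps summxE big_mkord (bigD1 (Ordinal kn))//= mxE lerDl.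
by rewrite sumr_ge0// => l _; rewrite mxE mulr_ge0 ?invr_ge0.
Unshelve. all: by end_near. Qed.

Lemma expmx_shift m (A : 'M[R]_m) (c : R) :
  expmx A = expR (- c) *: expmx (A + c%:M).
Proof.
rewrite expmxD; last by rewrite /GRing.comm -[LHS]/(A *m _) -[RHS]/(_ *m A) scalar_mxC.
rewrite expmx_scalar mul_mx_scalar scalerA expRN mulVf ?scale1r//.
by rewrite gt_eqF// expR_gt0.
Qed.

End MatrixExponential.

(** * Bounded flows from spectra in the open left half-plane *)

Section SpectralBound.
Context {R : realType}.

Lemma normcD (x y : R[i]) : Normc.normc (x + y) <= Normc.normc x + Normc.normc y.
Proof. exact: (le_normcD (x : Rcomplex R) y). Qed.

Lemma normc_ge0 (x : R[i]) : 0 <= Normc.normc x.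
Proof. by case: x => a b /=; exact: sqrtr_ge0. Qed.

Lemma normc_real (x : R) : Normc.normc (real_complex R x) = `|x|.
Proof. by rewrite /= expr0n addr0 sqrtr_sqr. Qed.

Definition cnrm n p (v : 'M[R[i]]_(n, p)) : R := \sum_i \sum_j Normc.normc (v i j).

Lemma cnrm_ge0 n p (v : 'M[R[i]]_(n, p)) : 0 <= cnrm v.
Proof. by do 2 apply: sumr_ge0 => ? _; exact: normc_ge0. Qed.

Lemma cnrmD n p (u v : 'M[R[i]]_(n, p)) : cnrm (u + v) <= cnrm u + cnrm v.
Proof.
rewrite -big_split; apply: ler_sum => i _; rewrite -big_split; apply: ler_sum => j _.
by rewrite mxE normcD.
Qed.

Lemma cnrmZ n p (a : R[i]) (v : 'M[R[i]]_(n, p)) : cnrm (a *: v) = Normc.normc a * cnrm v.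
Proof.
rewrite /cnrm mulr_sumr; apply: eq_bigr => i _; rewrite mulr_sumr.
by apply: eq_bigr => j _; rewrite mxE Normc.normcM.
Qed.

Lemma cnrm0 n p : cnrm (0 : 'M[R[i]]_(n, p)) = 0.
Proof. by rewrite /cnrm big1// => i _; rewrite big1// => j _; rewrite mxE Normc.normc0. Qed.

Lemma normc_sum (I : Type) (r : seq I) (F : I -> R[i]) :
  Normc.normc (\sum_(i <- r) F i) <= \sum_(i <- r) Normc.normc (F i).
Proof.
elim: r => [|i r IH]; first by rewrite !big_nil Normc.normc0.
by rewrite !big_cons (le_trans (normcD _ _))// lerD2l.
Qed.

Lemma cnrm_mulmx n (B : 'M[R[i]]_n) (v : 'cV[R[i]]_n) (b : R) :
  0 <= b -> (forall i j, Normc.normc (B i j) <= b) ->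
  cnrm (B *m v) <= n%:R * b * cnrm v.
Proof.
move=> b0 Bb.
have -> : n%:R * b * cnrm v = \sum_(i < n) (b * cnrm v).
  by rewrite sumr_const card_ord -[RHS]mulr_natl mulrA.
apply: ler_sum => i _; rewrite big_ord1 mxE (le_trans (normc_sum _ _))//.
rewrite /cnrm mulr_sumr; apply: ler_sum => k _; rewrite big_ord1 Normc.normcM.
by rewrite ler_wpM2r ?normc_ge0.
Qed.

(** From sqrt w <= (1 + w) / 2 with w = |1 + h z|^2. An Euler step along an eigenvalue with negative
    real part thus contracts, up to order h^2. *)
Lemma normc_1addZ (h : R) (z : R[i]) :
  Normc.normc (1 + real_complex R h * z) <=
  1 + h * complex.Re z + h ^+ 2 * (Normc.normc z ^+ 2 / 2).
Proof.
case: z => x y /=; rewrite !mul0r subr0 add0r addr0.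
rewrite sqr_sqrtr ?addr_ge0 ?sqr_ge0//.
set w := _ + _.
have w0 : 0 <= w by rewrite addr_ge0 ?sqr_ge0.
have -> : 1 + h * x + h ^+ 2 * ((x ^+ 2 + y ^+ 2) / 2) = (1 + w) / 2.
  by rewrite /w !exprMn sqrrD exprMn; field.
have := sqr_ge0 (Num.sqrt w - 1); rewrite sqrrB sqr_sqrtr// mulr1 expr1n.
by move=> ?; lra.
Qed.

(** Induction on the linear factors of a polynomial that annihilates v. For u = (A - z) v the flow
    is bounded by induction, and e^{tA} v satisfies g' = z g + e^{tA} u with Re z < 0. Following it
    by Euler steps of one fixed size h gives the bound without a Jordan form or a variation of
    constants integral. *)
Lemma cflow_bounded n (A : 'M[R]_n.+1) (s : seq R[i]) (v : 'cV[R[i]]_n.+1) :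
  (forall z, z \in s -> complex.Re z < 0) ->
  horner_mx (map_mx (real_complex R) A) (\prod_(z <- s) ('X - z%:P)) *m v = 0 ->
  exists C, forall t, 0 <= t ->
    cnrm (map_mx (real_complex R) (expmx (t *: A)) *m v) <= C.
Proof.
set AC := map_mx _ A; pose E t := map_mx (real_complex R) (expmx (t *: A)).
elim: s v => [|z s IH] v sneg.
  rewrite big_nil rmorph1 mul1mx => ->; exists 0 => t _.
  by rewrite mulmx0 cnrm0.
rewrite big_cons mulrC rmorphM/= -mulmxE -mulmxA.
set u := _ *m v => /IH[].
  by move=> y ys; apply: sneg; rewrite in_cons ys orbT.
move=> Cu Cub.
have Cu0 : 0 <= Cu by apply: le_trans (cnrm_ge0 _) (Cub 0 _).
have uE : u = AC *m v - z *: v.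
  by rewrite /u rmorphB/= horner_mx_X horner_mx_C mulmxBl mul_scalar_mx.
have xneg : complex.Re z < 0 by apply: sneg; rewrite mem_head.
set x := complex.Re z in xneg.
pose c := nrm A ^+ 2 * expR (nrm A).
have c0 : 0 <= c by rewrite mulr_ge0 ?sqr_ge0 ?expR_ge0.
pose D := Normc.normc z ^+ 2 / 2 + n.+1%:R * c.
have D0 : 0 <= D.
  by apply: addr_ge0; [apply: divr_ge0 => //; exact: sqr_ge0|exact: mulr_ge0].
(* The terms of [den] serve the three smallness conditions on h = - x / den proved next: h <= 1, h D
   <= - x / 2 and - h x <= 1. *)
pose den := 2 * (D + x ^+ 2 - x + 1).
have x20 := sqr_ge0 x.
have den0 : 0 < den by rewrite /den; lra.
pose h := - x / den.
have h0 : 0 < h by rewrite divr_gt0// oppr_gt0.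
have h1 : h <= 1 by rewrite ler_pdivrMr// /den; lra.
have hD : h * D <= - x / 2.
  rewrite /h mulrAC -mulrA ler_wpM2l//; first by rewrite oppr_ge0 ltW.
  by rewrite ler_pdivrMr// /den; lra.
have hx : 0 <= 1 + h * x / 2.
  suff : h * - x <= 1 by move=> ?; lra.
  by rewrite /h mulrAC ler_pdivrMr// mul1r -expr2 sqrrN /den; lra.
pose G t := cnrm (E t *m v).
have G0 t : 0 <= G t := cnrm_ge0 _.
have step t : 0 <= t -> G (t + h) <= (1 + h * x / 2) * G t + h * Cu.
  move=> t0; rewrite /G.
  have Eth : E (t + h) = E h *m E t by rewrite /E addrC expmx_addt map_mxM.
  have comm : E t *m AC = AC *m E t by rewrite /E /AC -!map_mxM expmx_comm.
  pose rho := E h - 1%:M - real_complex R h *: AC.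
  (* Since A v = z v + u, one step multiplies E t v by 1 + h z, adds h E t u, and leaves the
     second-order remainder [rho]. *)
  have split : E (t + h) *m v = (1 + real_complex R h * z) *: (E t *m v) +
      (real_complex R h *: (E t *m u) + rho *m (E t *m v)).
    rewrite Eth -mulmxA /rho !mulmxBl mul1mx -scalemxAl (mulmxA AC) -comm.
    rewrite uE mulmxBr -scalemxAr -mulmxA scalerBr scalerA scalerDl scale1r.
    move: (E t *m v) (E t *m (AC *m v)) => a e.
    move: (E h *m a) (_ *: a) (_ *: e) => b d f.
    by apply/matrixP => i j; rewrite !mxE; ring.
  rewrite split; apply: le_trans (cnrmD _ _) _.
  apply: le_trans (lerD (le_refl _) (cnrmD _ _)) _.
  rewrite !cnrmZ normc_real gtr0_norm//.
  have rb : cnrm (rho *m (E t *m v)) <= n.+1%:R * (h ^+ 2 * c) * G t.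
    apply: cnrm_mulmx => [|i j]; first by rewrite mulr_ge0 ?sqr_ge0.
    have -> : rho = map_mx (real_complex R) (expmx (h *: A) - 1%:M - h *: A).
      by rewrite !map_mxB map_mx1 map_mxZ.
    by rewrite mxE normc_real expmx_tail2// gtr0_norm.
  have zb : Normc.normc (1 + real_complex R h * z) * G t <=
      (1 + h * x + h ^+ 2 * (Normc.normc z ^+ 2 / 2)) * G t.
    by rewrite ler_wpM2r ?normc_1addZ.
  have ub : h * cnrm (E t *m u) <= h * Cu by rewrite ler_wpM2l ?(ltW h0)// Cub.
  have hDG : h * (h * D) * G t <= h * (- x / 2) * G t.
    by rewrite ler_wpM2r// ler_wpM2l// ltW.
  move: zb rb hDG ub; rewrite -/(G t) /D => zb rb hDG ub.
  apply: le_trans (lerD zb (lerD ub rb)) _.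
  by move: hDG; move: (G t) (Normc.normc z) => g w; lra.
pose B0 := n.+1%:R * expR (nrm A) * cnrm v.
have G1 t : 0 <= t -> t <= 1 -> G t <= B0.
  move=> t0 t1; apply: cnrm_mulmx => [|i j]; first exact: expR_ge0.
  rewrite mxE normc_real; have := @expmx_tail _ _ (t *: A) 0 i j.
  rewrite /expps big_nil subr0 expr0 mul1r => /le_trans; apply.
  by rewrite ler_expR nrmZ ler_piMl ?nrm_ge0 ?ger0_norm.
(* The second argument is the fixed point of g -> (1 + h x / 2) g + h Cu, so the bound [B] survives
   each step; the first covers the initial interval [0, 1]. *)
pose B := Num.max B0 (Cu / (- x / 2)).
have CuB : h * Cu <= h * (- x / 2) * B.
  rewrite -mulrA ler_wpM2l ?(ltW h0)// -ler_pdivrMl; last lra.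
  by rewrite mulrC le_max lexx orbT.
exists B => t t0.
have key k : forall t, 0 <= t -> t <= k%:R * h -> G t <= B.
  elim: k => [|k IHk] {}t {}t0 tk.
    rewrite le_max G1// (le_trans tk)// mul0r ler01//.
  have [th|th] := leP t h; first by rewrite le_max G1// (le_trans th).
  rewrite -(subrK h t).
  apply: le_trans (step _ _) _; first by rewrite subr_ge0 ltW.
  have : G (t - h) <= B.
    by apply: IHk; [rewrite subr_ge0 ltW|rewrite lerBlDr (le_trans tk)// -natr1 mulrDl mul1r].
  move=> /(ler_wpM2l hx) H; apply: le_trans (lerD H CuB) _.
  by rewrite -mulrDl le_eqVlt; apply/orP; left; apply/eqP; field.
have [k kt] : exists k : nat, t / h <= k%:R.
  exists (Num.bound (t / h)); apply/ltW/archi_boundP.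
  by rewrite divr_ge0// ltW.
by apply: (key k) => //; rewrite -ler_pdivrMr.
Qed.

(** The characteristic polynomial splits over the complex numbers and, by Cayley-Hamilton,
    annihilates every basis vector. *)
Lemma spectrum_neg_bounded n (A : 'M[R]_n) : spectrum_neg A ->
  exists C, forall t i j, 0 <= t -> `|expmx (t *: A) i j| <= C.
Proof.
case: n A => [|n] A sA; first by exists 0 => t [].
set AC := map_mx (real_complex R) A.
have [s ps] := closed_field_poly_normal (char_poly AC).
rewrite (monicP (char_poly_monic AC)) scale1r in ps.
have sneg z : z \in s -> complex.Re z < 0.
  move=> zs; apply: sA; rewrite /eigenvalueC eigenvalue_root_char -/AC ps.
  by rewrite root_prod_XsubC.
have H (j : 'I_n.+1) : exists C : R, forall t : R, 0 <= t ->
    cnrm (map_mx (real_complex R) (expmx (t *: A)) *m (delta_mx j 0 : 'cV_n.+1)) <= C.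
  by apply: (@cflow_bounded _ A s _ sneg); rewrite -ps Cayley_Hamilton mul0mx.
have [f fP] := choice H.
exists (\sum_j f j) => t i j t0.
have f0 k : 0 <= f k by apply: le_trans (cnrm_ge0 _) (fP k 0 _).
apply: (@le_trans _ _ (f j)); last by rewrite (bigD1 j)//= lerDl sumr_ge0.
apply: le_trans (fP j t t0); rewrite -colE -normc_real.
rewrite /cnrm (bigD1 i)//= big_ord1 !mxE -[leLHS]addr0 lerD// sumr_ge0// => k _.
by apply: sumr_ge0 => l _; exact: normc_ge0.
Qed.

End SpectralBound.

(** * Metzler matrices and generators *)

Section Metzler.
Context {R : realType} {m : nat}.
Implicit Types A M Q : 'M[R]_m.

Definition metzler A := forall i j, i != j -> 0 <= A i j.

Lemma metzler_shift A (c : R) : metzler A -> nrm A <= c ->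
  forall i j, 0 <= (A + c%:M) i j.
Proof.
move=> mA Ac i j; rewrite !mxE; case: eqVneq => [<-|ij]; last by rewrite mulr0n addr0 mA.
rewrite mulr1n -lerBlDl sub0r (le_trans _ Ac)// (le_trans (ler_norm _))//.
by rewrite normrN entry_le_nrm.
Qed.

Lemma expmx_ge_pow A (c t : R) k i j : metzler A -> nrm A <= c -> 0 <= t ->
  expR (- (t * c)) * (k`!%:R^-1 * (t ^+ k * ((A + c%:M) ^+ k) i j)) <=
  expmx (t *: A) i j.
Proof.
move=> mA Ac t0; rewrite (expmx_shift _ (t * c)) [leRHS]mxE ler_wpM2l ?expR_ge0//.
have -> : t *: A + (t * c)%:M = t *: (A + c%:M) by rewrite scalerDr scale_scalar_mx.
have -> : t ^+ k * ((A + c%:M) ^+ k) i j = ((t *: (A + c%:M)) ^+ k) i j.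
  have -> : (t *: (A + c%:M)) ^+ k = t ^+ k *: (A + c%:M) ^+ k; last by rewrite mxE.
  elim: k => [|k IH]; first by rewrite !expr0 scale1r.
  rewrite exprS IH -[LHS]/(_ *m _) -scalemxAl -scalemxAr scalerA -exprS.
  by rewrite [in RHS](exprS (A + c%:M)).
apply: expmx_ge0 => p q; rewrite mxE mulr_ge0//; exact: metzler_shift.
Qed.

Lemma metzler_expmx_ge0 A (t : R) i j : metzler A -> 0 <= t ->
  0 <= expmx (t *: A) i j.
Proof.
move=> mA t0; apply: le_trans (expmx_ge_pow 0 i j mA (lexx _) t0).
by rewrite !expr0 mul1r mulr_ge0 ?expR_ge0// mulr_ge0 ?invr_ge0// mxE; case: eqP.
Qed.

(** A path of length k from i to j in the graph of [A] makes the corresponding entry of the k-th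
    power of the shifted matrix positive. *)
Lemma metzler_expmx_gt0 A (t : R) i j : metzler A -> is_irreducible A -> 0 < t ->
  0 < expmx (t *: A) i j.
Proof.
move=> mA iA t0; pose c := nrm A + 1.
have Ac : nrm A <= c by rewrite lerDl.
suff [k kP] : exists k, 0 < ((A + c%:M) ^+ k) i j.
  apply: lt_le_trans (expmx_ge_pow k i j mA Ac (ltW t0)).
  by rewrite mulr_gt0 ?expR_gt0// mulr_gt0 ?invr_gt0 ?ltr0n ?fact_gt0// mulr_gt0 ?exprn_gt0.
have [p ip ->] := connectP (iA i j).
exists (size p); elim: p i ip {j} => [|x p IH] i /=.
  by move=> _; rewrite expr0 mxE eqxx.
move=> /andP[/andP[ix Aix] /IH{}IH]; rewrite exprS mxE.
have P0 := metzler_shift mA Ac.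
have Pk k r s : 0 <= ((A + c%:M) ^+ k) r s.
  elim: k r s => [|k IHk] r s; first by rewrite expr0 mxE; case: eqP.
  by rewrite exprS mxE sumr_ge0// => l _; rewrite mulr_ge0.
rewrite (bigD1 x)//= ltr_wpDr ?sumr_ge0// => [l _|]; first by rewrite mulr_ge0.
by rewrite mulr_gt0// !mxE (negbTE ix) mulr0n addr0.
Qed.

Lemma unitmx_col_inj A : (forall x : 'cV[R]_m, A *m x = 0 -> x = 0) -> A \in unitmx.
Proof.
move=> inj; rewrite -unitmx_tr -row_free_unit -kermx_eq0; apply/eqP/row_matrixP => i.
rewrite row0; apply: (can_inj (@trmxK _ _ _)); rewrite trmx0; apply: inj.
apply: (can_inj (@trmxK _ _ _)); rewrite trmx_mul trmxK trmx0.
by apply/sub_kermxP; exact: row_sub.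
Qed.

(** The reciprocal of a sum replaces a minimum over the indices; the added 1 keeps it meaningful for
    an empty index type. *)
Lemma strict_ratio (a c : 'I_m -> R) : (forall i, 0 < a i) -> (forall i, 0 < c i) ->
  exists2 k, 0 < k & forall i, k * a i <= c i.
Proof.
move=> a0 c0; pose S := 1 + \sum_i a i / c i.
have q0 i : 0 <= a i / c i by rewrite divr_ge0 ?ltW.
have S0 : 0 < S by rewrite ltr_pwDl// sumr_ge0.
exists S^-1; first by rewrite invr_gt0.
move=> i; rewrite mulrC ler_pdivrMr// mulrC -ler_pdivrMr// /S.
by rewrite (bigD1 i)//= addrCA lerDl addr_ge0// sumr_ge0.
Qed.

(** The number a M y is nonnegative when read as a (M y), and a sum of nonpositive terms when read
    as (a M) y. So each term vanishes, and the coefficients of a M are not zero. *)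
Lemma metzler_subinvariant_zero M (a : 'rV[R]_m) (y : 'cV[R]_m) :
  (forall i, 0 < a 0 i) -> (forall i, (a *m M) 0 i < 0) ->
  (forall i, 0 <= y i 0) -> (forall i, 0 <= (M *m y) i 0) -> y = 0.
Proof.
move=> a0 aM y0 My.
have h1 : 0 <= (a *m (M *m y)) 0 0.
  by rewrite mxE sumr_ge0// => i _; rewrite mulr_ge0// ltW.
rewrite mulmxA mxE in h1.
have h2 i : 0 <= - ((a *m M) 0 i * y i 0) by rewrite -mulNr mulr_ge0// oppr_ge0 ltW.
have : \sum_i - ((a *m M) 0 i * y i 0) = 0.
  by apply/eqP; rewrite eq_le sumr_ge0// andbT sumrN oppr_le0.
move=> /eqP; rewrite psumr_eq0// => /allP z.
apply/matrixP => i j; rewrite ord1 [RHS]mxE.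
have := z i (mem_index_enum _); rewrite /= oppr_eq0 mulf_eq0 lt_eqF//=.
by move/eqP.
Qed.

(** If M x = 0, the triangle inequality for the shifted, nonnegative matrix gives M |x| >= 0, and
    [metzler_subinvariant_zero] forces |x| = 0. *)
Lemma metzler_unitmx M (a : 'rV[R]_m) : metzler M ->
  (forall i, 0 < a 0 i) -> (forall i, (a *m M) 0 i < 0) -> M \in unitmx.
Proof.
move=> mM a0 aM; apply: unitmx_col_inj => x Mx.
pose y : 'cV[R]_m := \col_i `|x i 0|; pose c := nrm M.
suff y0 : y = 0.
  apply/matrixP => i j; rewrite ord1 [RHS]mxE; apply/eqP; rewrite -normr_eq0.
  by have /matrixP/(_ i 0) := y0; rewrite !mxE => ->.
apply: (metzler_subinvariant_zero a0 aM) => i; first by rewrite mxE.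
have -> : M *m y = (M + c%:M) *m y - c *: y by rewrite mulmxDl mul_scalar_mx addrK.
rewrite [leRHS]mxE [X in _ + X]mxE [X in _ - X]mxE subr_ge0.
have -> : c * y i 0 = `|((M + c%:M) *m x) i 0|.
  rewrite mulmxDl Mx add0r mul_scalar_mx !mxE normrM ger0_norm//; exact: nrm_ge0.
rewrite mxE [leRHS]mxE; apply: le_trans (ler_norm_sum _ _ _) _.
apply: ler_sum => j _; rewrite normrM [y _ _]mxE ler_wpM2r// ger0_norm//.
exact: metzler_shift.
Qed.

Lemma metzler_right_super M (a : 'rV[R]_m) : metzler M ->
  (forall i, 0 < a 0 i) -> (forall i, (a *m M) 0 i < 0) ->
  exists2 b : 'cV[R]_m, (forall i, 0 < b i 0) & M *m b = - ones R m.
Proof.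
move=> mM a0 aM; have Mu := metzler_unitmx mM a0 aM.
pose b := - (invmx M *m ones R m).
have Mb : M *m b = - ones R m by rewrite mulmxN mulmxA mulmxV// mul1mx.
pose c := nrm M; have P0 := metzler_shift mM (lexx c).
have cb i : c * b i 0 = ((M + c%:M) *m b) i 0 + 1.
  by rewrite mulmxDl Mb mul_scalar_mx !mxE; ring.
pose y : 'cV[R]_m := \col_i Num.max 0 (- b i 0).
have y0 i : 0 <= y i 0 by rewrite mxE le_max lexx.
have yE : y = 0.
  apply: (metzler_subinvariant_zero a0 aM) => // i.
  have -> : M *m y = (M + c%:M) *m y - c *: y by rewrite mulmxDl mul_scalar_mx addrK.
  rewrite [leRHS]mxE [X in _ + X]mxE [X in _ - X]mxE subr_ge0.
  have N0 : 0 <= ((M + c%:M) *m y) i 0 by rewrite mxE sumr_ge0// => j _; rewrite mulr_ge0.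
  rewrite [y i 0]mxE; have [b0|b0] := leP 0 (- b i 0); last by rewrite mulr0.
  rewrite mulrN cb opprD lerBlDr ler_wpDr// [leRHS]mxE [X in - X]mxE -sumrN.
  by apply: ler_sum => j _; rewrite -mulrN ler_wpM2l// [y _ _]mxE le_max lexx orbT.
have b0 i : 0 <= b i 0.
  have /matrixP/(_ i 0) := yE; rewrite !mxE => /eqP.
  by rewrite eq_le => /andP[]; rewrite ge_max lexx/= oppr_le0.
exists b => // i; rewrite lt_neqAle b0 andbT eq_sym; apply/eqP => bi.
have := cb i; rewrite bi mulr0 => /eqP; rewrite lt_eqF// ltr_wpDl// mxE.
by apply: sumr_ge0 => j _; rewrite mulr_ge0.
Qed.

End Metzler.

Section Generator.
Context {R : realType} {m : nat}.
Variables (Q : 'M[R]_m) (hQ : is_generator Q).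

Lemma generator_metzler : metzler Q. Proof. by case: hQ. Qed.

Lemma expmx_generator_ones (t : R) : expmx (t *: Q) *m ones R m = ones R m.
Proof.
rewrite (@expmx_intertwine _ _ _ _ (0 : 'M[R]_1)) ?expmx0 ?mulmx1//.
by rewrite -scalemxAl hQ.2 scaler0 mulmx0.
Qed.

Lemma expmx_left_null (xi : 'rV[R]_m) (t : R) : xi *m Q = 0 -> xi *m expmx (t *: Q) = xi.
Proof.
move=> xiQ; rewrite -(@expmx_intertwine _ _ _ (0 : 'M[R]_1)) ?expmx0 ?mul1mx//.
by rewrite mul0mx -scalemxAr xiQ scaler0.
Qed.

Lemma expmx_generator_rowsum (t : R) i : \sum_j expmx (t *: Q) i j = 1.
Proof.
have /matrixP/(_ i 0) := expmx_generator_ones t; rewrite !mxE => <-.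
by apply: eq_bigr => j _; rewrite [ones _ _ _ _]mxE mulr1.
Qed.

Hypothesis irr : is_irreducible Q.

(** The positive part p of [xi] satisfies p <= p P for the stochastic matrix P = e^Q. Both sides
    have the same total mass, so p = p P, which is positive everywhere because P is. *)
Lemma generator_left_null_pos (xi : 'rV[R]_m) i0 : xi *m Q = 0 -> 0 < xi 0 i0 ->
  forall i, 0 < xi 0 i.
Proof.
move=> xiQ xi0; pose P := expmx ((1 : R) *: Q).
have Ppos i j : 0 < P i j := metzler_expmx_gt0 i j generator_metzler irr ltr01.
have xiP : xi *m P = xi by exact: expmx_left_null.
pose p : 'rV[R]_m := \row_i Num.max 0 (xi 0 i).
have p0 i : 0 <= p 0 i by rewrite mxE le_max lexx.
have pxi i : xi 0 i <= p 0 i by rewrite mxE le_max lexx orbT.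
have pP i : p 0 i <= (p *m P) 0 i.
  rewrite [leLHS]mxE ge_max; apply/andP; split.
    by rewrite mxE sumr_ge0// => k _; rewrite mulr_ge0// ltW.
  rewrite -{1}xiP !mxE; apply: ler_sum => k _.
  by rewrite ler_wpM2r ?(ltW (Ppos _ _)).
have sE : \sum_i ((p *m P) 0 i - p 0 i) = 0.
  rewrite sumrB; under eq_bigr do rewrite mxE.
  rewrite exchange_big/=; under eq_bigr do rewrite -mulr_sumr expmx_generator_rowsum mulr1.
  by rewrite subrr.
move/eqP: sE; rewrite psumr_eq0; last by move=> i _; rewrite subr_ge0.
move=> /allP pE i.
have := pE i (mem_index_enum _); rewrite /= subr_eq0 => /eqP ppi.
have : 0 < p 0 i.
  rewrite -ppi mxE (bigD1 i0)//= ltr_pwDl//.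
    by rewrite mulr_gt0// (lt_le_trans xi0).
  by rewrite sumr_ge0// => k _; rewrite mulr_ge0// ltW.
by rewrite mxE lt_max ltxx.
Qed.

(** Says that the left null space is at most a line: a nonzero entry, up to sign, would make all
    entries positive and hence the sum positive. *)
Lemma generator_left_null_sum0 (xi : 'rV[R]_m) : xi *m Q = 0 -> \sum_i xi 0 i = 0 -> xi = 0.
Proof.
move=> xiQ s0; apply/matrixP => i0 j; rewrite ord1 {i0} [RHS]mxE.
have S (eta : 'rV[R]_m) : eta *m Q = 0 -> \sum_i eta 0 i = 0 -> ~ 0 < eta 0 j.
  move=> eQ e0 ej; have ep := generator_left_null_pos eQ ej.
  have : 0 < \sum_i eta 0 i.
    by rewrite (bigD1 j)//= ltr_pwDl// sumr_ge0// => k _; rewrite ltW.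
  by rewrite e0 ltxx.
case: (ltgtP (xi 0 j) 0) => // [xj|xj]; last by case: (S _ xiQ s0 xj).
case: (S (- xi)); rewrite ?mulNmx ?xiQ ?oppr0//; last by rewrite mxE oppr_gt0.
by under eq_bigr do rewrite mxE; rewrite sumrN s0 oppr0.
Qed.

(** The value at a maximizing state is an average, with positive weights, of all the values. *)
Lemma generator_right_null (z : 'cV[R]_m) : Q *m z = 0 -> forall i j, z i 0 = z j 0.
Proof.
move=> Qz; pose P := expmx ((1 : R) *: Q).
have Ppos i j : 0 < P i j := metzler_expmx_gt0 i j generator_metzler irr ltr01.
have Pz : P *m z = z.
  rewrite (@expmx_intertwine _ _ _ _ (0 : 'M[R]_1)) ?expmx0 ?mulmx1//.
  by rewrite -scalemxAl Qz scaler0 mulmx0.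
suff H (i : 'I_m) : exists k, forall j, z j 0 = z k 0.
  by move=> i j; have [k kP] := H i; rewrite !kP.
have [k _ kmax] := @arg_maxP _ _ _ i xpredT (fun i => z i 0) isT; exists k => j.
have d0 l : 0 <= P k l * (z k 0 - z l 0).
  by rewrite mulr_ge0 ?(ltW (Ppos _ _))// subr_ge0; exact: kmax.
have : \sum_l P k l * (z k 0 - z l 0) = 0.
  under eq_bigr do rewrite mulrBr; rewrite sumrB -mulr_suml expmx_generator_rowsum mul1r.
  by have /matrixP/(_ k 0) := Pz; rewrite mxE => ->; rewrite subrr.
move=> /eqP; rewrite psumr_eq0// => /allP /(_ j (mem_index_enum _)) /=.
by rewrite mulf_eq0 gt_eqF//= subr_eq0 => /eqP.
Qed.

Variable (alpha : 'rV[R]_m).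
Hypothesis halpha : is_stationary Q alpha.

Lemma stationary_gt0 i : 0 < alpha 0 i.
Proof.
case: halpha => a0 aQ a1.
have [j aj] : exists j, 0 < alpha 0 j.
  apply: contrapT => /forallNP h.
  move: a1; rewrite big1 => [/eqP|j _]; first by rewrite eq_sym oner_eq0.
  by apply/eqP; rewrite eq_le a0 andbT leNgt; apply/negP.
exact: generator_left_null_pos aQ aj i.
Qed.

(** Fredholm alternative by counting ranks: the left kernel of Q is spanned by alpha, so the row
    space of Q has dimension m - 1 and fills the space of rows with zero sum that contains it. *)
Lemma generator_left_solve (g : 'rV[R]_m) : \sum_i g 0 i = 0 -> exists b, b *m Q = g.
Proof.
move=> g0; case: halpha => _ aQ a1.
have kerQ : (kermx Q <= alpha)%MS.
  apply/row_subP => i; set u := row i _.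
  have uQ : u *m Q = 0 by apply/sub_kermxP; exact: row_sub.
  move: u uQ => u uQ.
  suff -> : u = (\sum_i u 0 i) *: alpha by rewrite scalemx_sub.
  apply/eqP; rewrite -subr_eq0; apply/eqP; apply: generator_left_null_sum0.
    by rewrite mulmxBl uQ -scalemxAl aQ scaler0 subrr.
  under eq_bigr do rewrite !mxE.
  by rewrite sumrB -mulr_sumr a1 mulr1 subrr.
have rk : (m <= (\rank Q).+1)%N.
  have := mxrank_ker Q; have := mxrankS kerQ; have := rank_leq_row alpha.
  by have := rank_leq_row Q; lia.
have Qk : (Q <= kermx (ones R m))%MS by apply/sub_kermxP; exact: hQ.2.
have ron : \rank (ones R m) = 1%N.
  apply/eqP; rewrite eqn_leq rank_leq_col/= lt0n mxrank_eq0; apply/eqP => o0.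
  move: a1; rewrite (_ : \sum_i alpha 0 i = (alpha *m ones R m) 0 0).
    by rewrite o0 mulmx0 mxE => /eqP; rewrite eq_sym oner_eq0.
  by rewrite mxE; apply: eq_bigr => i _; rewrite mxE mulr1.
have rko : \rank (kermx (ones R m)) = (m - 1)%N by rewrite mxrank_ker ron.
have Qeq : (kermx (ones R m) <= Q)%MS.
  by rewrite -(geq_leqif (mxrank_leqif_sup Qk)) rko; lia.
have /submxP[b bE] : (g <= Q)%MS.
  apply: submx_trans Qeq; apply/sub_kermxP/matrixP => i j.
  rewrite !ord1 !mxE -[RHS]g0; apply: eq_bigr => k _; by rewrite mxE mulr1.
by exists b.
Qed.

End Generator.

(** * Taylor estimates for matrix flows and tests at a minimum *)

Section LocalExpansion.
Context {R : realType}.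

Lemma le0_of_le_small (x c d : R) : 0 < d -> 0 <= c ->
  (forall t, 0 < t -> t <= d -> x <= t * c) -> x <= 0.
Proof.
move=> d0 c0 h; rewrite leNgt; apply/negP => x0.
have cc : 0 < 2 * (c + 1) by rewrite mulr_gt0// ltr_wpDl.
pose t := Num.min d (x / (2 * (c + 1))).
have t0 : 0 < t by rewrite lt_min d0 divr_gt0.
have td : t <= d by rewrite ge_min lexx.
have tx : t * (2 * (c + 1)) <= x by rewrite -ler_pdivlMr// ge_min lexx orbT.
have tc : 0 <= t * c by rewrite mulr_ge0// ltW.
by have := h t t0 td; lra.
Qed.

(** The first and second derivative tests at an interior minimum, with the derivatives replaced by
    the coefficients of an expansion with cubic remainder. *)
Lemma taylor2_min (f : R -> R) (f0 p q K d : R) : 0 < d -> 0 <= K ->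
  (forall e, `|e| <= d -> `|f e - f0 - e * p - e ^+ 2 / 2 * q| <= `|e| ^+ 3 * K) ->
  (forall e, `|e| <= d -> f0 <= f e) -> p = 0 /\ 0 <= q.
Proof.
move=> d0 K0 fT fmin.
have G e : `|e| <= d -> 0 <= e * p + e ^+ 2 / 2 * q + `|e| ^+ 3 * K.
  move=> ed; have := fT e ed; have := fmin e ed; rewrite ler_norml => fm /andP[_].
  by lra.
have p0 : p = 0.
  apply/eqP; rewrite -normr_le0.
  apply: (@le0_of_le_small _ (`|q| / 2 + d ^+ 1 * K) d) => //.
    by rewrite addr_ge0 ?mulr_ge0// ltW.
  move=> t t0 td.
  have tp : - t * `|p| + t ^+ 2 / 2 * q + t ^+ 3 * K >= 0.
    have [pp|pn] := leP 0 p.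
      by have := G (- t); rewrite normrN (gtr0_norm t0) (ger0_norm pp) sqrrN => /(_ td).
    by have := G t; rewrite (gtr0_norm t0) (ltr0_norm pn) mulrNN => /(_ td).
  have tq : t ^+ 2 / 2 * q <= t ^+ 2 / 2 * `|q|.
    by rewrite ler_wpM2l ?ler_norm// mulr_ge0 ?sqr_ge0.
  have tK : t ^+ 3 * K <= t ^+ 2 * d * K.
    by rewrite ler_wpM2r// exprSr ler_wpM2l ?sqr_ge0.
  rewrite -(ler_pM2l t0) expr1.
  have := tp; rewrite -[t * _ * _]mulrA; move: tq tK; lra.
split=> //; rewrite -oppr_le0.
apply: (@le0_of_le_small _ (2 * K) d) => //; first by rewrite mulr_ge0.
move=> t t0 td; have := G t; rewrite gtr0_norm// p0 mulr0 add0r => /(_ td) h.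
have t2 : 0 < t ^+ 2 / 2 by rewrite divr_gt0 ?exprn_gt0.
rewrite -(ler_pM2l t2); move: h; lra.
Qed.

Lemma expmx_taylor_col m (A : 'M[R]_m) (w : 'cV[R]_m) :
  exists2 K, 0 <= K & forall e i, `|e| <= 1 ->
  `|(expmx (e *: A) *m w) i 0 - w i 0 - e * (A *m w) i 0
     - e ^+ 2 / 2 * (A *m (A *m w)) i 0| <= `|e| ^+ 3 * K.
Proof.
pose c := nrm A ^+ 3 * expR (nrm A).
have c0 : 0 <= c by rewrite mulr_ge0 ?exprn_ge0 ?nrm_ge0 ?expR_ge0.
exists (c * \sum_k `|w k 0|); first by rewrite mulr_ge0// sumr_ge0.
move=> e i e1.
pose E := expmx (e *: A) - 1%:M - e *: A - (e ^+ 2 / 2) *: (A *m A).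
have -> : (expmx (e *: A) *m w) i 0 - w i 0 - e * (A *m w) i 0
     - e ^+ 2 / 2 * (A *m (A *m w)) i 0 = (E *m w) i 0.
  rewrite /E !mulmxBl mul1mx -!scalemxAl (mulmxA A A w).
  move: (expmx _ *m w) (A *m w) (A *m A *m w) => a b d.
  by rewrite !mxE.
rewrite mxE; apply: le_trans (ler_norm_sum _ _ _) _.
rewrite mulrA mulr_sumr; apply: ler_sum => k _.
by rewrite normrM ler_wpM2r// expmx_tail3.
Qed.

Lemma expmx_taylor_row m (A : 'M[R]_m) (e : R) (w : 'rV[R]_m) i : `|e| <= 1 ->
  `|(w *m expmx (e *: A)) 0 i - w 0 i - e * (w *m A) 0 i
     - e ^+ 2 / 2 * (w *m A *m A) 0 i| <=
  `|e| ^+ 3 * (nrm A ^+ 3 * expR (nrm A) * \sum_k `|w 0 k|).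
Proof.
pose c := nrm A ^+ 3 * expR (nrm A) => e1.
pose E := expmx (e *: A) - 1%:M - e *: A - (e ^+ 2 / 2) *: (A *m A).
have -> : (w *m expmx (e *: A)) 0 i - w 0 i - e * (w *m A) 0 i
     - e ^+ 2 / 2 * (w *m A *m A) 0 i = (w *m E) 0 i.
  rewrite /E !mulmxBr mulmx1 -!scalemxAr (mulmxA w A A).
  move: (w *m expmx _) (w *m A) (w *m A *m A) => a b d.
  by rewrite !mxE.
rewrite mxE; apply: le_trans (ler_norm_sum _ _ _) _.
rewrite mulrA mulr_sumr; apply: ler_sum => k _.
by rewrite normrM mulrC ler_wpM2r// expmx_tail3.
Qed.

Lemma expmx_entry_le m (A : 'M[R]_m) i j : `|expmx A i j| <= expR (nrm A).
Proof.
have := @expmx_tail _ _ A 0 i j.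
by rewrite /expps big_nil subr0 expr0 mul1r.
Qed.

Lemma expmx_entry_continuous m (A : 'M[R]_m) i j :
  continuous (fun y : R => expmx (y *: A) i j).
Proof.
move=> y; apply/cvgrPdist_le => eps eps0.
pose c := nrm A * expR (nrm A) * (m%:R * expR (nrm (y *: A))) + 1.
have c0 : 0 < c.
  by rewrite ltr_wpDl// ?mulr_ge0 ?nrm_ge0 ?expR_ge0.
near=> z.
have zd : `|y - z| <= Num.min 1 (eps / c).
  by near: z; apply: cvgr_dist_le; [exact: cvg_id|rewrite lt_min ltr01 divr_gt0].
move: zd; rewrite le_min distrC => /andP[z1 zc].
have -> : z = (z - y) + y by rewrite subrK.
set e := z - y in z1 zc *; set Y := expmx (y *: A).
have -> : `|Y i j - expmx ((e + y) *: A) i j| =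
    `|((expmx (e *: A) - expps 1 (e *: A)) *m Y) i j|.
  rewrite distrC expmx_addt mulmxBl.
  rewrite (_ : expps 1 (e *: A) = 1%:M); last first.
    by rewrite /expps big_nat1 expr0 fact0 invr1 scale1r.
  by rewrite mul1mx [in RHS]mxE [X in _ = `|_ + X|]mxE.
rewrite mxE; apply: le_trans (ler_norm_sum _ _ _) _.
apply: (@le_trans _ _ (\sum_(k < m) `|e| * (nrm A * expR (nrm A)) * expR (nrm (y *: A)))).
  apply: ler_sum => k _; rewrite normrM; apply: ler_pM => //; last exact: expmx_entry_le.
  apply: le_trans (expmx_tail _ _ _ _) _; rewrite expr1 nrmZ -mulrA ler_wpM2l//.
  by rewrite ler_wpM2l ?nrm_ge0// ler_expR ler_piMl ?nrm_ge0.
rewrite sumr_const card_ord -mulr_natl.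
move: zc; rewrite ler_pdivlMr// => /(le_trans _); apply.
rewrite [leLHS](_ : _ = `|e| * (c - 1)); last by rewrite /c; ring.
by rewrite ler_wpM2l// lerBlDr lerDl.
Unshelve. all: by end_near. Qed.

End LocalExpansion.

Lemma diag_mxE {R : realType} m n (d : 'rV[R]_m) (A : 'M[R]_(m, n)) i j :
  (diag_mx d *m A) i j = d 0 i * A i j.
Proof. by rewrite mul_diag_mx mxE. Qed.

Lemma mx_diagE {R : realType} m n (d : 'rV[R]_n) (A : 'M[R]_(m, n)) i j :
  (A *m diag_mx d) i j = A i j * d 0 j.
Proof. by rewrite mul_mx_diag mxE. Qed.

(** * The matrices U and L *)

Section Symbol.
Context {R : realType} {m : nat}.
Variables (mu sigma : 'rV[R]_m) (Q : 'M[R]_m).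

(** The matrix exponent of the free process: E[e^{theta X(t)}; phi(t) = j] given phi(0) = i is the
    entry (i, j) of [expmx (t *: symbol theta)]. *)
Definition symbol (theta : R) : 'M[R]_m :=
  (theta ^+ 2 / 2) *: (diag_mx sigma *m diag_mx sigma) + theta *: diag_mx mu + Q.

Lemma row_symbol theta (a : 'rV[R]_m) i : (a *m symbol theta) 0 i =
  theta ^+ 2 / 2 * sigma 0 i ^+ 2 * a 0 i + theta * mu 0 i * a 0 i + (a *m Q) 0 i.
Proof.
rewrite /symbol !mulmxDr -!scalemxAr mulmxA [LHS]mxE; congr (_ + _).
by rewrite [LHS]mxE [X in X + _]mxE [X in _ + X]mxE !mx_diagE; ring.
Qed.

Lemma symbol_col theta (a : 'cV[R]_m) i : (symbol theta *m a) i 0 =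
  theta ^+ 2 / 2 * sigma 0 i ^+ 2 * a i 0 + theta * mu 0 i * a i 0 + (Q *m a) i 0.
Proof.
rewrite /symbol !mulmxDl -!scalemxAl -mulmxA [LHS]mxE; congr (_ + _).
by rewrite [LHS]mxE [X in X + _]mxE [X in _ + X]mxE !diag_mxE; ring.
Qed.

Lemma metzler_symbol theta : is_generator Q -> metzler (symbol theta).
Proof.
move=> [Q0 _] i j ij; rewrite /symbol mul_diag_mx !mxE (negbTE ij).
by rewrite !(mulr0n, mulr0, add0r) Q0.
Qed.

(** Perturbation of alpha: for a = alpha + theta b, the row a times the symbol has no term of order
    0, and [b] is chosen so that the first-order term is theta times [mbar *: alpha], which is
    negative. The equation for [b] is solvable since its right-hand side sums to 0 by the definition
    of [mbar]. *)
Lemma left_supersolution (alpha : 'rV[R]_m) :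
  is_generator Q -> is_irreducible Q -> is_stationary Q alpha ->
  \sum_i alpha 0 i * mu 0 i < 0 ->
  exists2 theta0, 0 < theta0 & forall theta, 0 < theta -> theta <= theta0 ->
  exists a : 'rV[R]_m, (forall i, 0 < a 0 i) /\ (forall i, (a *m symbol theta) 0 i < 0).
Proof.
move=> hQ iQ ha; set mbar := \sum_i _ => mneg.
have apos := stationary_gt0 hQ iQ ha; have [_ aQ a1] := ha.
have [b bQ] : exists b : 'rV[R]_m, b *m Q = \row_i (mbar * alpha 0 i - alpha 0 i * mu 0 i).
  apply: (generator_left_solve hQ iQ ha); under eq_bigr do rewrite mxE.
  by rewrite sumrB -mulr_sumr a1 mulr1 subrr.
pose K i := sigma 0 i ^+ 2 / 2 * alpha 0 i + sigma 0 i ^+ 2 / 2 * `|b 0 i|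
            + `|mu 0 i| * `|b 0 i| + 1.
have s0 i : 0 <= sigma 0 i ^+ 2 / 2 by rewrite divr_ge0 ?sqr_ge0.
have K0 i : 0 < K i.
  rewrite /K ltr_wpDl//; apply: addr_ge0; last exact: mulr_ge0.
  by apply: addr_ge0; apply: mulr_ge0 => //; exact: ltW.
have mneg' : 0 < - mbar by rewrite oppr_gt0.
have [k1 k10 k1P] := @strict_ratio _ _ K (fun i => - mbar * alpha 0 i) K0
  (fun i => mulr_gt0 mneg' (apos i)).
have b1 i : 0 < `|b 0 i| + 1 by rewrite ltr_wpDl.
have [k2 k20 k2P] := @strict_ratio _ _ (fun i => `|b 0 i| + 1) (fun i => alpha 0 i) b1 apos.
exists (Num.min 1 (Num.min k1 k2)); first by rewrite !lt_min ltr01 k10 k20.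
move=> theta t0; rewrite !le_min => /andP[t1 /andP[tk1 tk2]].
exists (alpha + theta *: b); split=> i.
  rewrite !mxE -ltrBlDr sub0r.
  have h1 : - (theta * b 0 i) <= theta * `|b 0 i|.
    by rewrite -mulrN ler_wpM2l ?(ltW t0)// -normrN ler_norm.
  have h2 : theta * (`|b 0 i| + 1) <= k2 * (`|b 0 i| + 1) by rewrite ler_wpM2r// ltW.
  have := k2P i; lra.
rewrite row_symbol mulmxDl aQ add0r -scalemxAl bQ !mxE.
set s : R := sigma 0 i; set al : R := alpha 0 i; set x : R := b 0 i; set u : R := mu 0 i.
have -> : theta ^+ 2 / 2 * s ^+ 2 * (al + theta * x) + theta * u * (al + theta * x) +
    theta * (mbar * al - al * u) =
  theta * (mbar * al + theta * (s ^+ 2 / 2 * al + theta * (s ^+ 2 / 2 * x) + u * x)) by field.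
rewrite pmulr_rlt0//.
have h1 : theta * (s ^+ 2 / 2 * x) <= s ^+ 2 / 2 * `|x|.
  apply: (@le_trans _ _ (theta * (s ^+ 2 / 2 * `|x|))).
    apply: ler_wpM2l; first exact: ltW.
    by apply: ler_wpM2l; [exact: s0|exact: ler_norm].
  by rewrite ler_piMl// mulr_ge0//; exact: s0.
have h2 : u * x <= `|u| * `|x| by rewrite -normrM ler_norm.
have h3 : theta * (s ^+ 2 / 2 * al + theta * (s ^+ 2 / 2 * x) + u * x) <
    theta * K i.
  by rewrite ltr_pM2l// /K -/s -/al -/x -/u; lra.
have h4 : theta * K i <= k1 * K i by rewrite ler_wpM2r// ltW.
have := k1P i; rewrite -/al; lra.
Qed.

End Symbol.

(** * U is an irreducible generator, and the sign structure of L *)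

Section FlowPositivity.
Context {R : realType} {m : nat}.
Variables (mu sigma : 'rV[R]_m) (Q U : 'M[R]_m) (alpha : 'rV[R]_m).
Hypotheses (hQ : is_generator Q) (hirr : is_irreducible Q)
  (halpha : is_stationary Q alpha) (hsigma : forall i, 0 < sigma 0 i)
  (hdrift : \sum_i alpha 0 i * mu 0 i < 0) (hU : is_U0 mu sigma Q U).

Let S2 := diag_mx sigma *m diag_mx sigma.

Lemma U0_quad : 2^-1 *: (S2 *m (U *m U)) + diag_mx mu *m U + Q = 0.
Proof. by case: hU; rewrite /quad_solution raddf0 subr0. Qed.

Lemma U0_quad_col (v : 'cV[R]_m) i :
  2^-1 * sigma 0 i ^+ 2 * (U *m (U *m v)) i 0 + mu 0 i * (U *m v) i 0 + (Q *m v) i 0 = 0.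
Proof.
have /(congr1 (fun M => (M *m v) i 0)) := U0_quad.
rewrite mul0mx [RHS]mxE !mulmxDl -scalemxAl -!mulmxA => <-.
rewrite [RHS]mxE [X in _ = X + _]mxE [X in _ = X + _ + _]mxE.
by congr (_ + _ + _); rewrite !diag_mxE; ring.
Qed.

(** Subtracting [eps] moves the eigenvalue 0 to - eps and the others further left, so the shifted
    flow is bounded. *)
Lemma expmx_subexp (eps : R) : 0 < eps ->
  exists C, forall t i j, 0 <= t -> `|expmx (t *: U) i j| <= C * expR (eps * t).
Proof.
move=> e0.
have sneg : spectrum_neg (U - eps%:M).
  move=> z /eigenvalueP[v vU v0]; have [_ [_ hz]] := hU.
  have zE : eigenvalueC U (z + real_complex R eps).
    apply/eigenvalueP; exists v => //.
    by rewrite scalerDl -vU map_mxB map_scalar_mx mulmxBr mul_mx_scalar subrK.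
  have [z0|/(hz _ zE)] := eqVneq (z + real_complex R eps) 0.
    move/eqP: z0; rewrite addr_eq0 => /eqP ->.
    by rewrite /= oppr_lt0.
  case: z {vU} zE => a b _ /=; lra.
have [C CP] := spectrum_neg_bounded sneg.
exists C => t i j t0.
have -> : t *: U = t *: (U - eps%:M) + (eps * t)%:M.
  by rewrite scalerBr scale_scalar_mx (mulrC t) subrK.
rewrite expmxD; last first.
  by rewrite /GRing.comm -[LHS]/(_ *m _) -[RHS]/(_ *m _) scalar_mxC.
rewrite expmx_scalar mul_mx_scalar mxE normrM ger0_norm ?expR_ge0// mulrC.
by rewrite ler_wpM2r ?expR_ge0 ?CP.
Qed.

(* Maximum principle: [w + eta e^{theta y} a], with [a] a positive strict
   supersolution of the symbol at a small [theta > 0], is positive at infinity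
   because [w] grows subexponentially, and cannot have a nonpositive interior
   minimum. *)
Lemma flow_ge0 (v : 'cV[R]_m) : (forall i, 0 <= v i 0) ->
  forall y i, 0 <= y -> 0 <= (expmx (y *: U) *m v) i 0.
Proof.
move=> v0.
have [th th0 /(_ th th0 (lexx _))[al [al0 alM]]] :=
  left_supersolution sigma hQ hirr halpha hdrift.
have [a a0 Ma] := metzler_right_super (metzler_symbol mu sigma th hQ) al0 alM.
(* Half the rate of the exponential that is added to [w], so that the latter wins at infinity. *)
have [C CP] := @expmx_subexp (th / 2) (divr_gt0 th0 (ltr0Sn _ _)).
pose w y := expmx (y *: U) *m v.
suff key eta : 0 < eta -> forall y i, 0 <= y -> 0 <= (w y) i 0 + eta * (expR (th * y) * a i 0).
  move=> y i y0; rewrite -oppr_le0.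
  have c0 : 0 <= expR (th * y) * a i 0 by rewrite mulr_ge0 ?expR_ge0// ltW.
  apply: (@le0_of_le_small _ _ _ 1 ltr01 c0) => t t0 _.
  by have := key t t0 y i y0; rewrite /w; lra.
move=> eta0 y0 i0 y00; rewrite leNgt; apply/negP => neg.
pose u i y := (w y) i 0 + eta * (expR (th * y) * a i 0).
pose V := \sum_k `|v k 0|.
have wC y i : 0 <= y -> `|(w y) i 0| <= C * V * expR (th / 2 * y).
  move=> yge; rewrite mxE; apply: le_trans (ler_norm_sum _ _ _) _.
  rewrite mulrAC mulr_sumr; apply: ler_sum => k _.
  by rewrite normrM ler_wpM2r ?CP.
have V0 : 0 <= V by rewrite sumr_ge0.
have C0 : 0 <= C.
  have := CP 0 i0 i0 (lexx _); rewrite mulr0 expR0 mulr1; apply: le_trans.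
  exact: normr_ge0.
have CV0 : 0 < C * V + 1 by rewrite ltr_wpDl// mulr_ge0.
have [k k0 kP] := @strict_ratio _ _ (fun=> C * V + 1) (fun i => eta * a i 0)
   (fun=> CV0) (fun i => mulr_gt0 eta0 (a0 i)).
have uinf y i : 0 <= y -> 1 <= k * expR (th / 2 * y) -> 0 < u i y.
  move=> yge yk; rewrite /u -ltrBlDr sub0r.
  have := wC y i yge; rewrite ler_norml => /andP[+ _].
  move=> h0; apply: lt_le_trans h0; rewrite ltrN2.
  have -> : expR (th * y) = expR (th / 2 * y) * expR (th / 2 * y).
    by rewrite -expRD; congr expR; field.
  set x := expR _ in yk *; have x0 : 0 < x by exact: expR_gt0.
  have h : (C * V + 1) * 1 <= (C * V + 1) * (k * x) by rewrite ler_wpM2l// ltW.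
  have h2 : k * (C * V + 1) * x <= eta * a i 0 * x by rewrite ler_wpM2r// ltW.
  have -> : eta * (x * x * a i 0) = (eta * a i 0 * x) * x by ring.
  rewrite ltr_pM2r//; move: h h2; lra.
(* Beyond 2 / (th k) one has k e^{th y / 2} >= k th y / 2 >= 1, the condition in [uinf]. So [u] is
   positive at both ends of [0, Y], and a negative minimum is interior. *)
pose Y := Num.max y0 (2 / th / k).
have Y0 : 0 <= Y by rewrite le_max y00.
have uY i : 0 < u i Y.
  apply: uinf => //; rewrite -ler_pdivrMl// mulr1.
  apply: le_trans (expR_ge1Dx _); rewrite ler_wpDl//.
  have : 2 / th / k <= Y by rewrite le_max lexx orbT.
  rewrite -(ler_pM2l th0) => h; rewrite -(ler_pM2l (_ : 0 < 2)) //.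
  apply: le_trans (_ : th * (2 / th / k) <= _); last by move: h; lra.
  by rewrite le_eqVlt; apply/orP; left; apply/eqP; field; rewrite !gt_eqF.
have u0 i : 0 < u i 0.
  rewrite /u /w scale0r expmx0 mul1mx mulr0 expR0 mul1r.
  by rewrite ltr_wpDl// mulr_gt0.
have ucont i : continuous (u i).
  move=> y; rewrite /u; apply: cvgD; last first.
    apply: cvgM; first exact: cvg_cst.
    apply: cvgM; last exact: cvg_cst.
    apply: (@continuous_comp _ _ _ (fun z => th * z) expR); last exact: continuous_expR.
    by apply: cvgM; [exact: cvg_cst|exact: cvg_id].
  apply: (@mulmx_cvg _ _ _ _ _ _ _ (fun z => expmx (z *: U)) (fun=> v)) => p q.
    exact: expmx_entry_continuous.
  exact: cvg_cst.
have minE i : exists2 c, c \in `[0, Y] & forall t, t \in `[0, Y] -> u i c <= u i t.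
  by apply: EVT_min => //; apply: continuous_subspaceT; exact: ucont.
have [c cY cmin] : exists2 c : 'I_m -> R, forall i, c i \in `[0, Y] &
    forall i t, t \in `[0, Y] -> u i (c i) <= u i t.
  have /choice[c cP] : forall i, exists c, c \in `[0, Y] /\ forall t, t \in `[0, Y] -> u i c <= u i t.
    by move=> i; have [x ? ?] := minE i; exists x.
  by exists c => i; case: (cP i).
(* The minimum is taken over states as well as over points, which makes the coupling term Q u
   nonnegative at the minimizing state. *)
have [i _ imin] := @arg_minP _ _ _ i0 xpredT (fun i => u i (c i)) isT.
set ys := c i in imin.
have y0Y : y0 \in `[0, Y] by rewrite in_itv/= y00 le_max lexx.
have us : u i ys < 0.
  by apply: le_lt_trans (imin i0 isT) _; apply: le_lt_trans (cmin i0 _ y0Y) neg.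
have uglob j t : t \in `[0, Y] -> u i ys <= u j t.
  by move=> tY; apply: le_trans (imin j isT) (cmin j t tY).
have /andP[ys0 ysY] : (0 < ys) && (ys < Y).
  have := cY i; rewrite in_itv/= -/ys => /andP[yl yr].
  apply/andP; split; rewrite lt_neqAle ?yl ?yr andbT; apply/eqP => E.
    by move: us; rewrite -E ltNge (ltW (u0 i)).
  by move: us; rewrite E ltNge (ltW (uY i)).
pose uv : 'cV[R]_m := w ys + (eta * expR (th * ys)) *: a.
have uvE j : uv j 0 = u j ys by rewrite /uv /u [LHS]mxE [X in _ + X]mxE mulrA.
have [K1 K10 T1] := expmx_taylor_col U (w ys).
have [K2 K20 T2] := expmx_taylor_col (th%:M) ((eta * expR (th * ys)) *: a).
have [] := @taylor2_min _ (fun e => u i (ys + e)) (u i ys)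
   ((U *m w ys) i 0 + (eta * expR (th * ys)) * th * a i 0)
   ((U *m (U *m w ys)) i 0 + (eta * expR (th * ys)) * th ^+ 2 * a i 0) (K1 + K2)
   (Num.min 1 (Num.min ys (Y - ys))).
- by rewrite !lt_min ltr01 ys0 subr_gt0.
- by rewrite addr_ge0.
- move=> e; rewrite !le_min => /andP[e1 _].
  have := ler_normD ((expmx (e *: U) *m w ys) i 0 - w ys i 0 - e * (U *m w ys) i 0
     - e ^+ 2 / 2 * (U *m (U *m w ys)) i 0)
   ((expmx (e *: th%:M) *m ((eta * expR (th * ys)) *: a)) i 0
     - ((eta * expR (th * ys)) *: a) i 0
     - e * (th%:M *m ((eta * expR (th * ys)) *: a)) i 0
     - e ^+ 2 / 2 * (th%:M *m (th%:M *m ((eta * expR (th * ys)) *: a))) i 0).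
  move=> h; move: (le_trans h (lerD (T1 e i e1) (T2 e i e1))); rewrite -mulrDr.
  apply: le_trans.
  have uE : u i (ys + e) = (expmx (e *: U) *m w ys) i 0 +
      (expmx (e *: th%:M) *m ((eta * expR (th * ys)) *: a)) i 0.
    rewrite /u /w (addrC ys e) expmx_addt mulmxA; congr (_ + _).
    rewrite scale_scalar_mx expmx_scalar mul_scalar_mx !mxE mulrDr expRD.
    by rewrite (mulrC th e); ring.
  rewrite uE /u !mul_scalar_mx !mxE.
  rewrite le_eqVlt; apply/orP; left; apply/eqP; congr `| _ |.
  by ring.
- move=> e; rewrite !le_min => /andP[_ /andP[e1 e2]].
  apply: uglob; rewrite in_itv/=.
  move: e1 e2; rewrite !ler_norml => /andP[? ?] /andP[? ?]; lra.
move=> p0 q0.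
(* The equation solved by [w] plus the strict inequality for the exponential gives a negative value,
   while at the minimum the first-order term is 0 and the other two terms are nonnegative: a
   contradiction. *)
have ode : 2^-1 * sigma 0 i ^+ 2 *
     ((U *m (U *m w ys)) i 0 + (eta * expR (th * ys)) * th ^+ 2 * a i 0) +
   mu 0 i * ((U *m w ys) i 0 + (eta * expR (th * ys)) * th * a i 0) + (Q *m uv) i 0 =
   - (eta * expR (th * ys)).
  have h1 := U0_quad_col (w ys) i.
  have /(congr1 (fun M : 'cV[R]_m => M i 0)) := Ma; rewrite symbol_col => h2.
  have -> : (Q *m uv) i 0 = (Q *m w ys) i 0 + eta * expR (th * ys) * (Q *m a) i 0.
    by rewrite /uv mulmxDr -scalemxAr [LHS]mxE [X in _ + X]mxE.
  move: h2; rewrite [in RHS]mxE [ones _ _ _ _]mxE => h2.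
  set g := eta * _; rewrite -[RHS]addr0 -[X in _ = _ + X]h1 -(mulrN1 g) -h2.
  by field.
have g0 : 0 < eta * expR (th * ys) by rewrite mulr_gt0// expR_gt0.
have Quv : 0 <= (Q *m uv) i 0.
  have -> : (Q *m uv) i 0 = \sum_j Q i j * (u j ys - u i ys).
    rewrite mxE; under eq_bigr do rewrite uvE.
    under [RHS]eq_bigr do rewrite mulrBr.
    rewrite sumrB -mulr_suml.
    suff -> : \sum_j Q i j = 0 by rewrite mul0r subr0.
    have /(congr1 (fun M : 'cV[R]_m => M i 0)) := hQ.2; rewrite mxE [RHS]mxE => E; rewrite -[RHS]E.
    by apply: eq_bigr => j _; rewrite [ones _ _ _ _]mxE mulr1.
  rewrite sumr_ge0// => j _; have [->|ij] := eqVneq i j; first by rewrite subrr mulr0.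
  rewrite mulr_ge0 ?hQ.1// subr_ge0; apply: uglob; exact: cY.
have s20 : 0 <= 2^-1 * sigma 0 i ^+ 2 by rewrite mulr_ge0 ?sqr_ge0// invr_ge0.
move: ode; rewrite p0 mulr0 addr0 => ode.
have := mulr_ge0 s20 q0; lra.
Qed.

(** Off the diagonal the entry of the nonnegative flow at time t is t U_ij + O(t^2). *)
Lemma U0_metzler : metzler U.
Proof.
move=> i j ij; rewrite -oppr_le0.
pose c := nrm U ^+ 2 * expR (nrm U).
have c0 : 0 <= c by rewrite mulr_ge0 ?sqr_ge0 ?expR_ge0.
apply: (@le0_of_le_small _ _ c 1 ltr01 c0) => t t0 t1.
have h1 : 0 <= expmx (t *: U) i j.
  have := @flow_ge0 (delta_mx j 0) _ t i (ltW t0).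
  by rewrite -colE mxE; apply => k; rewrite mxE; case: (_ && _).
have := @expmx_tail2 _ _ U t i j; rewrite gtr0_norm// => /(_ t1) => h2.
have E : (expmx (t *: U) - 1%:M - t *: U) i j = expmx (t *: U) i j - t * U i j.
  by move: (expmx _) => X; rewrite !mxE (negbTE ij) mulr0n subr0.
move: h2; rewrite E -/c ler_norml => /andP[_ h2].
rewrite -(ler_pM2l t0); move: h1 h2; lra.
Qed.

(** The root 0 of the characteristic polynomial provides a null vector of U; by the quadratic
    equation Q annihilates it too, so it is constant. *)
Lemma U0_ones : U *m ones R m = 0.
Proof.
have [z Uz z0] : exists2 z : 'cV[R]_m, U *m z = 0 & z != 0.
  have Unu : U \notin unitmx.
    apply/negP => Uu; have [_ [h0 _]] := hU.
    have rt : root (char_poly U) 0.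
      by apply: contraT => /(@mupNroot _ 0); rewrite h0.
    move: rt; rewrite -eigenvalue_root_char => /eigenvalueP[v vU].
    by rewrite -(mulmxK Uu v) vU scale0r mul0mx eqxx.
  apply: contrapT => h; move/negP: Unu; apply; apply: unitmx_col_inj => x Ux.
  by apply: contrapT => /eqP x0; apply: h; exists x.
have Qz : Q *m z = 0.
  apply/matrixP => i j; rewrite ord1 [RHS]mxE.
  by have := U0_quad_col z i; rewrite Uz mulmx0 [(0 : 'cV_m) i 0]mxE !mulr0 !add0r.
have zc := generator_right_null hQ hirr Qz.
have [i zi] : exists i, z i 0 != 0.
  apply: contrapT => /forallNP h; move/eqP: z0; apply; apply/matrixP => i j.
  by rewrite ord1 [RHS]mxE; apply: contrapT => /eqP; exact: h.
have -> : ones R m = (z i 0)^-1 *: z.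
  by apply/matrixP => k j; rewrite ord1 !mxE (zc k i) mulVf.
by rewrite -scalemxAr Uz scaler0.
Qed.

Lemma U0_generator : is_generator U.
Proof. by split; [exact: U0_metzler|exact: U0_ones]. Qed.

(* A set closed under the transitions of [U] is closed under those of [U^2],
   hence, by the quadratic equation, under those of [Q]. *)
Lemma U0_irreducible : is_irreducible U.
Proof.
move=> i; pose e := fun k l : 'I_m => (k != l) && (0 < U k l).
suff cl k l : connect e i k -> (k != l) && (0 < Q k l) -> connect e i l.
  suff H p s : connect e i s -> path (fun k l => (k != l) && (0 < Q k l)) s p ->
      connect e i (last s p).
    by move=> j; have /connectP[p ip ->] := hirr i j; apply: H ip; exact: connect0.
  elim: p s => [|x p IH] s //= si /andP[sx]; apply: IH; exact: cl si sx.
move=> ik /andP[kl Qkl]; apply: contraT => nil.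
have Z r s : connect e i r -> ~~ connect e i s -> U r s = 0.
  move=> ir nis; have rs : r != s by apply: contraNneq nis => <-.
  apply/eqP; rewrite eq_le U0_metzler// andbT leNgt; apply: contra nis => Urs.
  by apply: connect_trans ir _; apply: connect1; rewrite /e rs.
have U2 : (U *m U) k l = 0.
  rewrite mxE big1// => r _; have [ir|nir] := boolP (connect e i r).
    by rewrite (Z r l)// mulr0.
  by rewrite (Z k r)// mul0r.
have /matrixP/(_ k l) := U0_quad; rewrite [LHS]mxE [X in X + _]mxE [X in X + _ + _]mxE.
rewrite -mulmxA !diag_mxE U2 (Z k l)// !mulr0 !add0r [RHS]mxE => E.
by rewrite E ltxx in Qkl.
Qed.

Let Theta := diag_mx sigma.

Lemma Theta_unit : Theta \in unitmx.
Proof.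
rewrite unitmxE /Theta det_diag unitfE prodf_seq_neq0; apply/allP => i _ /=.
by rewrite gt_eqF.
Qed.

Definition Lmx : 'M[R]_m := Theta *m Kmx mu sigma U *m invmx Theta.

Lemma Kmx_Lmx : Kmx mu sigma U = invmx Theta *m Lmx *m Theta.
Proof. by rewrite /Lmx !mulmxA mulVmx ?Theta_unit// mul1mx mulmxKV ?Theta_unit. Qed.

(** Together with the equation of U this is the factorization z^2 Theta^2 / 2 + z D + Q = (z + L)
    Theta^2 (z - U) / 2: U is the right solvent of the quadratic polynomial and - L the left one. *)
Lemma Lmx_S2 : Lmx *m S2 = S2 *m U + 2 *: diag_mx mu.
Proof.
have Tu := Theta_unit.
have -> : Lmx *m S2 = Theta *m Kmx mu sigma U *m Theta.
  by rewrite /Lmx /S2 -/Theta mulmxA mulmxKV.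
rewrite /Kmx -/Theta mulmxDr mulmxDl; congr (_ + _).
  by rewrite !mulmxA mulmxKV.
rewrite -scalemxAr -scalemxAl; congr (_ *: _).
have -> : invmx (Theta *m Theta) = invmx Theta *m invmx Theta.
  have T2u : Theta *m Theta \in unitmx by rewrite unitmx_mul Tu.
  rewrite -[RHS]mul1mx -(mulVmx T2u) -!mulmxA (mulmxA Theta (invmx Theta)) mulmxV//.
  by rewrite mul1mx mulmxV// mulmx1.
have cD : diag_mx mu *m Theta = Theta *m diag_mx mu by rewrite diag_mxC.
by rewrite !mulmxA mulmxV// mul1mx -mulmxA cD mulmxA mulVmx// mul1mx.
Qed.

Lemma metzler_Lmx : metzler Lmx.
Proof.
move=> i j ij; have /matrixP/(_ i j) := Lmx_S2.
have -> : (S2 *m U + 2 *: diag_mx mu) i j = sigma 0 i * (sigma 0 i * U i j).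
  rewrite [LHS]mxE /S2 -mulmxA !diag_mxE [X in _ + X]mxE [diag_mx mu i j]mxE.
  by rewrite (negbTE ij) mulr0n mulr0 addr0.
rewrite /S2 mulmxA !mx_diagE => E.
have s0 k := ltW (hsigma k).
have : 0 <= Lmx i j * sigma 0 j * sigma 0 j by rewrite E !mulr_ge0 ?s0 ?U0_metzler.
by rewrite !pmulr_lge0.
Qed.

(** By the factorization, L Theta^2 U = - 2 Q, which alpha annihilates. *)
Lemma stationary_Lmx_left_null : alpha *m Lmx *m S2 *m U = 0.
Proof.
have -> : alpha *m Lmx *m S2 *m U = 2 *: (alpha *m (2^-1 *: (S2 *m (U *m U)) + diag_mx mu *m U)).
  rewrite -(mulmxA alpha) Lmx_S2 -mulmxA scalemxAr; congr (_ *m _).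
  by rewrite mulmxDl scalerDr scalerA mulfV// scale1r -scalemxAl mulmxA.
have /eqP := U0_quad; rewrite addr_eq0 => /eqP ->.
by case: halpha => _ aQ _; rewrite mulmxN aQ oppr0 scaler0.
Qed.

Lemma sum_rowE (u : 'rV[R]_m) : \sum_i u 0 i = (u *m ones R m) 0 0.
Proof. by rewrite mxE; apply: eq_bigr => i _; rewrite [ones _ _ _ _]mxE mulr1. Qed.

(** The left null vector [eta] of U has total mass 2 sum_i alpha_i mu_i, because U 1 = 0. The drift
    thus makes some entry negative, and irreducibility of U spreads the sign to all entries. *)
Lemma stationary_Lmx_neg i : (alpha *m Lmx) 0 i < 0.
Proof.
pose eta := alpha *m Lmx *m S2.
have etaU : eta *m U = 0 := stationary_Lmx_left_null.
have etas : \sum_i eta 0 i < 0.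
  rewrite sum_rowE /eta -(mulmxA alpha) Lmx_S2 -mulmxA mulmxDl -mulmxA U0_ones mulmx0 add0r.
  rewrite -scalemxAl -scalemxAr mxE mulmxA -sum_rowE.
  by under eq_bigr do rewrite mx_diagE; rewrite pmulr_rlt0.
have [i0 ei0] : exists i0, eta 0 i0 < 0.
  apply: contrapT => /forallNP h; move: etas; rewrite ltNge sumr_ge0// => j _.
  by rewrite leNgt; apply/negP/h.
have := @generator_left_null_pos _ _ _ U0_generator U0_irreducible (- eta) i0.
rewrite mulNmx etaU oppr0 mxE oppr_gt0 => /(_ erefl ei0 i).
rewrite mxE oppr_gt0 /eta /S2 mulmxA !mx_diagE.
by rewrite !pmulr_llt0.
Qed.

Lemma Lmx_unit : Lmx \in unitmx.
Proof.
exact: metzler_unitmx metzler_Lmx (stationary_gt0 hQ hirr halpha) stationary_Lmx_neg.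
Qed.

Lemma Kmx_unit : Kmx mu sigma U \in unitmx.
Proof. by rewrite Kmx_Lmx unitmx_mul unitmx_mul unitmx_inv Theta_unit Lmx_unit. Qed.

End FlowPositivity.

Section SubinvariantFlow.
Context {R : realType} {m : nat}.

(** After the shift by k, the inequality v N <= k v iterates to all powers of the nonnegative matrix
    N and can be summed in the series. *)
Lemma expmx_subinvariant (M : 'M[R]_m) (v : 'rV[R]_m) : metzler M ->
  (forall i, (v *m M) 0 i <= 0) ->
  forall y i, 0 <= y -> (v *m expmx (y *: M)) 0 i <= v 0 i.
Proof.
move=> mM vM y i y0; pose k := nrm M; pose N := M + k%:M.
have N0 p q : 0 <= N p q by exact: metzler_shift.
have vN l j : (v *m (y *: N) ^+ l) 0 j <= (y * k) ^+ l * v 0 j.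
  elim: l j => [|l IH] j; first by rewrite !expr0 mulmx1 mul1r.
  rewrite exprSr -[(_ * (y *: N))]/(_ *m _) mulmxA mxE.
  apply: (@le_trans _ _ (\sum_p (y * k) ^+ l * v 0 p * (y *: N) p j)).
    by apply: ler_sum => p _; rewrite ler_wpM2r// mxE mulr_ge0.
  under eq_bigr do rewrite -mulrA; rewrite -mulr_sumr exprSr -!mulrA.
  rewrite ler_wpM2l ?exprn_ge0 ?mulr_ge0 ?nrm_ge0//.
  have -> : \sum_p v 0 p * (y *: N) p j = y * (v *m N) 0 j.
    by rewrite [in RHS]mxE mulr_sumr; apply: eq_bigr => p _; rewrite mxE mulrCA.
  rewrite ler_wpM2l// /N mulmxDr mul_mx_scalar [leLHS]mxE [X in _ + X]mxE.
  by rewrite gerDr vM.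
rewrite (expmx_shift _ (y * k)) -scalemxAr [leLHS]mxE.
have -> : y *: M + (y * k)%:M = y *: N by rewrite /N scalerDr scale_scalar_mx.
rewrite expRN mulrC ler_pdivrMr ?expR_gt0//.
have h : (v *m expps n (y *: N)) 0 i @[n --> \oo] --> (v *m expmx (y *: N)) 0 i.
  by apply: mulmx_cvg => p q; [exact: cvg_cst|exact: expps_cvg].
have h2 : v 0 i * exps n (y * k) @[n --> \oo] --> v 0 i * expR (y * k).
  by apply: cvgM; [exact: cvg_cst|exact: exps_cvg].
rewrite -(cvg_lim (@Rhausdorff R) h) -(cvg_lim (@Rhausdorff R) h2).
apply: ler_lim; [exact: cvgP h|exact: cvgP h2|].
near=> n; rewrite /expps mulmx_sumr summxE /exps mulr_sumr; apply: ler_sum => l _.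
by rewrite -scalemxAr mxE mulrCA ler_wpM2l ?invr_ge0// mulrC.
Unshelve. all: by end_near. Qed.

Lemma expmx_subinvariant_decay (M : 'M[R]_m) (v : 'rV[R]_m) (c : R) : metzler M ->
  (forall i, (v *m M) 0 i <= - c * v 0 i) ->
  forall y i, 0 <= y -> (v *m expmx (y *: M)) 0 i <= expR (- (c * y)) * v 0 i.
Proof.
move=> mM vM y i y0.
have mMc : metzler (M + c%:M).
  by move=> p q pq; rewrite !mxE (negbTE pq) mulr0n addr0; exact: mM.
rewrite (expmx_shift (y *: M) (c * y)) -scalemxAr [leLHS]mxE.
rewrite ler_wpM2l ?expR_ge0//.
have -> : y *: M + (c * y)%:M = y *: (M + c%:M) by rewrite scalerDr scale_scalar_mx (mulrC c).
apply: expmx_subinvariant => // j; rewrite mulmxDr mul_mx_scalar [leLHS]mxE [X in _ + X]mxE.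
by rewrite -lerBrDr sub0r -mulNr.
Qed.

End SubinvariantFlow.

(** * Closed forms *)

Section ClosedForm.
Context {R : realType} {m : nat}.
Variables (mu sigma : 'rV[R]_m) (Q U : 'M[R]_m) (alpha : 'rV[R]_m).
Hypotheses (hQ : is_generator Q) (hirr : is_irreducible Q)
  (halpha : is_stationary Q alpha) (hsigma : forall i, 0 < sigma 0 i)
  (hdrift : \sum_i alpha 0 i * mu 0 i < 0) (hU : is_U0 mu sigma Q U).

Let Theta := diag_mx sigma.
Let K := Kmx mu sigma U.
Let L := Lmx mu sigma U.

(** [nu *m Theta] is a multiple c of [alpha *m L *m Theta^2], hence [nu *m invmx (- K)] is - c times
    [alpha *m Theta]. Since alpha sums to 1, the normalizing constant is exactly (- c)^{-1};
    conjugation by Theta then turns K into L. *)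
Lemma closed_form (nu : 'rV[R]_m) (x : R) : nu *m Theta *m U = 0 -> nu != 0 ->
  gamma_nu sigma K nu *:
    (nu *m invmx (- K) *m (1%:M - expmx (x *: K)) *m invmx Theta) =
  alpha *m (1%:M - expmx (x *: L)).
Proof.
move=> nuU nu0.
have Tu : Theta \in unitmx := Theta_unit hsigma.
have Ku : - K \in unitmx.
  by rewrite -scaleN1r unitmxZ ?unitrN1// /K (Kmx_unit hQ hirr halpha hsigma hdrift hU).
pose eta := alpha *m L *m (Theta *m Theta).
have etaU : eta *m U = 0 := stationary_Lmx_left_null halpha hsigma hU.
have Uon := U0_ones hQ hirr hU.
have gU := U0_generator hQ hirr halpha hdrift hU.
have iU := U0_irreducible hQ hirr halpha hdrift hU.
have etas : \sum_i eta 0 i != 0.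
  rewrite lt_eqF// sum_rowE /eta -(mulmxA alpha) (Lmx_S2 mu U hsigma).
  rewrite -mulmxA mulmxDl -mulmxA Uon mulmx0 add0r.
  rewrite -scalemxAl -scalemxAr mxE mulmxA -sum_rowE.
  by under eq_bigr do rewrite mx_diagE; rewrite pmulr_rlt0.
pose c := (\sum_i (nu *m Theta) 0 i) / \sum_i eta 0 i.
have nuE : nu *m Theta = c *: eta.
  apply/eqP; rewrite -subr_eq0; apply/eqP; apply: (generator_left_null_sum0 gU iU).
    by rewrite mulmxBl nuU -scalemxAl etaU scaler0 subrr.
  rewrite sum_rowE mulmxBl -scalemxAl [LHS]mxE [X in _ + X]mxE [X in _ - X]mxE.
  by rewrite -!sum_rowE /c divfK// subrr.
have TK : Theta *m K = L *m Theta by rewrite /L /Lmx mulmxKV.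
have nuK : nu = (- c *: (alpha *m Theta)) *m - K.
  apply: (can_inj (mulmxK Tu)); rewrite nuE mulmxN -scalemxAl scaleNr opprK.
  by rewrite -mulmxA TK /eta -!scalemxAl !mulmxA.
have c0 : c != 0.
  by apply: contraNneq nu0 => c0; rewrite nuK c0 oppr0 scale0r mul0mx.
have nuiK : nu *m invmx (- K) = - c *: (alpha *m Theta) by rewrite nuK mulmxK.
have g : gamma_nu sigma K nu = (- c)^-1.
  rewrite /gamma_nu nuiK -/Theta -!scalemxAl mulmxK// mxE -sum_rowE.
  by case: halpha => _ _ ->; rewrite mulr1.
have eKL : expmx (x *: K) *m invmx Theta = invmx Theta *m expmx (x *: L).
  apply: expmx_intertwine; rewrite -scalemxAl -scalemxAr; congr (_ *: _).
  by apply: (can_inj (mulKmx Tu)); rewrite !mulmxA TK mulmxK// mulmxV// mul1mx.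
rewrite g nuiK -!scalemxAl scalerA mulVf ?oppr_eq0// scale1r.
rewrite -!mulmxA mulmxBl mul1mx eKL mulmxBr mulmxV// mulKVmx//.
Qed.

Lemma spectrum_neg_unit (A : 'M[R]_m) : spectrum_neg A -> A \in unitmx.
Proof.
move=> sA; rewrite -row_free_unit -kermx_eq0; apply: contraT => /rowV0Pn[v vk v0].
have vA : v *m A = 0 by apply/sub_kermxP.
suff /sA : eigenvalueC A 0 by rewrite /= ltxx.
apply/eigenvalueP; exists (map_mx (real_complex R) v); last by rewrite map_mx_eq0.
by rewrite -map_mxM vA map_mx0 scale0r.
Qed.

(** The substitution nu = rho (- U(q))^{-1} Theta^{-1} reduces it to [closed_form], which takes any
    nonzero nu, normalized or not. The factor 2 in [gamma_rho] cancels the one in [mstar]. *)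
Lemma closed_form_rho (Uq : 'M[R]_m) (rho : 'rV[R]_m) (x : R) : spectrum_neg Uq ->
  rho *m invmx (- Uq) *m U = 0 -> \sum_i rho 0 i = 1 ->
  gamma_rho sigma Uq K rho *:
    (rho *m invmx (- Uq) *m invmx Theta *m invmx (- K)
       *m (1%:M - expmx (x *: K)) *m invmx Theta) =
  alpha *m (1%:M - expmx (x *: L)).
Proof.
move=> sq rU r1; have Tu : Theta \in unitmx := Theta_unit hsigma.
have qu : - Uq \in unitmx by rewrite -scaleN1r unitmxZ ?unitrN1// spectrum_neg_unit.
pose nu := rho *m invmx (- Uq) *m invmx Theta.
have nuU : nu *m Theta *m U = 0 by rewrite /nu mulmxKV.
have nu0 : nu != 0.
  apply/eqP => nu0; have rho0 : rho = 0.
    by rewrite -(mulmxKV qu rho) -(mulmxKV Tu (rho *m _)) -/nu nu0 !mul0mx.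
  by move: r1; rewrite rho0 big1 => [/eqP|i _]; rewrite ?mxE// eq_sym oner_eq0.
rewrite -(closed_form x nuU nu0) -/nu; congr (_ *: _).
rewrite /gamma_rho /gamma_nu /mstar -scalemxAr [X in _ * X^-1]mxE invfM mulrA mulfV// mul1r.
by rewrite /nu -/Theta !mulmxA.
Qed.

End ClosedForm.

(** * Gaussian moments *)

Section GaussianMoments.
Context {R : realType}.
Variables (s : R) (s0 : 0 < s).
Notation leb := lebesgue_measure.

Let ph : R -> R := normal_pdf 0 s.
Let pk : R := normal_peak s.

Lemma gaussE (x : R) : ph x = pk * expR (- x ^+ 2 / (s ^+ 2 *+ 2)).
Proof. by rewrite /ph normal_pdfE ?gt_eqF// /normal_fun subr0. Qed.

Lemma gauss_ge0 x : 0 <= ph x. Proof. exact: normal_pdf_ge0. Qed.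

Lemma gauss_cont : continuous ph.
Proof. by apply: continuous_normal_pdf; rewrite gt_eqF. Qed.

(** From u^2 / 2 <= e^u at u = x^2 / (2 s^2). It is the source of all decay at infinity used
    below. *)
Lemma gauss_quartic x : x ^+ 4 * ph x <= 8 * s ^+ 4 * pk.
Proof.
pose u := x ^+ 2 / (s ^+ 2 *+ 2).
have s2 : 0 < s ^+ 2 *+ 2 by rewrite pmulrn_lgt0// exprn_gt0.
have u0 : 0 <= u by rewrite divr_ge0 ?sqr_ge0 ?ltW.
have eu : u ^+ 2 / 2 <= expR u.
  apply: le_trans (exps_le_expR 3 u0).
  rewrite /exps !big_nat_recr//= big_nil !expr0 expr1 !factS !fact0 !muln1 /=.
  rewrite invr1 mul1r mul1r add0r mulrC; rewrite lerDr; lra.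
have eu0 : 0 < expR u by exact: expR_gt0.
rewrite gaussE mulNr -/u expRN.
have pk0 : 0 <= pk := normal_peak_ge0 s.
have -> : x ^+ 4 * (pk / expR u) = pk * (x ^+ 4 / expR u) by rewrite mulrCA.
rewrite (mulrC _ pk) ler_wpM2l// ler_pdivrMr//.
have -> : x ^+ 4 = 8 * s ^+ 4 * (u ^+ 2 / 2).
  rewrite /u -mulr_natr; field; by rewrite gt_eqF.
by rewrite ler_wpM2l// mulr_ge0// exprn_ge0// ltW.
Qed.

Lemma is_derive_gauss (x : R) : is_derive x (1 : R) ph (- (x / s ^+ 2) * ph x).
Proof.
have -> : ph = (fun x => pk * (expR \o (fun y => - y ^+ 2 / (s ^+ 2 *+ 2))) x).
  by apply/funext => y; rewrite gaussE.
have h : is_derive x (1 : R) (fun y : R => - y ^+ 2 / (s ^+ 2 *+ 2)) (- (x / s ^+ 2)).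
  apply: is_derive_eq; rewrite /GRing.scale/= !mulr1 -mulr_natr.
  by field; rewrite gt_eqF.
have h2 := @is_derive1_comp R expR (fun y : R => - y ^+ 2 / (s ^+ 2 *+ 2)) x _ _
  (is_derive_expR (- x ^+ 2 / (s ^+ 2 *+ 2))) h.
by apply: is_derive_eq; rewrite /GRing.scale/=; ring.
Qed.

Lemma gauss_poly_cvg0 (a b : R) :
  (a * x ^+ 2 + b) * ph x @[x --> +oo%R] --> (0 : R).
Proof.
pose C := (`|a| + `|b|) * (8 * s ^+ 4 * pk).
apply: norm_cvg0.
have h : C / x @[x --> +oo%R] --> (0 : R).
  rewrite -(mulr0 C); apply: cvgM; [exact: cvg_cst|].
  apply/cvgrPdist_le => e e0; near=> x.
  have x0 : 0 < x by near: x; apply: nbhs_pinfty_gt; rewrite num_real.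
  have xe : e^-1 <= x by near: x; apply: nbhs_pinfty_ge; rewrite num_real.
  by rewrite sub0r normrN gtr0_norm ?invr_gt0// -(invrK e) lef_pV2 ?posrE ?invr_gt0.
apply: (squeeze_cvgr _ (cvg_cst 0) h); near=> x.
have x1 : 1 <= x by near: x; apply: nbhs_pinfty_ge; rewrite num_real.
have x0 : 0 < x by exact: lt_le_trans x1.
rewrite normr_ge0/= normrM (ger0_norm (gauss_ge0 x)) ler_pdivlMr//.
have ab : `|a * x ^+ 2 + b| <= (`|a| + `|b|) * x ^+ 2.
  apply: le_trans (ler_normD _ _) _; rewrite mulrDl; apply: lerD.
    by rewrite normrM (ger0_norm (sqr_ge0 x)).
  by rewrite ler_peMr// exprn_ege1.
apply: (@le_trans _ _ ((`|a| + `|b|) * x ^+ 2 * ph x * x ^+ 2)).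
  apply: ler_pM; rewrite ?mulr_ge0 ?gauss_ge0 ?(ltW x0)//.
    by rewrite ler_wpM2r ?gauss_ge0.
  by rewrite expr2 ler_peMr// ltW.
rewrite /C.
have -> : (`|a| + `|b|) * x ^+ 2 * ph x * x ^+ 2 = (`|a| + `|b|) * (x ^+ 4 * ph x) by ring.
by rewrite ler_wpM2l ?addr_ge0// gauss_quartic.
Unshelve. all: by end_near. Qed.

Lemma gauss_cube_cont : continuous (fun x : R => `|x| ^+ 3 * ph x).
Proof.
move=> x; apply: cvgM; last exact: gauss_cont.
apply: (@continuous_comp _ _ _ (fun y : R => `|y|) (fun y : R => y ^+ 3)).
  exact: norm_continuous.
exact: exprn_continuous.
Qed.

Lemma gauss_cube_integral :
  (\int[leb]_x (`|x| ^+ 3 * ph x)%:E)%E = (4 * s ^+ 4 * ph 0)%:E.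
Proof.
have cN := gauss_cube_cont.
rewrite ge0_symfun_integralT//; last 2 first.
- by move=> x; rewrite mulr_ge0 ?exprn_ge0 ?gauss_ge0.
- by move=> x /=; rewrite normrN !gaussE sqrrN.
rewrite (_ : [set x | _] = `[0, +oo[%classic); last first.
  by apply/seteqP; split => x/=; rewrite in_itv/= andbT.
rewrite (eq_integral (fun x : measurableTypeR R => ((x : R) ^+ 3 * ph x)%:E)); last first.
  by move=> x; rewrite inE/= in_itv/= andbT => x0; rewrite ger0_norm.
(* A primitive of x^3 times the density on the half-line, found by integrating by parts twice. *)
pose F := fun x : R => ((- s ^+ 2) * x ^+ 2 + (- 2 * s ^+ 4)) * ph x.
have dF (x : R) : is_derive x (1 : R) F (x ^+ 3 * ph x).
  have hp := is_derive_gauss x.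
  have hq : is_derive x (1 : R) (fun x : R => (- s ^+ 2) * x ^+ 2 + (- 2 * s ^+ 4)) (- s ^+ 2 * (2 * x)).
    by apply: is_derive_eq; rewrite /GRing.scale/=; ring.
  apply: is_derive_eq; rewrite /GRing.scale/=.
  by field; rewrite gt_eqF.
rewrite (@ge0_continuous_FTC2y _ _ F 0 0).
- by rewrite -EFinB -EFinM; congr (_%:E); rewrite /F expr0n/=; ring.
- by move=> x x0; rewrite mulr_ge0 ?exprn_ge0 ?gauss_ge0.
- apply: continuous_subspaceT => x; apply: cvgM; last exact: gauss_cont.
  by exact: exprn_continuous.
- exact: gauss_poly_cvg0.
- by move=> x _; case: (dF x).
- apply: cvg_at_right_filter; apply: differentiable_continuous.
  by apply/derivable1_diffP; case: (dF 0).
- by move=> x _; rewrite derive1E; case: (dF x).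
Qed.

Lemma measurable_gauss : measurable_fun setT ph.
Proof. exact: measurable_normal_pdf. Qed.

Lemma gauss_cube_integrable :
  leb.-integrable setT (fun x : R => (`|x| ^+ 3 * ph x)%:E).
Proof.
have m := continuous_measurable_fun gauss_cube_cont.
apply/integrableP; split; first exact/measurable_EFinP.
under eq_integral => x _.
  rewrite gee0_abs; last by rewrite lee_fin mulr_ge0 ?exprn_ge0 ?gauss_ge0.
  over.
by rewrite gauss_cube_integral ltry.
Qed.

Lemma gauss_dom_integrable (c : R) :
  leb.-integrable setT (fun x : R => (c * (1 + `|x| ^+ 3) * ph x)%:E).
Proof.
rewrite (_ : (fun x : R => _) =
    (fun x : measurableTypeR R => c%:E * ((ph x)%:E + (`|x| ^+ 3 * ph x)%:E))%E); last first.
  by apply/funext => x; rewrite -EFinD -EFinM; congr (_%:E); ring.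
apply: integrableZl => //; apply: integrableD => //; last exact: gauss_cube_integrable.
exact: integrable_normal_pdf.
Qed.

Lemma poly2_le (b c k x : R) : `|b * x + c * x ^+ 2 + k| <= (`|b| + `|c| + `|k|) * (1 + `|x| ^+ 3).
Proof.
have x0 : 0 <= `|x| by [].
have h1 : `|x| <= 1 + `|x| ^+ 3.
  have [x1|x1] := leP `|x| 1; first by rewrite (le_trans x1)// lerDl exprn_ge0.
  by rewrite (@le_trans _ _ (`|x| ^+ 3)) ?lerDr// exprS ler_peMr// exprn_ege1// ltW.
have h2 : `|x| ^+ 2 <= 1 + `|x| ^+ 3.
  have [x1|x1] := leP `|x| 1.
    by rewrite (@le_trans _ _ 1) ?exprn_ile1// lerDl exprn_ge0.
  by rewrite (@le_trans _ _ (`|x| ^+ 3)) ?lerDr// (exprS _ 2) ler_peMl ?exprn_ge0// ltW.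
have h3 : 1 <= 1 + `|x| ^+ 3 by rewrite lerDl exprn_ge0.
rewrite !mulrDl; apply: le_trans (ler_normD _ _) _; apply: lerD.
  by apply: le_trans (ler_normD _ _) _; apply: lerD; rewrite normrM ?normrX ler_wpM2l.
by rewrite ler_peMr.
Qed.

(* [b w + c (w^2 - s^2)] times the density is the derivative of
   [- (b s^2 + c s^2 w)] times the density, which vanishes at infinity. *)
Lemma gauss_mean_var (b c : R) :
  (\int[leb]_x ((b * x + c * x ^+ 2 + - (c * s ^+ 2)) * ph x)%:E)%E = 0%E.
Proof.
set q := fun x : R => (b * x + c * x ^+ 2 + - (c * s ^+ 2)) * ph x.
pose F := fun x : R => (- (c * s ^+ 2) * x + - (b * s ^+ 2)) * ph x.
have dF (x : R) : is_derive x (1 : R) F (q x).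
  have hp := is_derive_gauss x.
  have hq : is_derive x (1 : R) (fun x : R => - (c * s ^+ 2) * x + - (b * s ^+ 2)) (- (c * s ^+ 2)).
    by apply: is_derive_eq; rewrite /GRing.scale/=; ring.
  apply: is_derive_eq; rewrite /GRing.scale/= /q.
  by field; rewrite gt_eqF.
have Fc (x : R) : F z @[z --> x] --> F x.
  by apply: differentiable_continuous; apply/derivable1_diffP; case: (dF x).
have qc : continuous q.
  move=> x; apply: cvgM; last exact: gauss_cont.
  apply: cvgD; last exact: cvg_cst.
  apply: cvgD; apply: cvgM; try exact: cvg_cst; first exact: cvg_id.
  by exact: exprn_continuous.
have mq : measurable_fun setT q by exact: continuous_measurable_fun.
pose I (n : nat) : set R := `[- n.+1%:R, n.+1%:R]%classic.
pose qn (n : nat) := fun x : measurableTypeR R => (q x * \1_(I n) x)%:E.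
pose dom := fun x : measurableTypeR R =>
  ((`|b| + `|c| + `|- (c * s ^+ 2)|) * (1 + `|x| ^+ 3) * ph x)%:E.
have mqE : measurable_fun setT (fun x : measurableTypeR R => (q x)%:E) by exact/measurable_EFinP.
have mI n : measurable (I n) by exact: measurable_itv.
have mqn n : measurable_fun setT (qn n).
  have mind : measurable_fun setT (\1_(I n) : R -> R) by apply/measurable_indic; exact: mI.
  by have mprod := measurable_funM mq mind; apply/measurable_EFinP; exact: mprod.
have qle x : (`|(q x)%:E| <= dom x)%E.
  by rewrite /dom/= lee_fin normrM (ger0_norm (gauss_ge0 x)) ler_wpM2r ?gauss_ge0// poly2_le.
have Iev (x : R) : \forall n \near \oo, x \in I n.
  near=> n; rewrite inE /I/= in_itv/= -ler_norml.
  apply: le_trans (_ : n%:R <= _); last by rewrite ler_nat.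
  by near: n; exact: nbhs_infty_ger.
(* The fundamental theorem is applied on the symmetric intervals [I n]; dominated convergence
   extends the result to the whole line. *)
have [_ _ lim] : [/\ leb.-integrable setT (fun x : measurableTypeR R => (q x)%:E),
   (fun n => \int[leb]_x `|qn n x - (q x)%:E|)%E @ \oo --> 0%E &
   (fun n => \int[leb]_x qn n x)%E @ \oo --> (\int[leb]_x (q x)%:E)%E].
  apply: (@dominated_convergence _ _ _ leb setT measurableT qn _ dom) => //.
  - apply: aeW => x _; apply: cvg_near_cst; near=> n.
    have xn : x \in I n by near: n; exact: Iev.
    by rewrite /qn indicE xn mulr1.
  - exact: gauss_dom_integrable.
  - apply: aeW => x n _; apply: le_trans (qle x); rewrite /qn indicE.
    by case: (_ \in _); rewrite ?mulr1 // mulr0 abse0 abse_ge0.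
have E n : (\int[leb]_x qn n x = (F n.+1%:R - F (- n.+1%:R))%:E)%E.
  have -> : (\int[leb]_x qn n x = \int[leb]_(x in I n) (q x)%:E)%E.
    rewrite [RHS]integral_mkcond; apply: eq_integral => x _.
    by rewrite /qn patchE indicE; case: ifP; rewrite ?mulr1 ?mulr0.
  rewrite /I (@continuous_FTC2 _ q F) ?EFinB//.
  - by rewrite -subr_gt0 opprK addr_gt0.
  - exact: continuous_subspaceT.
  - split; first by move=> x _; case: (dF x).
      by apply: cvg_at_right_filter; exact: Fc.
    by apply: cvg_at_left_filter; exact: Fc.
  - by move=> x _; rewrite derive1E; case: (dF x).
have FE (x : R) : F x - F (- x) = - (2 * c * s ^+ 2) * (x * ph x).
  by rewrite /F !gaussE sqrrN; ring.
have F0 : (F n.+1%:R - F (- n.+1%:R)) @[n --> \oo] --> (0 : R).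
  rewrite (_ : (fun n => _) = (fun n => - (2 * c * s ^+ 2) * (n.+1%:R * ph n.+1%:R))); last first.
    by apply/funext => n; rewrite FE.
  rewrite -(mulr0 (- (2 * c * s ^+ 2))); apply: cvgM; first exact: cvg_cst.
  have h := gauss_poly_cvg0 1 0.
  have h2 : (1 * n.+1%:R ^+ 2 + 0) * ph n.+1%:R @[n --> \oo] --> (0 : R).
    apply: (cvg_comp (fun n : nat => n.+1%:R : R) _ _ h).
    apply/cvgryPge => A; near=> n; apply: le_trans (_ : n%:R <= _); last by rewrite ler_nat.
    by near: n; exact: nbhs_infty_ger.
  apply: (squeeze_cvgr _ (cvg_cst 0) h2); near=> n.
  rewrite mulr_ge0 ?gauss_ge0//= addr0 mul1r ler_wpM2r ?gauss_ge0//.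
  by rewrite expr2 ler_peMr// ler1n.
apply: (cvg_unique _ lim) => //.
rewrite (_ : (fun n => _) = (fun n => (F n.+1%:R - F (- n.+1%:R))%:E)); last exact/funext.
by apply: cvg_EFin; [near=> n|exact: F0].
Unshelve. all: by end_near. Qed.

Lemma integral_normal_prob (f : R -> \bar R) :
  (normal_prob 0 s).-integrable setT f ->
  (\int[normal_prob 0 s]_x f x = \int[leb]_x (f x * (ph x)%:E))%E.
Proof.
move=> fint; have mf := measurable_int _ fint.
rewrite -(Radon_Nikodym_change_of_variables (normal_prob_dominates 0 s))//=.
apply: ae_eq_integral => //.
- apply: emeasurable_funM => //; apply: (measurable_int leb).
  by apply: Radon_Nikodym_integrable; exact: normal_prob_dominates.
- apply: emeasurable_funM => //=; apply/measurable_EFinP; exact: measurable_gauss.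
- apply: ae_eqe_mul2l => /=.
  rewrite Radon_NikodymE//=; first exact: normal_prob_dominates.
  move=> abmu; case: cid => /= h [h1 h2 h3].
  apply: integral_ae_eq => //=.
  + by apply/measurable_EFinP; exact: measurable_gauss.
  + by move=> E E01 mE; rewrite -h3.
Qed.

(** The linear term has mean 0, the square has mean s^2, and 4 s^4 [ph 0] is the third absolute
    moment. *)
Lemma normal_prob_upper (f : R -> R) (a b c d : R) : measurable_fun setT f ->
  (forall w, 0 <= f w <= 1) -> 0 <= d ->
  (forall w, f w <= a + b * w + c * w ^+ 2 + d * `|w| ^+ 3) ->
  (\int[normal_prob 0 s]_w (f w)%:E <= (a + c * s ^+ 2 + d * (4 * s ^+ 4 * ph 0))%:E)%E.
Proof.
move=> mf f01 d0 fp.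
have fint : (normal_prob 0 s).-integrable setT (EFin \o f).
  apply: (@le_integrable _ _ _ _ _ measurableT _ (cst 1%:E)).
  - exact/measurable_EFinP.
  - move=> x _ /=; rewrite normr1 lee_fin; have /andP[f0 f1] := f01 x.
    by rewrite ger0_norm.
  - exact: finite_measure_integrable_cst.
have -> : (\int[normal_prob 0 s]_w (f w)%:E = \int[leb]_x (f x * ph x)%:E)%E.
  by rewrite (integral_normal_prob fint).
have phint : leb.-integrable setT (fun x : measurableTypeR R => (ph x)%:E).
  exact: integrable_normal_pdf.
pose q : R -> R := fun x => (b * x + c * x ^+ 2 + - (c * s ^+ 2)) * ph x.
have qint : leb.-integrable setT (fun x : measurableTypeR R => (q x)%:E).
  apply: (le_integrable measurableT _ _ (gauss_dom_integrable (`|b| + `|c| + `|- (c * s ^+ 2)|))).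
    apply/measurable_EFinP; apply: measurable_funM; last exact: measurable_gauss.
    apply: measurable_funD => //; apply: measurable_funD; apply: measurable_funM => //.
  move=> x _; rewrite /= lee_fin normrM [leRHS]ger0_norm ?mulr_ge0 ?gauss_ge0 ?addr_ge0 ?exprn_ge0//.
  by rewrite (ger0_norm (gauss_ge0 x)) ler_wpM2r ?gauss_ge0// poly2_le.
have int2 : leb.-integrable setT
    (fun x : measurableTypeR R => ((a + c * s ^+ 2)%:E * (ph x)%:E)%E) by exact: integrableZl.
have int3 : leb.-integrable setT
    (fun x : measurableTypeR R => (d%:E * (`|x| ^+ 3 * ph x)%:E)%E).
  by apply: integrableZl => //; exact: gauss_cube_integrable.
have i1 : (\int[leb]_x ((q x)%:E + ((a + c * s ^+ 2)%:E * (ph x)%:E + d%:E * (`|x| ^+ 3 * ph x)%:E)) =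
    (a + c * s ^+ 2 + d * (4 * s ^+ 4 * ph 0))%:E)%E.
  rewrite integralD//=; last exact: integrableD.
  rewrite integralD//= integralZl//= integralZl//=; last exact: gauss_cube_integrable.
  by rewrite gauss_mean_var gauss_cube_integral integral_normal_pdf mule1 add0e.
rewrite -i1; apply: le_integral => //.
- apply: (le_integrable measurableT _ _ phint).
    by apply/measurable_EFinP; apply: measurable_funM => //; exact: measurable_gauss.
  move=> x _; rewrite /= lee_fin normrM ler_piMl//.
  by have /andP[f0 f1] := f01 x; rewrite ger0_norm.
- by apply: integrableD => //; exact: integrableD.
- move=> x _; rewrite -!EFinM -!EFinD lee_fin.
  have -> : q x + ((a + c * s ^+ 2) * ph x + d * (`|x| ^+ 3 * ph x)) =
     (a + b * x + c * x ^+ 2 + d * `|x| ^+ 3) * ph x by rewrite /q; ring.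
  by rewrite ler_wpM2r ?gauss_ge0.
Qed.

Lemma gauss_cube_scale : 4 * s ^+ 4 * ph 0 = 4 / Num.sqrt (pi *+ 2) * s ^+ 3.
Proof.
rewrite gaussE expr0n /= oppr0 mul0r expR0 mulr1 /pk /normal_peak -mulrnAr sqrtrM ?sqr_ge0//.
rewrite sqrtr_sqr gtr0_norm//; field.
apply/andP; split; last by rewrite gt_eqF.
by rewrite gt_eqF// sqrtr_gt0 pmulrn_lgt0// pi_gt0.
Qed.

End GaussianMoments.

Ltac nneg := repeat match goal with
  | |- is_true (0 <= _ + _) => apply: addr_ge0
  | |- is_true (0 <= _ * _) => apply: mulr_ge0
  | |- is_true (0 <= _ ^+ 2) => exact: sqr_ge0
  | |- is_true (0 <= _ ^+ _) => apply: exprn_ge0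
  | |- is_true (0 <= _^-1) => rewrite invr_ge0
  | |- is_true (0 <= `|_|) => exact: normr_ge0
  | |- is_true (0 <= nrm _) => exact: nrm_ge0
  | |- is_true (0 <= expR _) => exact: expR_ge0
  | |- _ => first [done | by apply: ltW]
  end.

(** * Comparison for the tails of the reflected walk *)

Section OneStep.
Context {R : realType}.

Let kap : R := 4 / Num.sqrt (pi *+ 2).

Lemma kap_ge0 : 0 <= kap.
Proof. by rewrite divr_ge0// sqrtr_ge0. Qed.

Definition gexp (r : R) (f : R -> R) : R := fine (\int[normal_prob 0 r]_w (f w)%:E).

Lemma gexp_bounded_int (r : R) (f : R -> R) : measurable_fun setT f ->
  (forall w, 0 <= f w <= 1) ->
  (normal_prob 0 r).-integrable setT (EFin \o f).
Proof.
move=> mf f01; apply: (@le_integrable _ _ _ _ _ measurableT _ (cst 1%:E)).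
- exact/measurable_EFinP.
- move=> x _ /=; rewrite normr1 lee_fin; have /andP[f0 f1] := f01 x.
  by rewrite ger0_norm.
- exact: finite_measure_integrable_cst.
Qed.

Lemma gexp_upper (r : R) (f : R -> R) (a b c d : R) : 0 < r -> measurable_fun setT f ->
  (forall w, 0 <= f w <= 1) -> 0 <= d ->
  (forall w, f w <= a + b * w + c * w ^+ 2 + d * `|w| ^+ 3) ->
  gexp r f <= a + c * r ^+ 2 + d * (kap * r ^+ 3).
Proof.
move=> r0 mf f01 d0 fp; have := normal_prob_upper r0 mf f01 d0 fp.
rewrite gauss_cube_scale// -/kap.
have ffin : (\int[normal_prob 0 r]_w (f w)%:E)%E \is a fin_num.
  exact: integrable_fin_num (gexp_bounded_int r mf f01).
by rewrite -{1}(fineK ffin) lee_fin.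
Qed.

(** Applying upper estimates to 1 - f yields the lower ones, so only one direction has to be
    expanded. *)
Lemma gexp_compl (r : R) (f : R -> R) : measurable_fun setT f ->
  (forall w, 0 <= f w <= 1) -> gexp r (fun w => 1 - f w) = 1 - gexp r f.
Proof.
move=> mf f01; have fint := gexp_bounded_int r mf f01.
rewrite /gexp (_ : \int[_]_w _ = 1%:E - \int[normal_prob 0 r]_w (f w)%:E)%E.
  by rewrite fineB//; exact: integrable_fin_num fint.
under eq_integral do rewrite EFinB.
rewrite integralB//=; last exact: finite_measure_integrable_cst.
by rewrite integral_cst//= probability_setT mule1.
Qed.

(** One step of length r^2, with noise of standard deviation r. [C] depends only on mu, sigma and
    [M], so the estimate can be iterated; [g] is unrestricted because it will carry the accumulated
    error. The cross term of the square is linear in the noise and has mean 0. *)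
Lemma gexp_taylor (mu sigma M : R) : 0 <= M ->
  exists2 C, 0 <= C & forall (r y : R) (f : R -> R) (g g1 g2 : R), 0 < r -> r <= 1 ->
  measurable_fun setT f -> (forall w, 0 <= f w <= 1) -> `|g1| <= M -> `|g2| <= M ->
  (forall e, f (y + e) <= g + e * g1 + e ^+ 2 / 2 * g2 + M * `|e| ^+ 3) ->
  gexp r (fun w => f (y - mu * r ^+ 2 - sigma * w)) <=
    g + r ^+ 2 * (2^-1 * sigma ^+ 2 * g2 - mu * g1) + C * r ^+ 3.
Proof.
move=> M0.
exists (2^-1 * mu ^+ 2 * M + 4 * M * `|mu| ^+ 3 + 4 * M * `|sigma| ^+ 3 * kap).
  by have := kap_ge0 => k0; nneg.
move=> r y f g g1 g2 r0 r1 mf f01 g1M g2M ft.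
have mf' : measurable_fun setT (fun w => f (y - mu * r ^+ 2 - sigma * w)).
  apply: measurableT_comp => //; apply: measurable_funB => //.
have up := @gexp_upper r _
  (g - mu * r ^+ 2 * g1 + 2^-1 * mu ^+ 2 * r ^+ 4 * g2 + 4 * M * `|mu| ^+ 3 * r ^+ 6)
  (- sigma * g1 + mu * r ^+ 2 * sigma * g2) (2^-1 * sigma ^+ 2 * g2)
  (4 * M * `|sigma| ^+ 3) r0 mf' (fun w => f01 _).
apply: le_trans (up _ _) _.
- by nneg.
- move=> w; have := ft (- mu * r ^+ 2 - sigma * w).
  rewrite addrA mulNr => /le_trans; apply.
  have cube (a b : R) : `|a + b| ^+ 3 <= 4 * `|a| ^+ 3 + 4 * `|b| ^+ 3.
    have h1 : `|a + b| ^+ 3 <= (`|a| + `|b|) ^+ 3.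
      by rewrite lerXn2r ?nnegrE ?addr_ge0// ler_normD.
    apply: le_trans h1 _; have a0 := normr_ge0 a; have b0 := normr_ge0 b.
    move: `|a| `|b| a0 b0 => p q p0 q0; rewrite -subr_ge0.
    have -> : 4 * p ^+ 3 + 4 * q ^+ 3 - (p + q) ^+ 3 = 3 * ((p + q) * (p - q) ^+ 2) by ring.
    by nneg.
  have := cube (- (mu * r ^+ 2)) (- (sigma * w)).
  rewrite !normrN (normrM mu) (normrM sigma) (ger0_norm (sqr_ge0 r)) (exprMn _ `|mu|) (exprMn _ `|sigma|) => /(ler_wpM2l M0) h.
  move: h; set z := `| _ |; rewrite -!mulNr; lra.
rewrite -subr_ge0.
have -> : g + r ^+ 2 * (2^-1 * sigma ^+ 2 * g2 - mu * g1) +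
   (2^-1 * mu ^+ 2 * M + 4 * M * `|mu| ^+ 3 + 4 * M * `|sigma| ^+ 3 * kap) * r ^+ 3 -
   (g - mu * r ^+ 2 * g1 + 2^-1 * mu ^+ 2 * r ^+ 4 * g2 + 4 * M * `|mu| ^+ 3 * r ^+ 6 +
   2^-1 * sigma ^+ 2 * g2 * r ^+ 2 + 4 * M * `|sigma| ^+ 3 * (kap * r ^+ 3)) =
   2^-1 * mu ^+ 2 * r ^+ 3 * (M - r * g2) + 4 * M * `|mu| ^+ 3 * (r ^+ 3 - r ^+ 6) by field.
have r3 : 0 <= r ^+ 3 by rewrite exprn_ge0 ?ltW.
apply: addr_ge0; apply: mulr_ge0.
- by nneg.
- rewrite subr_ge0; apply: (@le_trans _ _ (1 * `|g2|)); last by rewrite mul1r.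
  apply: le_trans (ler_norm _) _; rewrite normrM ler_wpM2r// gtr0_norm//.
- by nneg.
- by rewrite subr_ge0 (exprD r 3 3) ler_piMr// exprn_ile1// ltW.
Qed.

End OneStep.

(** * Discrete comparison principle *)

Section Comparison.
Context {R : realType} {m : nat}.
Variables (mu sigma : 'rV[R]_m) (Q : 'M[R]_m) (alpha : 'rV[R]_m).
Hypotheses (hQ : is_generator Q) (hirr : is_irreducible Q)
  (halpha : is_stationary Q alpha).

(** The forward operator acting on tails, evaluated on separate values for the function and its two
    derivatives, so that no differentiability is required. The minus sign comes from T(y - mu h) for
    a step mu h. *)
Definition drift (g g1 g2 : 'I_m -> R) i : R :=
  2^-1 * sigma 0 i ^+ 2 * g2 i - mu 0 i * g1 i + \sum_j g j * Q j i.

(** The transition matrix is I + r^2 Q + O(r^4), and its products with the terms of order r^2 are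
    O(r^3) since r <= 1. The accumulated error is kept proportional to alpha because the chain then
    passes it on without growth. *)
Lemma transition_step (M C1 : R) : 0 <= M -> 0 <= C1 ->
  exists2 C, 0 <= C & forall (r c : R) (x g g1 g2 : 'I_m -> R), 0 < r -> r <= 1 ->
  (forall j, `|g j| <= M) -> (forall j, `|g1 j| <= M) -> (forall j, `|g2 j| <= M) ->
  (forall j, x j <= g j + r ^+ 2 * (2^-1 * sigma 0 j ^+ 2 * g2 j - mu 0 j * g1 j)
                    + C1 * r ^+ 3 + c * alpha 0 j) ->
  forall i, \sum_j expmx (r ^+ 2 *: Q) j i * x j <=
    g i + r ^+ 2 * drift g g1 g2 i + C * r ^+ 3 + c * alpha 0 i.
Proof.
move=> M0 C10.
pose B j : R := 2^-1 * sigma 0 j ^+ 2 * M + `|mu 0 j| * M.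
have B0 j : 0 <= B j by rewrite /B; nneg.
pose q := nrm Q ^+ 2 * expR (nrm Q).
have q0 : 0 <= q by rewrite mulr_ge0 ?sqr_ge0 ?expR_ge0.
exists (C1 + \sum_j ((q + nrm Q) * (M + B j + C1))).
  by rewrite addr_ge0// sumr_ge0// => j _; nneg.
move=> r c x g g1 g2 r0 r1 gM g1M g2M xle i.
set P := expmx _; set h := r ^+ 2.
have h0 : 0 <= h by exact: sqr_ge0.
have h1 : h <= 1 by rewrite exprn_ile1// ltW.
have P0 j k : 0 <= P j k by apply: metzler_expmx_ge0 => //; exact: generator_metzler.
pose G j : R := h * (2^-1 * sigma 0 j ^+ 2 * g2 j - mu 0 j * g1 j) + C1 * r ^+ 3.
have aP : \sum_j P j i * alpha 0 j = alpha 0 i.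
  have [_ aQ _] := halpha.
  have /matrixP/(_ 0 i) := expmx_left_null h aQ; rewrite mxE => <-.
  by apply: eq_bigr => j _; rewrite mulrC.
have step1 : \sum_j P j i * x j <= \sum_j P j i * (g j + G j) + c * alpha 0 i.
  apply: (@le_trans _ _ (\sum_j P j i * (g j + G j + c * alpha 0 j))).
    apply: ler_sum => j _; rewrite ler_wpM2l//; apply: le_trans (xle j) _.
    by rewrite /G !addrA.
  under eq_bigr do rewrite mulrDr (mulrCA _ c).
  by rewrite big_split/= -mulr_sumr aP.
apply: le_trans step1 _; rewrite lerD2r.
have r3 : 0 <= r ^+ 3 by rewrite exprn_ge0// ltW.
have r31 : r ^+ 3 <= 1 by rewrite exprn_ile1// ltW.
have hr3 : h * h <= r ^+ 3 
  by rewrite (_ : h * h = r ^+ 3 * r); [rewrite ler_piMr|rewrite /h; ring].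
have hr3' : r ^+ 3 * h <= r ^+ 3 by rewrite ler_piMr.
have Gb j : `|G j| <= h * B j + C1 * r ^+ 3.
  apply: le_trans (ler_normD _ _) _; apply: lerD.
    rewrite normrM (ger0_norm h0) ler_wpM2l//; apply: le_trans (ler_normB _ _) _.
    apply: lerD; rewrite normrM; last by rewrite ler_wpM2l.
    have s20 : 0 <= 2^-1 * sigma 0 j ^+ 2 by nneg.
    by rewrite (ger0_norm s20) ler_wpM2l.
  by rewrite normrM (ger0_norm C10) (ger0_norm r3).
have Pq j : `|P j i - (j == i)%:R - h * Q j i| <= h ^+ 2 * q.
  have := @expmx_tail2 _ _ Q h j i; rewrite (ger0_norm h0) => /(_ h1); apply: le_trans.
  have gen (X : 'M[R]_m) : (X - 1%:M - h *: Q) j i = X j i - (j == i)%:R - h * Q j i.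
    by rewrite !mxE.
  by rewrite gen.
have -> : \sum_j P j i * (g j + G j) = g i + G i + h * \sum_j g j * Q j i +
   \sum_j ((P j i - (j == i)%:R - h * Q j i) * (g j + G j) + h * Q j i * G j).
  have -> : g i + G i = \sum_j (j == i)%:R * (g j + G j).
    rewrite (bigD1 i)//= eqxx mul1r big1 ?addr0// => j ji.
    by rewrite (negbTE ji) mul0r.
  rewrite mulr_sumr -!big_split/=; apply: eq_bigr => j _; ring.
have -> : g i + h * drift g g1 g2 i + (C1 + \sum_j ((q + nrm Q) * (M + B j + C1))) * r ^+ 3 =
   g i + G i + h * \sum_j g j * Q j i + \sum_j ((q + nrm Q) * (M + B j + C1)) * r ^+ 3.
  by rewrite /drift /G -mulr_suml; ring.
rewrite lerD2l; apply: ler_sum => j _.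
have GB : `|G j| <= B j + C1.
  apply: le_trans (Gb j) _; apply: lerD; first by rewrite ler_piMl.
  by rewrite ler_piMr.
have -> : (q + nrm Q) * (M + B j + C1) * r ^+ 3 =
    q * (M + B j + C1) * r ^+ 3 + nrm Q * (M + B j + C1) * r ^+ 3 by ring.
apply: lerD.
  apply: le_trans (ler_norm _) _; rewrite normrM.
  apply: (@le_trans _ _ (h ^+ 2 * q * (M + (B j + C1)))).
    by apply: ler_pM => //; apply: le_trans (ler_normD _ _) _; exact: lerD.
  rewrite addrA -mulrA mulrC; apply: ler_wpM2l; last by rewrite expr2.
  by have := B0 j => Bj; nneg.
apply: le_trans (ler_norm _) _; rewrite normrM normrM (ger0_norm h0).
apply: (@le_trans _ _ (h * nrm Q * (h * B j + C1 * r ^+ 3))).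
  apply: ler_pM; [nneg|nneg| |exact: Gb].
  by apply: ler_wpM2l => //; exact: entry_le_nrm.
have -> : h * nrm Q * (h * B j + C1 * r ^+ 3) =
    nrm Q * (B j * (h * h) + C1 * (r ^+ 3 * h)) by ring.
rewrite -mulrA ler_wpM2l ?nrm_ge0//.
have := ler_wpM2l (B0 j) hr3; have := ler_wpM2l C10 hr3'; have := mulr_ge0 M0 r3.
move: (B j) (h * h) (r ^+ 3 * h) => x1 x2 x3; lra.
Qed.

(** The base point is nonnegative but the increment is arbitrary: the noise may carry the argument
    below 0. *)
Definition taylor_bound (M : R) (g g1 g2 : 'I_m -> R -> R) : Prop :=
  forall j y, 0 <= y -> [/\ `|g j y| <= M, `|g1 j y| <= M, `|g2 j y| <= M &
    forall e, `|g j (y + e) - g j y - e * g1 j y - e ^+ 2 / 2 * g2 j y| <= M * `|e| ^+ 3].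

Lemma taylor_boundD (M M' a b : R) g g1 g2 k k1 k2 :
  taylor_bound M g g1 g2 -> taylor_bound M' k k1 k2 ->
  taylor_bound (`|a| * M + `|b| * M') (fun j y => a * g j y + b * k j y)
    (fun j y => a * g1 j y + b * k1 j y) (fun j y => a * g2 j y + b * k2 j y).
Proof.
have aux (x y X Y : R) : `|x| <= X -> `|y| <= Y -> `|a * x + b * y| <= `|a| * X + `|b| * Y.
  by move=> xX yY; apply: le_trans (ler_normD _ _) _; rewrite !normrM lerD// ler_wpM2l.
move=> tg tk j y y0; have [h0 h1 h2 h3] := tg j y y0; have [l0 l1 l2 l3] := tk j y y0.
split; [exact: aux|exact: aux|exact: aux|] => e.
rewrite mulrDl -!mulrA; apply: le_trans (aux _ _ _ _ (h3 e) (l3 e)).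
by rewrite le_eqVlt; apply/orP; left; apply/eqP; congr `|_|; ring.
Qed.

(* [T k i y] stands for P[Y_k > y, X_k = i], with Y the reflected walk of time
   step [r ^+ 2] and X the chain; since Y >= 0, this is [p k i] = P[X_k = i]
   for y < 0. *)
Record tail_system (r : R) (T : nat -> 'I_m -> R -> R) (p : nat -> 'I_m -> R) : Prop := {
  ts_meas : forall k j, measurable_fun setT (T k j);
  ts_01 : forall k j y, 0 <= T k j y <= 1;
  ts_neg : forall k j y, y < 0 -> T k j y = p k j;
  ts_init : forall j y, 0 <= y -> T 0%N j y = 0;
  ts_step : forall k i y, 0 <= y -> T k.+1 i y =
    \sum_j expmx (r ^+ 2 *: Q) j i *
      gexp r (fun w => T k j (y - mu 0 j * r ^+ 2 - sigma 0 j * w)) }.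

(** The recursion has nonnegative weights, so an inequality between tail and barrier propagates from
    one step to the next; each step adds an error of order r^3. For y < 0 and at step 0 the
    comparison is a hypothesis on the barrier. *)
Lemma tail_comparison (M : R) : 0 <= M ->
  exists2 C, 0 <= C & forall (r : R) T p (G G1 G2 : nat -> 'I_m -> R -> R),
  0 < r -> r <= 1 -> tail_system r T p ->
  (forall k, taylor_bound M (G k) (G1 k) (G2 k)) ->
  ((forall k j y, y < 0 -> p k j <= G k j y) ->
   (forall j y, 0 <= y -> 0 <= G 0%N j y) ->
   (forall k i y, 0 <= y -> G k i y +
      r ^+ 2 * drift (G k ^~ y) (G1 k ^~ y) (G2 k ^~ y) i <= G k.+1 i y) ->
   forall k i y, T k i y <= G k i y + k%:R * (C * r ^+ 3) * alpha 0 i) /\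
  ((forall k j y, y < 0 -> G k j y <= p k j) ->
   (forall j y, 0 <= y -> G 0%N j y <= 0) ->
   (forall k i y, 0 <= y -> G k.+1 i y <= G k i y +
      r ^+ 2 * drift (G k ^~ y) (G1 k ^~ y) (G2 k ^~ y) i) ->
   forall k i y, G k i y - k%:R * (C * r ^+ 3) * alpha 0 i <= T k i y).
Proof.
move=> M0.
have /choice[c cP] : forall j, exists c, 0 <= c /\ forall (r y : R) (f : R -> R) (g g1 g2 : R), 0 < r -> r <= 1 ->
  measurable_fun setT f -> (forall w, 0 <= f w <= 1) -> `|g1| <= M -> `|g2| <= M ->
  (forall e, f (y + e) <= g + e * g1 + e ^+ 2 / 2 * g2 + M * `|e| ^+ 3) ->
  gexp r (fun w => f (y - mu 0 j * r ^+ 2 - sigma 0 j * w)) <=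
    g + r ^+ 2 * (2^-1 * sigma 0 j ^+ 2 * g2 - mu 0 j * g1) + c * r ^+ 3.
  by move=> j; have [c c0 cP] := gexp_taylor (mu 0 j) (sigma 0 j) M0; exists c.
pose C1 := \sum_j c j.
have c0 j : 0 <= c j by case: (cP j).
have cC j : c j <= C1 by rewrite /C1 (bigD1 j)//= lerDl sumr_ge0.
have C10 : 0 <= C1 by rewrite sumr_ge0.
have [C2 C20 C2P] := transition_step M0 C10.
have apos := stationary_gt0 hQ hirr halpha.
have [k1 k10 k1P] := @strict_ratio _ _ (fun=> 1) (fun i => alpha 0 i) (fun=> ltr01) apos.
(* Every alpha_i is at least [k1], so the constant error [C2] is dominated by [C] times alpha_i. *)
pose C := C2 / k1.
have C0 : 0 <= C by rewrite divr_ge0// ltW.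
have CP (r : R) i : 0 < r -> C2 * r ^+ 3 <= C * r ^+ 3 * alpha 0 i.
  move=> r0; rewrite mulrAC ler_wpM2r ?exprn_ge0 ?(ltW r0)//.
  by rewrite /C mulrAC ler_pdivlMr// ler_wpM2l//; have := k1P i; rewrite mulr1.
exists C => // r T p G G1 G2 r0 r1 [mT T01 Tneg T0 Tstep] tG.
have r20 : 0 <= r ^+ 2 by exact: sqr_ge0.
split=> bnd ini step; elim=> [|k IH] i y.
- rewrite !mul0r addr0; have [y0|y0] := leP 0 y; first by rewrite T0// ini.
  by rewrite Tneg// bnd.
- have [y0|y0] := leP 0 y; last first.
    rewrite Tneg//; apply: le_trans (bnd _ _ _ y0) _; rewrite lerDl.
    by have := apos i => ai; nneg.
  rewrite Tstep//.
  have H j : gexp r (fun w => T k j (y - mu 0 j * r ^+ 2 - sigma 0 j * w)) <=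
      G k j y + r ^+ 2 * (2^-1 * sigma 0 j ^+ 2 * G2 k j y - mu 0 j * G1 k j y) +
      C1 * r ^+ 3 + k%:R * (C * r ^+ 3) * alpha 0 j.
    have [_ g1M g2M gT] := tG k j y y0; have [_ cjP] := cP j.
    apply: le_trans (cjP r y (T k j) (G k j y + k%:R * (C * r ^+ 3) * alpha 0 j) (G1 k j y) (G2 k j y) _ _ _ _ _ _ _) _ => //.
      move=> e; apply: le_trans (IH j (y + e)) _.
      by have := gT e; rewrite ler_norml => /andP[_]; lra.
    have : c j * r ^+ 3 <= C1 * r ^+ 3 by rewrite ler_wpM2r ?exprn_ge0 ?(ltW r0).
    lra.
  have := C2P r (k%:R * (C * r ^+ 3)) _ (G k ^~ y) (G1 k ^~ y) (G2 k ^~ y) r0 r1 _ _ _ H i.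
  move=> /(_ (fun j => let: And4 a _ _ _ := tG k j y y0 in a)
             (fun j => let: And4 _ a _ _ := tG k j y y0 in a)
             (fun j => let: And4 _ _ a _ := tG k j y y0 in a)) h.
  apply: le_trans h _; have := step k i y y0; have := CP r i r0.
  rewrite -natr1; lra.
- rewrite !mul0r subr0; have [y0|y0] := leP 0 y; first by rewrite T0// ini.
  by rewrite Tneg// bnd.
- have [y0|y0] := leP 0 y; last first.
    rewrite Tneg//; apply: le_trans (bnd _ _ _ y0); rewrite lerBlDr lerDl.
    by have := apos i => ai; nneg.
  rewrite Tstep//.
  have H j : - gexp r (fun w => T k j (y - mu 0 j * r ^+ 2 - sigma 0 j * w)) <=
      - G k j y + r ^+ 2 * (2^-1 * sigma 0 j ^+ 2 * - G2 k j y - mu 0 j * - G1 k j y) +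
      C1 * r ^+ 3 + k%:R * (C * r ^+ 3) * alpha 0 j.
    have [_ g1M g2M gT] := tG k j y y0; have [_ cjP] := cP j.
    (* The lower bound is the upper one for 1 - T and the negated barrier. *)
    have mc : measurable_fun setT (fun z => 1 - T k j z) by exact: measurable_funB.
    have T01' z : 0 <= 1 - T k j z <= 1.
      by have /andP[? ?] := T01 k j z; apply/andP; split; lra.
    have := cjP r y (fun z => 1 - T k j z)
      (1 - G k j y + k%:R * (C * r ^+ 3) * alpha 0 j) (- G1 k j y) (- G2 k j y) r0 r1 mc T01'.
    rewrite !normrN => /(_ g1M g2M).
    have mf' : measurable_fun setT (fun w => T k j (y - mu 0 j * r ^+ 2 - sigma 0 j * w)).
      apply: measurableT_comp => //; apply: measurable_funB => //.
    rewrite (gexp_compl r mf')//.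
    have : c j * r ^+ 3 <= C1 * r ^+ 3 by rewrite ler_wpM2r ?exprn_ge0 ?(ltW r0).
    move=> h1 h2; have {h2} := h2 _; move: h1 => h1 h2.
    have : forall e, 1 - T k j (y + e) <= 1 - G k j y + k%:R * (C * r ^+ 3) * alpha 0 j +
        e * - G1 k j y + e ^+ 2 / 2 * - G2 k j y + M * `|e| ^+ 3.
      move=> e; have := IH j (y + e).
      by have := gT e; rewrite ler_norml => /andP[+ _]; lra.
    move=> /h2; lra.
  have := C2P r (k%:R * (C * r ^+ 3)) _ (fun j => - G k j y) (fun j => - G1 k j y)
     (fun j => - G2 k j y) r0 r1 _ _ _ H i.
  have hn (u : 'I_m -> R) : (forall j, `|u j| <= M) -> forall j, `|- u j| <= M.
    by move=> uM j; rewrite normrN.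
  move=> /(_ (hn _ (fun j => let: And4 a _ _ _ := tG k j y y0 in a))
             (hn _ (fun j => let: And4 _ a _ _ := tG k j y y0 in a))
             (hn _ (fun j => let: And4 _ _ a _ := tG k j y y0 in a))) h.
  have dE : drift (fun j => - G k j y) (fun j => - G1 k j y) (fun j => - G2 k j y) i =
     - drift (G k ^~ y) (G1 k ^~ y) (G2 k ^~ y) i.
    rewrite /drift; under eq_bigr do rewrite mulNr.
    by rewrite sumrN; ring.
  move: h; rewrite dE; under eq_bigr do rewrite mulrN; rewrite sumrN.
  have := step k i y y0; have := CP r i r0.
  rewrite -natr1; lra.
Qed.

End Comparison.

Section FlowCut.
Context {R : realType} {m : nat}.

(* A jump from [y >= 0] to below [- delta] has size at least [delta], so the
   cut only changes the cubic term of the Taylor bounds. *)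
Definition flow_cut (v : 'rV[R]_m) (B : 'M[R]_m) (delta : R) (c0 : 'I_m -> R) j z : R :=
  if z < - delta then c0 j else (v *m expmx (z *: B)) 0 j.

Definition flow_d1 (v : 'rV[R]_m) (B : 'M[R]_m) j (y : R) : R :=
  (v *m expmx (y *: B) *m B) 0 j.

Definition flow_d2 (v : 'rV[R]_m) (B : 'M[R]_m) j (y : R) : R :=
  (v *m expmx (y *: B) *m B *m B) 0 j.

Lemma flow_cut_ge (v : 'rV[R]_m) B delta c0 j z : - delta <= z ->
  flow_cut v B delta c0 j z = (v *m expmx (z *: B)) 0 j.
Proof. by rewrite /flow_cut ltNge => ->. Qed.

Lemma row_mulmx_le n (w : 'rV[R]_m) (B : 'M[R]_(m, n)) (K : R) j :
  (forall k, `|w 0 k| <= K) -> `|(w *m B) 0 j| <= K * nrm B.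
Proof.
move=> wK; rewrite mxE; apply: le_trans (ler_norm_sum _ _ _) _.
rewrite /nrm mulr_sumr; apply: ler_sum => k _; rewrite normrM.
apply: ler_pM => //; rewrite (bigD1 j)//= lerDl; exact: sumr_ge0.
Qed.

Lemma taylor_bound_le (M M' : R) (g g1 g2 : 'I_m -> R -> R) : M <= M' ->
  taylor_bound M g g1 g2 -> taylor_bound M' g g1 g2.
Proof.
move=> MM h j y y0; have [a b c d] := h j y y0; split; try exact: le_trans MM.
by move=> e; apply: le_trans (d e) _; rewrite ler_wpM2r// exprn_ge0.
Qed.

Lemma flow_cut_taylor (v : 'rV[R]_m) B (delta K : R) c0 :
  0 < delta -> delta <= 1 -> 0 <= K ->
  (forall z j, - delta <= z -> `|(v *m expmx (z *: B)) 0 j| <= K) ->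
  (forall j, `|c0 j| <= K) ->
  exists2 M, 0 <= M & taylor_bound M (flow_cut v B delta c0) (flow_d1 v B) (flow_d2 v B).
Proof.
move=> d0 d1 K0 vK cK; set n := nrm B.
have n0 : 0 <= n by exact: nrm_ge0.
pose M1 := n ^+ 3 * expR n * (m%:R * K).
pose M2 := (2 * K + K * n + K * n * n) / delta ^+ 3.
have M10 : 0 <= M1 by rewrite /M1; nneg.
have M20 : 0 <= M2 by rewrite /M2; nneg.
have Kn : 0 <= K * n by nneg.
have Knn : 0 <= K * n * n by nneg.
exists (K + K * n + K * n * n + M1 + M2); first by nneg.
move=> j y y0; have yd : - delta <= y by rewrite (le_trans _ y0)// oppr_le0 ltW.
set w := v *m expmx (y *: B).
have wK k : `|w 0 k| <= K by exact: vK.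
have w1 k : `|(w *m B) 0 k| <= K * n by exact: row_mulmx_le.
have w2 k : `|(w *m B *m B) 0 k| <= K * n * n by exact: row_mulmx_le.
split.
- by rewrite flow_cut_ge//; have := wK j; rewrite -/w; lra.
- by rewrite /flow_d1 -/w; have := w1 j; lra.
- by rewrite /flow_d2 -/w; have := w2 j; lra.
move=> e; rewrite (flow_cut_ge _ _ _ _ yd) /flow_d1 /flow_d2 -/w.
have e3 : 0 <= `|e| ^+ 3 by rewrite exprn_ge0.
have [ed|ed] := leP `|e| delta.
  have ye : - delta <= y + e.
    by move: ed; rewrite ler_norml => /andP[]; lra.
  rewrite flow_cut_ge// expmx_addt mulmxA -/w.
  apply: le_trans (expmx_taylor_row B w j (le_trans ed d1)) _.
  rewrite mulrC ler_wpM2r//; apply: (@le_trans _ _ M1); last by lra.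
  rewrite /M1 -/n; apply: ler_wpM2l; first by nneg.
  by apply: le_trans (ler_sum _ (fun k _ => wK k)) _; rewrite sumr_const card_ord mulr_natl.
(* For a large increment there is no expansion: x >= 1, so every term of the remainder is bounded by
   a multiple of x^3. *)
pose x := `|e| / delta.
have x1 : 1 <= x by rewrite ler_pdivlMr// mul1r ltW.
have ex : `|e| <= x.
  by rewrite ler_pdivlMr// ler_piMr.
have x0 : 0 <= x by exact: le_trans x1.
have x13 : 1 <= x ^+ 3 by rewrite exprn_ege1.
have xx3 : x <= x ^+ 3 by rewrite exprS ler_peMr// exprn_ege1.
have xxx3 : x ^+ 2 <= x ^+ 3 by rewrite (exprS x 2) ler_peMl ?exprn_ge0.
have gK : `|flow_cut v B delta c0 j (y + e)| <= K.
  by rewrite /flow_cut; case: ltP => // h; exact: vK.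
apply: (@le_trans _ _ (K + K + `|e| * (K * n) + `|e| ^+ 2 / 2 * (K * n * n))).
  apply: le_trans (ler_normB _ _) _; apply: lerD; last first.
    by rewrite normrM normrM normrX (@ger0_norm _ 2^-1) ?invr_ge0// ler_wpM2l// mulr_ge0 ?sqr_ge0 ?invr_ge0.
  apply: le_trans (ler_normB _ _) _; apply: lerD; last by rewrite normrM ler_wpM2l.
  by apply: le_trans (ler_normB _ _) _; apply: lerD.
have e2 : `|e| ^+ 2 <= x ^+ 3.
  by apply: le_trans xxx3; rewrite lerXn2r ?nnegrE.
have M2E : M2 * `|e| ^+ 3 = (2 * K + K * n + K * n * n) * x ^+ 3.
  by rewrite /M2 /x; field; rewrite gt_eqF.
apply: (@le_trans _ _ (M2 * `|e| ^+ 3)); last by rewrite ler_wpM2r//; lra.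
rewrite M2E.
have := ler_wpM2l K0 x13; have := ler_wpM2r Kn (le_trans ex xx3).
have := ler_wpM2r Knn e2; have := mulr_ge0 (sqr_ge0 `|e|) Knn; lra.
Qed.

End FlowCut.

(** * The limiting tail and its barriers *)

Section TailBounds.
Context {R : realType} {m : nat}.
Variables (mu sigma : 'rV[R]_m) (Q U : 'M[R]_m) (alpha : 'rV[R]_m).
Hypotheses (hQ : is_generator Q) (hirr : is_irreducible Q)
  (halpha : is_stationary Q alpha) (hsigma : forall i, 0 < sigma 0 i)
  (hdrift : \sum_i alpha 0 i * mu 0 i < 0) (hU : is_U0 mu sigma Q U).

Let L := Lmx mu sigma U.
Let S2 := diag_mx sigma *m diag_mx sigma.

Definition limit_tail (y : R) (i : 'I_m) : R := (alpha *m expmx (y *: L)) 0 i.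

(** By [Lmx_S2], L L Theta^2 / 2 - L D equals L Theta^2 U / 2, so the left equation for L is the
    right equation for U. It says that rows flowing under L solve the stationary forward
    equation. *)
Lemma Lmx_quad : 2^-1 *: (L *m L *m S2) - L *m diag_mx mu + Q = 0.
Proof.
have LS : L *m S2 = S2 *m U + 2 *: diag_mx mu := Lmx_S2 mu U hsigma.
have -> : 2^-1 *: (L *m L *m S2) - L *m diag_mx mu = 2^-1 *: (S2 *m (U *m U)) + diag_mx mu *m U.
  rewrite -[L *m L *m S2]mulmxA LS mulmxDr mulmxA LS -scalemxAr.
  rewrite scalerDr scalerA mulVf// scale1r addrK mulmxDl scalerDr -scalemxAl.
  by rewrite scalerA mulVf// scale1r -mulmxA.
exact: U0_quad hU.
Qed.

Lemma drift_flow (w : 'rV[R]_m) i :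
  drift mu sigma Q (fun j => w 0 j) (fun j => (w *m L) 0 j) (fun j => (w *m L *m L) 0 j) i = 0.
Proof.
have /(congr1 (fun M : 'M[R]_m => (w *m M) 0 i)) := Lmx_quad.
rewrite mulmx0 [RHS]mxE => <-; rewrite /drift.
rewrite mulmxDr mulmxBr -scalemxAr !mulmxA [RHS]mxE [X in _ = X + _]mxE.
rewrite [X in _ = X + _ + _]mxE [X in _ = _ + X + _]mxE [X in _ = _ - X + _]mx_diagE.
rewrite !mx_diagE [(w *m Q) 0 i]mxE; congr (_ + _); ring.
Qed.

Lemma limit_tail_decay : exists2 c, 0 < c &
  forall y i, 0 <= y -> 0 <= limit_tail y i <= expR (- (c * y)) * alpha 0 i.
Proof.
have apos := stationary_gt0 hQ hirr halpha.
have Lneg := stationary_Lmx_neg hQ hirr halpha hsigma hdrift hU.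
have mL := metzler_Lmx hQ hirr halpha hsigma hdrift hU.
have Lneg' i : 0 < - (alpha *m L) 0 i by rewrite oppr_gt0.
have [c c0 cP] := @strict_ratio _ _ (fun i => alpha 0 i) _ apos Lneg'.
exists c => // y i y0; apply/andP; split.
  rewrite /limit_tail mxE sumr_ge0// => j _.
  by rewrite mulr_ge0 ?(ltW (apos j))//; exact: metzler_expmx_ge0.
apply: expmx_subinvariant_decay => // j.
by rewrite mulNr lerNr.
Qed.

Lemma alpha_le1 i : alpha 0 i <= 1.
Proof.
have apos := stationary_gt0 hQ hirr halpha.
have [_ _ <-] := halpha; rewrite (bigD1 i)//= lerDl sumr_ge0// => j _; exact: ltW.
Qed.

Lemma limit_tail_le y i : 0 <= y -> limit_tail y i <= alpha 0 i.
Proof.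
move=> y0; have apos := stationary_gt0 hQ hirr halpha.
have [c c0 cP] := limit_tail_decay; have /andP[_ h] := cP y i y0.
apply: le_trans h _; rewrite ler_piMl ?(ltW (apos i))//.
by rewrite -expR0 ler_expR oppr_le0 mulr_ge0// ltW.
Qed.

(** The slope [alpha *m L] at 0 is negative in every state, and it dominates the second-order
    remainder on a short interval. *)
Lemma limit_tail_neg : exists2 d, 0 < d <= 1 &
  forall z i, - d <= z -> z < 0 -> alpha 0 i <= limit_tail z i.
Proof.
have apos := stationary_gt0 hQ hirr halpha.
have Lneg i : 0 < - (alpha *m L) 0 i.
  by rewrite oppr_gt0; exact: stationary_Lmx_neg hQ hirr halpha hsigma hdrift hU i.
have [k k0 kP] := @strict_ratio _ _ (fun=> 1) _ (fun=> ltr01) Lneg.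
pose c := nrm L ^+ 2 * expR (nrm L).
have c0 : 0 <= c by rewrite /c; nneg.
exists (Num.min 1 (k / (c + 1))).
  by rewrite lt_min ltr01 divr_gt0 ?ltr_wpDl// ge_min lexx.
move=> z i zd z0; have zn : 0 < - z by rewrite oppr_gt0.
have : - z <= Num.min 1 (k / (c + 1)) by rewrite lerNl.
rewrite le_min => /andP[z1 zk].
have az : `|z| <= 1 by rewrite ltr0_norm.
pose E := expmx (z *: L) - 1%:M - z *: L.
have Eb : `|(alpha *m E) 0 i| <= z ^+ 2 * c.
  rewrite mxE; apply: le_trans (ler_norm_sum _ _ _) _.
  apply: (@le_trans _ _ (\sum_j alpha 0 j * (z ^+ 2 * c))).
    apply: ler_sum => j _; rewrite normrM (ger0_norm (ltW (apos j))).
    by rewrite ler_wpM2l ?(ltW (apos j))// expmx_tail2.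
  by rewrite -mulr_suml; have [_ _ ->] := halpha; rewrite mul1r.
have EE : (alpha *m E) 0 i = limit_tail z i - alpha 0 i - z * (alpha *m L) 0 i.
  rewrite /E !mulmxBr mulmx1 -scalemxAr /limit_tail.
  by move: (alpha *m expmx _) (alpha *m L) => X Y; rewrite !mxE.
move: Eb; rewrite EE ler_norml => /andP[Eb _].
have h1 : (- z) * k <= z * (alpha *m L) 0 i.
  by have := ler_wpM2l (ltW zn) (kP i); rewrite mulr1 mulrNN.
have h2 : (- z) * ((- z) * c) <= (- z) * k.
  rewrite ler_pM2l//; apply: (@le_trans _ _ ((- z) * (c + 1))).
    by rewrite ler_pM2l// lerDl.
  by rewrite -ler_pdivlMr// ltr_wpDl.
move: Eb h1 h2; rewrite expr2; lra.
Qed.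

(* The barriers are [(1 - eps) F(y + d) - dk R] and [(1 + eps) F + dk R], where
   F is the limit, [R = e^{- theta y} a] is a strict supersolution, and
   [dk = (1 + kappa s) / (1 + kappa t)] exceeds 1 before the time [s] from which
   the chain is close to stationarity. *)
Lemma tail_bounds : exists d0 kappa D : R, [/\ 0 < d0, 0 < kappa, 0 <= D &
  forall eps d s, 0 < eps -> eps < 1 -> 0 < d -> d <= d0 -> 0 <= s ->
  exists C, forall r T p, 0 < r -> r <= 1 -> tail_system mu sigma Q r T p ->
  (forall k j, 0 <= p k j <= 1) ->
  (forall k, s <= k%:R * r ^+ 2 -> forall j,
      (1 - eps) * alpha 0 j <= p k j <= (1 + eps) * alpha 0 j) ->
  forall k i y, 0 <= y ->
    (1 - eps) * limit_tail (y + d) i - D * (1 + kappa * s) / (1 + kappa * (k%:R * r ^+ 2))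
      - k%:R * r ^+ 3 * C <= T k i y <=
    (1 + eps) * limit_tail y i + D * (1 + kappa * s) / (1 + kappa * (k%:R * r ^+ 2))
      + k%:R * r ^+ 3 * C].
Proof.
have apos := stationary_gt0 hQ hirr halpha.
have [c c0 cP] := limit_tail_decay.
have [d0 /andP[d00 d01] d0P] := limit_tail_neg.
have [th0 th00 th0P] := left_supersolution sigma hQ hirr halpha hdrift.
(* At most [c], so that R dominates F initially; at most [th0], so that a strict supersolution
   exists. *)
pose th := Num.min c th0.
have thp : 0 < th by rewrite lt_min c0.
have thc : th <= c by rewrite ge_min lexx.
have [a' [a'0 a'M]] : exists a : 'rV[R]_m, (forall i, 0 < a 0 i) /\
    (forall i, (a *m symbol mu sigma Q th) 0 i < 0).
  by apply: th0P => //; rewrite ge_min lexx orbT.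
have [k1 k10 k1P] := @strict_ratio _ _ (fun=> 1) _ (fun=> ltr01) a'0.
(* Scaled to have entries at least 1: then R >= 1 for y < 0 and exceeds any probability. *)
pose a := k1^-1 *: a'.
have a1 i : 1 <= a 0 i.
  by rewrite mxE ler_pdivlMl// k1P.
have a0 i : 0 < a 0 i by exact: lt_le_trans (a1 i).
have aM i : 0 < - (a *m symbol mu sigma Q th) 0 i.
  by rewrite oppr_gt0 /a -scalemxAl mxE pmulr_rlt0// invr_gt0.
have [kappa kap0 kapP] := @strict_ratio _ _ (fun i => a 0 i) _ a0 aM.
pose D := nrm a * expR th.
have D0 : 0 <= D by rewrite /D; nneg.
exists d0, kappa, D; split=> // eps d s e0 e1 d0' dd0 s0.
pose V := flow_cut alpha L d0 (fun j => alpha 0 j).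
pose vm := alpha *m expmx (d *: L).
pose Vm := flow_cut vm L d (fun j => alpha 0 j).
pose BR : 'M[R]_m := (- th)%:M.
pose RR := flow_cut a BR 1 (fun j => a 0 j).
have aE z j : (a *m expmx (z *: BR)) 0 j = expR (- th * z) * a 0 j.
  by rewrite /BR scale_scalar_mx expmx_scalar mul_mx_scalar mxE (mulrC z).
have vmE z j : (vm *m expmx (z *: L)) 0 j = limit_tail (z + d) j.
  by rewrite /vm -mulmxA -expmx_addt addrC.
have alpha1 j : `|alpha 0 j| <= 1 by rewrite ger0_norm ?alpha_le1// ltW.
have [MV MV0 tV] : exists2 M, 0 <= M & taylor_bound M V (flow_d1 alpha L) (flow_d2 alpha L).
  have eL : 1 <= expR (nrm L) by rewrite -expR0 ler_expR nrm_ge0.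
  apply: (flow_cut_taylor (K := expR (nrm L)) d00 d01); first exact: expR_ge0.
    move=> z j zd; have [z0|z0] := leP 0 z.
      have /andP[f0 f1] := cP z j z0.
      by rewrite -/(limit_tail z j) ger0_norm// (le_trans (limit_tail_le j z0))// (le_trans (alpha_le1 j)).
    rewrite mxE; apply: le_trans (ler_norm_sum _ _ _) _.
    apply: (@le_trans _ _ (\sum_k alpha 0 k * expR (nrm L))).
      apply: ler_sum => k _; rewrite normrM (ger0_norm (ltW (apos k))).
      rewrite ler_wpM2l ?(ltW (apos k))//; apply: le_trans (expmx_entry_le _ _ _) _.
      rewrite ler_expR nrmZ ler_piMl ?nrm_ge0// ltr0_norm// lerNl (le_trans _ zd)//.
      by rewrite lerN2.
    by rewrite -mulr_suml; have [_ _ ->] := halpha; rewrite mul1r.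
  by move=> j; exact: le_trans (alpha1 j) eL.
have [Mm Mm0 tVm] : exists2 M, 0 <= M & taylor_bound M Vm (flow_d1 vm L) (flow_d2 vm L).
  apply: (flow_cut_taylor (K := 1) d0' (le_trans dd0 d01)) => // z j zd.
  have zd0 : 0 <= z + d by lra.
  have /andP[f0 f1] := cP (z + d) j zd0.
  by rewrite vmE ger0_norm// (le_trans (limit_tail_le j zd0))// alpha_le1.
have [MR MR0 tR] : exists2 M, 0 <= M & taylor_bound M RR (flow_d1 a BR) (flow_d2 a BR).
  apply: (flow_cut_taylor (K := D) ltr01 (lexx _) D0).
    move=> z j zd; rewrite aE normrM (ger0_norm (expR_ge0 _)) mulrC /D.
    apply: ler_pM => //; first by rewrite entry_le_nrm.
    by rewrite ler_expR mulNr -mulrN ler_piMr ?(ltW thp)// lerNl.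
  move=> j; apply: le_trans (entry_le_nrm a 0 j) _; rewrite /D ler_peMr ?nrm_ge0//.
  by rewrite -expR0 ler_expR ltW.
pose dk (r : R) (k : nat) := (1 + kappa * s) / (1 + kappa * (k%:R * r ^+ 2)).
have den (r : R) (k : nat) : 0 < 1 + kappa * (k%:R * r ^+ 2).
  by rewrite ltr_pwDl//; nneg.
have ks0 : 0 <= kappa * s by rewrite mulr_ge0// ltW.
have dk0 r k : 0 <= dk r k by rewrite divr_ge0 ?(ltW (den _ _))// addr_ge0.
have dkle r k : dk r k <= 1 + kappa * s.
  rewrite ler_pdivrMr// ler_peMr ?addr_ge0// lerDl; nneg.
pose M := 2 * MV + 2 * Mm + (1 + kappa * s) * MR.
have M0 : 0 <= M by rewrite /M; nneg.
have [C C0 CP] := tail_comparison mu sigma hQ hirr halpha M0.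
exists C => r T p r0 r1 sys p01 pconv k i y y0.
have r20 : 0 <= r ^+ 2 by exact: sqr_ge0.
have RRpos j z : 0 <= RR j z.
  by rewrite /RR /flow_cut; case: ifP => _; rewrite ?aE ?mulr_ge0 ?expR_ge0 ?ltW.
have RRneg j z : z < 0 -> 1 <= RR j z.
  move=> z0; rewrite /RR /flow_cut; case: ifP => _ //; rewrite aE.
  rewrite (le_trans (a1 j))// ler_peMl ?(ltW (a0 j))// -expR0 ler_expR.
  by rewrite mulrC nmulr_rge0 ?oppr_le0// ltW.
have RRge j z : 0 <= z -> RR j z = expR (- th * z) * a 0 j.
  by move=> z0; rewrite /RR flow_cut_ge ?aE// (le_trans _ z0)// lerN10.
have RRD j z : 0 <= z -> RR j z <= D.
  move=> z0; rewrite RRge// mulrC /D; apply: ler_pM; rewrite ?(ltW (a0 j)) ?expR_ge0//.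
    by apply: le_trans (entry_le_nrm a 0 j); rewrite ler_norm.
  by rewrite ler_expR; have := mulr_ge0 (ltW thp) z0; rewrite mulNr; lra.
have driftR z j : 0 <= z -> drift mu sigma Q (RR ^~ z) (flow_d1 a BR ^~ z) (flow_d2 a BR ^~ z) j
    <= - kappa * RR j z.
  move=> z0; pose w := a *m expmx (z *: BR).
  have wE : w = expR (- th * z) *: a by apply/matrixP => i' j'; rewrite ord1 /w aE [RHS]mxE.
  have -> : drift mu sigma Q (RR ^~ z) (flow_d1 a BR ^~ z) (flow_d2 a BR ^~ z) j =
      (w *m symbol mu sigma Q th) 0 j.
    rewrite row_symbol /drift /flow_d1 /flow_d2 -/w /BR !mul_mx_scalar [(w *m Q) 0 j]mxE.
    congr (_ + _); last by apply: eq_bigr => l _; rewrite /RR flow_cut_ge// (le_trans _ z0)// lerN10.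
    by rewrite scalerA ![(_ *: w) 0 j]mxE; field.
  rewrite wE -scalemxAl mxE RRge// mulrCA ler_wpM2l ?expR_ge0//.
  by rewrite mulNr lerNr.
(* With q = kappa r^2 this is (1 - q) (1 + (k + 1) q) <= 1 + k q, valid for every q >= 0; hence the
   choice of a rational rather than exponential decay of [dk]. *)
have dkstep k' z j : 0 <= z ->
    dk r k' * (1 - kappa * r ^+ 2) * RR j z <= dk r k'.+1 * RR j z.
  move=> z0; rewrite ler_wpM2r ?RRpos//.
  rewrite /dk ler_pdivlMr// mulrAC -mulrA mulrAC ler_pdivrMr//.
  rewrite ler_wpM2l ?addr_ge0//.
  rewrite -natr1; have := mulr_ge0 (ltW kap0) r20; set q := kappa * r ^+ 2 => q0.
  have -> : kappa * ((k'%:R + 1) * r ^+ 2) = k'%:R * q + q by rewrite /q; ring.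
  have -> : kappa * (k'%:R * r ^+ 2) = k'%:R * q by rewrite /q; ring.
  have := mulr_ge0 (ler0n R k') (mulr_ge0 q0 q0); have := mulr_ge0 q0 q0; lra.
have dkearly k' : k'%:R * r ^+ 2 < s -> 1 <= dk r k'.
  by move=> ks; rewrite ler_pdivlMr// mul1r lerD2l ler_pM2l// ltW.
have driftV z j : 0 <= z -> drift mu sigma Q (V ^~ z) (flow_d1 alpha L ^~ z) (flow_d2 alpha L ^~ z) j = 0.
  move=> z0; rewrite -[RHS](drift_flow (alpha *m expmx (z *: L)) j) /drift.
  congr (_ + _); apply: eq_bigr => l _; rewrite /V flow_cut_ge//.
  by rewrite (le_trans _ z0)// oppr_le0 ltW.
have driftVm z j : 0 <= z -> drift mu sigma Q (Vm ^~ z) (flow_d1 vm L ^~ z) (flow_d2 vm L ^~ z) j = 0.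
  move=> z0; rewrite -[RHS](drift_flow (vm *m expmx (z *: L)) j) /drift.
  congr (_ + _); apply: eq_bigr => l _; rewrite /Vm flow_cut_ge//.
  by rewrite (le_trans _ z0)// oppr_le0 ltW.
have driftD (A B : R) (g g1 g2 h h1 h2 : 'I_m -> R -> R) z j :
   drift mu sigma Q (fun j => A * g j z + B * h j z) (fun j => A * g1 j z + B * h1 j z)
     (fun j => A * g2 j z + B * h2 j z) j =
   A * drift mu sigma Q (g ^~ z) (g1 ^~ z) (g2 ^~ z) j + B * drift mu sigma Q (h ^~ z) (h1 ^~ z) (h2 ^~ z) j.
  rewrite /drift; under eq_bigr do rewrite mulrDl -!mulrA.
  by rewrite big_split/= -!mulr_sumr; ring.
have kr3 : k%:R * (C * r ^+ 3) * alpha 0 i <= k%:R * r ^+ 3 * C.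
  rewrite (mulrC C) mulrA ler_piMr ?alpha_le1//; nneg.
have e1' : 0 <= 1 - eps by lra.
apply/andP; split.
- pose G k j z := (1 - eps) * Vm j z + (- dk r k) * RR j z.
  have tG k' : taylor_bound M (G k') (fun j z => (1 - eps) * flow_d1 vm L j z + (- dk r k') * flow_d1 a BR j z)
      (fun j z => (1 - eps) * flow_d2 vm L j z + (- dk r k') * flow_d2 a BR j z).
    apply: taylor_bound_le (taylor_boundD (1 - eps) (- dk r k') tVm tR).
    rewrite normrN (ger0_norm (dk0 _ _)) ger0_norm// /M.
    have := ler_wpM2r MR0 (dkle r k'); have := mulr_ge0 (ltW e0) Mm0; lra.
  have [_ lo] := CP r T p G _ _ r0 r1 sys tG.
  have {lo} lo := lo _ _ _ k i y; move: lo.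
  have -> : G k i y = (1 - eps) * limit_tail (y + d) i - dk r k * RR i y.
    rewrite /G /Vm flow_cut_ge ?vmE ?mulNr//; lra.
  move=> lo; apply: le_trans (lo _ _ _) => {lo}.
  + rewrite -(mulrA D) -/(dk r k).
    have := ler_wpM2l (dk0 r k) (RRD i y y0); lra.
  + move=> k' j z z0; rewrite /G.
    have Vmle : 0 <= Vm j z <= alpha 0 j.
      rewrite /Vm /flow_cut; case: ltP => zd; first by rewrite lexx ltW.
      have zd0 : 0 <= z + d by lra.
      by rewrite vmE limit_tail_le// andbT; have /andP[] := cP _ j zd0.
    have /andP[Vm0 Vm1] := Vmle.
    have [ks|ks] := leP s (k'%:R * r ^+ 2).
      have /andP[+ _] := pconv k' ks j; apply: le_trans.
      have := mulr_ge0 (dk0 r k') (RRpos j z); have := ler_wpM2l e1' Vm1; lra.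
    have /andP[+ _] := p01 k' j; apply: le_trans.
    have h1 : 1 <= dk r k' * RR j z.
      rewrite -[leLHS]mulr1; apply: (ler_pM ler01 ler01); [exact: dkearly|exact: RRneg].
    have := alpha_le1 j; have := mulr_ge0 (ltW e0) Vm0; lra.
  + move=> j z z0; rewrite /G /Vm flow_cut_ge; last by lra.
    have zd0 : 0 <= z + d by lra.
    rewrite vmE RRge//; have /andP[f0 f1] := cP _ j zd0.
    (* The walk starts at 0, so its tail vanishes at step 0 and the lower barrier must be
       nonpositive: [dk] R has to dominate the shifted F. *)
    have dk1 : 1 <= dk r 0 by rewrite /dk mul0r mulr0 addr0 divr1 lerDl.
    have h1 : limit_tail (z + d) j <= expR (- th * z) * a 0 j.
      apply: le_trans f1 _; apply: ler_pM; rewrite ?expR_ge0 ?(ltW (apos j))//.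
        rewrite ler_expR mulNr lerN2; apply: ler_pM; rewrite ?(ltW thp)//; lra.
      exact: le_trans (alpha_le1 j) (a1 j).
    have w0 : 0 <= expR (- th * z) * a 0 j by rewrite mulr_ge0 ?expR_ge0 ?ltW.
    have := ler_wpM2r w0 dk1; have := mulr_ge0 (ltW e0) f0; lra.
  + move=> k' j z z0; rewrite /G driftD driftVm// mulr0 add0r.
    have := ler_wpM2l (mulr_ge0 r20 (dk0 r k')) (driftR z j z0).
    have := dkstep k' z j z0; lra.
- pose G k j z := (1 + eps) * V j z + dk r k * RR j z.
  have tG k' : taylor_bound M (G k') (fun j z => (1 + eps) * flow_d1 alpha L j z + dk r k' * flow_d1 a BR j z)
      (fun j z => (1 + eps) * flow_d2 alpha L j z + dk r k' * flow_d2 a BR j z).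
    apply: taylor_bound_le (taylor_boundD (1 + eps) (dk r k') tV tR).
    rewrite (ger0_norm (dk0 _ _)) ger0_norm ?addr_ge0 ?(ltW e0)// /M.
    have := ler_wpM2r MR0 (dkle r k'); have := ler_wpM2r MV0 (ltW e1); lra.
  have [up _] := CP r T p G _ _ r0 r1 sys tG.
  have {up} up := up _ _ _ k i y; move: up.
  have -> : G k i y = (1 + eps) * limit_tail y i + dk r k * RR i y.
    rewrite /G /V flow_cut_ge//; lra.
  have Vge j z : z < 0 -> alpha 0 j <= V j z.
    by move=> z0; rewrite /V /flow_cut; case: ltP => // zd; exact: d0P.
  move=> up; apply: le_trans (up _ _ _) _ => {up}.
  + move=> k' j z z0; rewrite /G.
    have V0 := le_trans (ltW (apos j)) (Vge j z z0).
    have [ks|ks] := leP s (k'%:R * r ^+ 2).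
      have /andP[_ +] := pconv k' ks j; move=> /le_trans; apply.
      have := mulr_ge0 (dk0 r k') (RRpos j z).
      have e2 : 0 <= 1 + eps by lra.
      have := ler_wpM2l e2 (Vge j z z0); lra.
    have /andP[_ +] := p01 k' j; move=> /le_trans; apply.
    have h1 : 1 <= dk r k' * RR j z.
      rewrite -[leLHS]mulr1; apply: (ler_pM ler01 ler01); [exact: dkearly|exact: RRneg].
    have := mulr_ge0 (ltW e0) V0; lra.
  + move=> j z z0; rewrite /G /V flow_cut_ge; last by lra.
    have /andP[f0 _] := cP _ j z0.
    have := mulr_ge0 (dk0 r 0) (RRpos j z).
    rewrite -/(limit_tail z j); have := mulr_ge0 (ltW e0) f0; lra.
  + move=> k' j z z0; rewrite /G driftD driftV// mulr0 add0r.
    have := ler_wpM2l (mulr_ge0 r20 (dk0 r k')) (driftR z j z0).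
    have := dkstep k' z j z0; lra.
  + rewrite -(mulrA D) -/(dk r k).
    have := ler_wpM2l (dk0 r k) (RRD i y y0); lra.
Qed.

End TailBounds.

(** * Markov property of the reflected walk *)

Section SubLaw.
Context {R : realType} d (Omega : measurableType d) (P : probability Omega R)
  d' (T : measurableType d').
Variables (Y : Omega -> T) (D : set Omega).
Hypotheses (mY : measurable_fun setT Y) (mD : measurable D).

(** The law of [Y] restricted to the event [D]. Leaving it unnormalized avoids dividing by a
    probability that may be 0. The measurability proofs are arguments so that the measure structure
    can be inferred from the term. *)
Definition sublaw of measurable_fun setT Y & measurable D : set T -> \bar R :=
  fun A => P (Y @^-1` A `&` D).

Local Notation law := (sublaw mY mD).

Let mpre A : measurable A -> measurable (Y @^-1` A `&` D).
Proof.
by move=> mA; apply: measurableI => //; rewrite -[X in measurable X]setTI; exact: mY.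
Qed.

Let law0 : law set0 = 0%E.
Proof. by rewrite /sublaw preimage_set0 set0I measure0. Qed.

Let law_ge0 A : (0 <= law A)%E. Proof. exact: measure_ge0. Qed.

Let law_sigma_additive : semi_sigma_additive law.
Proof.
move=> F mF tF mUF; rewrite /sublaw preimage_bigcup setI_bigcupl.
apply: measure_semi_sigma_additive.
- by move=> n; exact: mpre.
- move=> i j _ _ [w [[Fi _] [Fj _]]]; apply: (tF i j) => //; by exists (Y w).
- by apply: bigcup_measurable => n _; exact: mpre.
Qed.

HB.instance Definition _ := isMeasure.Build _ _ _ law law0 law_ge0 law_sigma_additive.

Let law_fin : fin_num_fun law.
Proof. by move=> A mA; apply: fin_num_measure; exact: mpre. Qed.

HB.instance Definition _ := @Measure_isFinite.Build _ _ _ law law_fin.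

End SubLaw.

Section MeasurableAbove.
Context {R : realType} d (Omega : measurableType d).

Lemma measurable_above (V : Omega -> R) z : measurable_fun setT V -> measurable [set w | z < V w].
Proof.
move=> mV; rewrite (_ : [set w | _] = V @^-1` `]z, +oo[%classic).
  by rewrite -[X in measurable X]setTI; exact: mV.
by apply/seteqP; split=> w; rewrite /= in_itv/= andbT.
Qed.

End MeasurableAbove.

Section Partition.
Context {R : realType} d (Omega : measurableType d) (P : probability Omega R) (m : nat).

Lemma probability_partition (X : Omega -> 'I_m) (S : set Omega) :
  (forall l, measurable [set w | X w = l]) -> measurable S ->
  P S = (\sum_l P (S `&` [set w | X w = l]))%E.
Proof.
move=> mX mS; pose F l := S `&` [set w | X w = l].
have SE : \big[setU/set0]_(l < m) F l = S.
  rewrite -bigcup_seq; apply/seteqP; split=> [w [l _ []]//|w Sw].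
  by exists (X w) => //=; rewrite mem_index_enum.
rewrite -{1}SE measure_semi_additive_ord//; last by rewrite SE.
- by move=> l; exact: measurableI.
- move=> i j _ _ [w [[_ /= <-] [_ /= <-]]] //.
Qed.

End Partition.

(* The noise takes values in [T] and is read through [e]: the normal law is a
   measure on [measurableTypeR R], whose display is not that of [R]. *)
Section Recursion.
Context {R : realType} d (Omega : measurableType d) (P : probability Omega R) (m : nat)
  d' (T : measurableType d').
Variables (mu sigma : 'rV[R]_m) (Pm : 'M[R]_m) (g : probability T R) (h : R) (e : T -> R)
  (X : nat -> Omega -> 'I_m) (N : nat -> Omega -> T).
Hypotheses (Pm0 : forall i j, 0 <= Pm i j)
  (mX : forall k l, measurable [set w | X k w = l])
  (me : measurable_fun setT e) (mN : forall k, measurable_fun setT (N k)).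
Hypothesis joint : forall n (i : nat -> 'I_m) (B : nat -> set T),
  (forall k, measurable (B k)) ->
  P [set w | (forall k, (k <= n)%N -> X k w = i k) /\ (forall k, (k < n)%N -> B k (N k w))] =
  (P [set w | X 0%N w = i 0%N] * \prod_(0 <= k < n) ((Pm (i k) (i k.+1))%:E * g (B k)))%E.

(** Lindley's recursion, with drift and volatility frozen at the state at the left end of the
    step. *)
Fixpoint reflected (k : nat) (w : Omega) : R :=
  if k is k'.+1 then
    Num.max (reflected k' w + mu 0 (X k' w) * h + sigma 0 (X k' w) * e (N k' w)) 0
  else 0.

Lemma measurable_state_fun (c : 'rV[R]_m) k : measurable_fun setT (fun w => c 0 (X k w)).
Proof.
have -> : (fun w => c 0 (X k w)) = (fun w => \sum_l c 0 l * \1_[set w | X k w = l] w).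
  apply/funext => w; rewrite (bigD1 (X k w))//= indicE mem_set// mulr1 big1 ?addr0// => l lX.
  by rewrite indicE memNset ?mulr0//= => E; move: lX; rewrite E eqxx.
by apply: measurable_sum => l; apply: measurable_funM => //; exact: measurable_indic.
Qed.

Lemma measurable_reflected k : measurable_fun setT (reflected k).
Proof.
elim: k => [|k IH] //=; apply: measurable_maxr => //.
apply: measurable_funD; first apply: measurable_funD => //.
  by apply: measurable_funM => //; exact: measurable_state_fun.
apply: measurable_funM => //; first exact: measurable_state_fun.
exact: measurableT_comp.
Qed.

Lemma reflected_ge0 k w : 0 <= reflected k w.
Proof. by case: k => //= k; rewrite le_max lexx orbT. Qed.

Let psi l (p : T * R) : R := Num.max (p.2 + mu 0 l * h + sigma 0 l * e p.1) 0.

Let mpsi l : measurable_fun setT (psi l).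
Proof.
apply: measurable_maxr => //; apply: measurable_funD.
  by apply: measurable_funD => //; exact: measurable_snd.
by apply: measurable_funM => //; exact: measurableT_comp.
Qed.

Let pair k w : T * R := (N k w, reflected k w).

Let mpair k : measurable_fun setT (pair k).
Proof. by apply: measurable_fun_pair => //; exact: measurable_reflected. Qed.

(** Stands for the probability that X_k = l and Y_{k+1} lies in A, computed with the k-th noise
    independent of the pair (Y_k, X_k). *)
Let kernel k l (A : set R) : \bar R :=
  (g \x sublaw P (measurable_reflected k) (mX k l))%E (psi l @^-1` A).

Let future k n (i : nat -> 'I_m) (B : nat -> set T) : set Omega :=
  [set w | (forall j, (k <= j <= n)%N -> X j w = i j) /\
           (forall j, (k <= j < n)%N -> B j (N j w))].

Let mfuture k n i B : (forall j, measurable (B j)) -> measurable (future k n i B).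
Proof.
move=> mB; rewrite /future.
have -> : [set w | (forall j, (k <= j <= n)%N -> X j w = i j) /\
           (forall j, (k <= j < n)%N -> B j (N j w))] =
  (\bigcap_(j in [set j | (k <= j <= n)%N]) [set w | X j w = i j]) `&`
  (\bigcap_(j in [set j | (k <= j < n)%N]) (N j @^-1` (B j))).
  by apply/seteqP; split=> w [].
apply: measurableI; apply: bigcap_measurableType => j _ //.
by rewrite -[X in measurable X]setTI; exact: mN.
Qed.

Let weight k n (i : nat -> 'I_m) (B : nat -> set T) : \bar R :=
  (\prod_(k <= j < n) ((Pm (i j) (i j.+1))%:E * g (B j)))%E.

Let weight_fin k n i B : (forall j, measurable (B j)) -> weight k n i B \is a fin_num.
Proof.
move=> mB; rewrite /weight; apply: (big_ind (fun x => x \is a fin_num)) => //.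
  by move=> x y xf yf; exact: fin_numM.
by move=> j _; apply: fin_numM => //; apply: fin_num_measure.
Qed.

Let weight_ge0 k n i B : (0 <= weight k n i B)%E.
Proof. by apply: prode_ge0 => j _; rewrite mule_ge0// lee_fin. Qed.

(** The future consists of later states and of the noises from k on. Including the noises is what
    lets the induction on k split off the noise of the current step. *)
Let markov_at k := forall n i (A : set R) (B : nat -> set T), (k <= n)%N ->
  measurable A -> (forall j, measurable (B j)) ->
  P ((reflected k @^-1` A) `&` future k n i B) =
  (P ((reflected k @^-1` A) `&` [set w | X k w = i k]) * weight k n i B)%E.

Let markov_step k : markov_at k -> forall n i (A : set R) (B : nat -> set T), (k < n)%N ->
  measurable A -> (forall j, measurable (B j)) ->
  P ((reflected k.+1 @^-1` A) `&` future k.+1 n i B) =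
  ((\sum_l (Pm l (i k.+1))%:E * kernel k l A) * weight k.+1 n i B)%E.
Proof.
move=> mk n i A B kn mA mB.
have mS : measurable ((reflected k.+1 @^-1` A) `&` future k.+1 n i B).
  apply: measurableI; last exact: mfuture.
  by rewrite -[X in measurable X]setTI; exact: measurable_reflected.
rewrite (probability_partition P (mX k) mS).
have wf := weight_fin k.+1 n i mB.
have w0 := weight_ge0 k.+1 n i B.
rewrite muleC ge0_sume_distrr; last by move=> l _; rewrite mule_ge0 ?lee_fin.
apply: eq_bigr => l _.
pose D := future k.+1 n i B `&` [set w | X k w = l].
have mD : measurable D by apply: measurableI => //; exact: mfuture.
have -> : P (reflected k.+1 @^-1` A `&` future k.+1 n i B `&` [set w | X k w = l]) =
    sublaw P (mpair k) mD (psi l @^-1` A).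
  congr (P _); apply/seteqP; split=> w /=.
    by move=> [[Aw Fw] Xw]; split=> //; rewrite /psi/= -Xw.
  by move=> [Aw [Fw Xw]]; split=> //; split=> //; rewrite Xw.
pose c := Pm l (i k.+1) * fine (weight k.+1 n i B).
have c0 : 0 <= c by rewrite mulr_ge0// fine_ge0.
pose mu1 := mscale (NngNum c0) (sublaw P (measurable_reflected k) (mX k l)).
have mpA : measurable (psi l @^-1` A).
  by rewrite -[X in measurable X]setTI; exact: mpsi.
(* It suffices to compare on rectangles the joint law of noise and position, restricted to [D], with
   the product of [g] and a multiple of the law of the position. *)
rewrite -(@product_measure_unique _ _ _ _ _ g mu1 (sublaw P (mpair k) mD))//; last first.
  move=> A2 A1 mA2 mA1.
  (* Prescribing the state l and the noise set A2 at index k turns the rectangle into an event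
     covered by the induction hypothesis. *)
  pose i' j := if j == k then l else i j.
  pose B' j := if j == k then A2 else B j.
  have mB' j : measurable (B' j) by rewrite /B'; case: eqP.
  have := mk n i' A1 B' (ltnW kn) mA1 mB'.
  rewrite /weight big_ltn// /i' /B' eqxx (gtn_eqF (ltnSn k)).
  rewrite (_ : \prod_(k.+1 <= j < n) _ = weight k.+1 n i B)%E; last first.
    apply: eq_big_nat => j /andP[kj _].
    by rewrite !gtn_eqF// (ltn_trans kj).
  move=> E; rewrite /mu1 /mscale/= /sublaw.
  transitivity (P (reflected k @^-1` A1 `&` future k n i' B')).
    congr (P _); apply/seteqP; split=> w /=.
      move=> [[wN wY] [[Xf Nf] Xk]]; split=> //; split=> j; rewrite /i' /B'; case: eqVneq => [->//|jk] /andP[kj jn].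
        by apply: Xf; rewrite jn andbT ltn_neqAle eq_sym jk.
      by apply: Nf; rewrite jn andbT ltn_neqAle eq_sym jk.
    move=> [wY [Xf Nf]]; split; [split=> //|].
      by have := Nf k; rewrite /B' eqxx leqnn kn; exact.
    split; last by have := Xf k; rewrite /i' eqxx leqnn (ltnW kn); exact.
    split=> j /andP[kj jn].
      by have := Xf j; rewrite /i' (gtn_eqF kj) (ltnW kj) jn; exact.
    by have := Nf j; rewrite /B' (gtn_eqF kj) (ltnW kj) jn; exact.
  rewrite E /= /mscale/= /c EFinM fineK//.
  set p := P _; set q := g A2; set W := weight _ _ _ _.
  by rewrite (muleC _%:E q) muleC -!muleA.
rewrite /product_measure1 /kernel /product_measure1.
under eq_integral do rewrite /mu1 /= /mscale/=.
rewrite ge0_integralZl//; last exact: measurable_fun_xsection.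
by rewrite /c EFinM fineK// muleCA muleA.
Qed.

Let kernel_step k : markov_at k -> forall l (A : set R), measurable A ->
  P ((reflected k.+1 @^-1` A) `&` [set w | X k.+1 w = l]) =
  (\sum_j (Pm j l)%:E * kernel k j A)%E.
Proof.
move=> mk l A mA.
have := markov_step mk (n := k.+1) (fun=> l) (B := fun=> setT) (ltnSn k) mA (fun=> measurableT).
rewrite /weight big_geq// mule1 => <-; congr (P (_ `&` _)).
apply/seteqP; split=> w /= => [Xw|[Xf _]]; last by apply: Xf; rewrite ltnSn.
split=> // j.
by rewrite -eqn_leq => /eqP <-.
Qed.

Lemma markov_property k : markov_at k.
Proof.
elim: k => [|k IH] n i A B kn mA mB; last first.
  by rewrite (markov_step IH)// (kernel_step IH).
have [A0|A0] := pselect (A 0); last first.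
  have -> : reflected 0 @^-1` A = set0 by apply/seteqP; split.
  by rewrite !set0I measure0 mul0e.
have -> : reflected 0 @^-1` A = setT by apply/seteqP; split.
rewrite !setTI -joint//; congr (P _); apply/seteqP; split=> w /= [Xf Nf]; split=> j jn.
Qed.

Definition tail (k : nat) (i : 'I_m) (y : R) : R :=
  fine (P [set w | y < reflected k w /\ X k w = i]).

Let mtail k i (y : R) : measurable [set w | y < reflected k w /\ X k w = i].
Proof.
apply: measurableI; last exact: mX.
by apply: measurable_above; exact: measurable_reflected.
Qed.

Lemma tailE k i (y : R) : (tail k i y)%:E = sublaw P (measurable_reflected k) (mX k i) `]y, +oo[%classic.
Proof.
rewrite /tail fineK; last by apply: fin_num_measure; exact: mtail.
congr (P _); apply/seteqP; split=> w /=.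
  by rewrite in_itv/= andbT.
by rewrite in_itv/= andbT.
Qed.

Lemma tail_01 k i (y : R) : 0 <= tail k i y <= 1.
Proof.
rewrite /tail fine_ge0//= -lee_fin fineK; last by apply: fin_num_measure; exact: mtail.
by apply: probability_le1; exact: mtail.
Qed.

Lemma measurable_tail k i : measurable_fun setT (tail k i).
Proof.
pose C : set (R * R) := [set p | p.1 < p.2].
have mC : measurable C.
  have -> : C = (fun p : R * R => p.2 - p.1) @^-1` `]0, +oo[%classic.
    by apply/seteqP; split=> p; rewrite /C/= in_itv/= andbT subr_gt0.
  rewrite -[X in measurable X]setTI; apply: measurable_funB => //.
have -> : tail k i = fine \o (sublaw P (measurable_reflected k) (mX k i) \o xsection C).
  apply/funext => y /=; rewrite -[LHS]/(fine (tail k i y)%:E) tailE; congr (fine (_ _)).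
  by apply/seteqP; split=> z; rewrite /xsection/= inE /C/= in_itv/= andbT.
by apply: measurableT_comp => //; exact: measurable_fun_xsection.
Qed.

(** For y >= 0, max(z, 0) > y means z > y, so the recursion is a Gaussian average of the previous
    tails, each at the argument from which the step reaches y. *)
Lemma tail_step k i (y : R) : 0 <= y -> tail k.+1 i y =
  \sum_j Pm j i * fine (\int[g]_w (tail k j (y - mu 0 j * h - sigma 0 j * e w))%:E).
Proof.
move=> y0.
have /= := kernel_step (@markov_property k) i (A := `]y, +oo[%classic) (measurable_itv _).
have -> : reflected k.+1 @^-1` `]y, +oo[%classic `&` [set w | X k.+1 w = i] =
    [set w | y < reflected k.+1 w /\ X k.+1 w = i].
  by apply/seteqP; split=> w /=; rewrite in_itv/= andbT.
have kE j : kernel k j `]y, +oo[%classic = (\int[g]_w (tail k j (y - mu 0 j * h - sigma 0 j * e w))%:E)%E.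
  rewrite /kernel /product_measure1; apply: eq_integral => w _.
  rewrite tailE /=; congr (sublaw _ _ _ _); apply/seteqP; split=> z.
    rewrite /xsection/= inE /psi/= !in_itv/= !andbT lt_max (ltNge y 0) y0 orbF => H; lra.
  rewrite /xsection/= inE /psi/= !in_itv/= !andbT lt_max (ltNge y 0) y0 orbF => H; lra.
have kfin j : kernel k j `]y, +oo[%classic \is a fin_num.
  rewrite kE; apply: integrable_fin_num => //.
  apply: (@le_integrable _ _ _ _ _ measurableT _ (cst 1%:E)).
  - apply/measurable_EFinP; apply: measurableT_comp; first exact: measurable_tail.
    by apply: measurable_funB => //; apply: measurable_funM.
  - move=> x _ /=; have /andP[t0 t1] := tail_01 k j (y - mu 0 j * h - sigma 0 j * e x).
    by rewrite normr1 lee_fin ger0_norm.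
  - exact: finite_measure_integrable_cst.
rewrite (eq_bigr (fun j => (Pm j i * fine (kernel k j `]y, +oo[%classic))%:E)).
  by rewrite sumEFin /tail => ->; apply: eq_bigr => j _; rewrite kE.
by move=> j _; rewrite EFinM fineK.
Qed.

End Recursion.

Section GridLaw.
Context {R : realType} d (Omega : measurableType d) (P : probability Omega R) (m : nat).
Variables (Q : 'M[R]_m) (phi : R -> Omega -> 'I_m) (W : R -> {RV P >-> R}).

Lemma events_of_chain_grid (t : nat -> R) n (i : nat -> 'I_m) :
  (forall k, 0 <= t k) ->
  events_of_chain phi [set w | forall k, (k <= n)%N -> phi (t k) w = i k].
Proof.
move=> t0; rewrite /events_of_chain; set G := [set A | _].
rewrite (_ : [set w | _] = \bigcap_(k in [set k | (k <= n)%N]) [set w | phi (t k) w = i k])//.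
apply: (@bigcap_measurableType _ (g_sigma_algebraType G)) => k _.
by apply: sub_gen_smallest; exists (t k), (i k).
Qed.

Lemma events_of_real_increments (t : nat -> R) n (B : nat -> set R) :
  (forall k, 0 <= t k) -> (forall k, measurable (B k)) ->
  events_of_real W [set w | forall k, (k < n)%N -> B k (increment W (t k) (t k.+1) w)].
Proof.
move=> t0 mB; rewrite /events_of_real; set G := [set A | _].
rewrite (_ : [set w | _] =
  \bigcap_(k in [set k | (k < n)%N]) (increment W (t k) (t k.+1) @^-1` B k))//.
have mW s : 0 <= s -> measurable_fun setT (W s : g_sigma_algebraType G -> R).
  move=> s0 _ C mC; rewrite setTI; apply: sub_gen_smallest; exists s, C; split=> //.
apply: (@bigcap_measurableType _ (g_sigma_algebraType G)) => k _.
have mI : measurable_fun setT (increment W (t k) (t k.+1) : g_sigma_algebraType G -> R).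
  by apply: measurable_funB; exact: mW.
by have := mI measurableT _ (mB k); rewrite setTI.
Qed.

Hypotheses (hphi : is_ctmc P Q phi) (hW : is_brownian W)
  (hind : independent_processes phi W).

(** The hypothesis [joint] of the recursion: finite-dimensional laws of the chain, independent
    Gaussian increments, and independence of the two processes. *)
Lemma grid_law (h : R) (h0 : 0 < h) n (i : nat -> 'I_m) (B : nat -> set R) :
  (forall k, measurable (B k)) ->
  P [set w | (forall k, (k <= n)%N -> phi (k%:R * h) w = i k) /\
             (forall k, (k < n)%N -> B k (increment W (k%:R * h) (k.+1%:R * h) w))] =
  (P [set w | phi (0%:R * h) w = i 0%N] *
   \prod_(0 <= k < n) ((expmx (h *: Q) (i k) (i k.+1))%:E *
                       normal_prob 0 (Num.sqrt h) (B k)))%E.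
Proof.
move=> mB.
pose t k : R := k%:R * h.
have t0 k : 0 <= t k by rewrite mulr_ge0// ltW.
have tS k : t k <= t k.+1 by rewrite /t ler_wpM2r ?ler_nat// ltW.
have dt k : t k.+1 - t k = h by rewrite /t -mulrBl -natrB// subSnn mul1r.
have [_ chain _] := hphi; have [_ law indep _] := hW.
rewrite (hind (events_of_chain_grid _ _ t0) (events_of_real_increments _ t0 mB)).
rewrite (chain n t i (t0 0%N) tS) (indep n t B (t0 0%N) tS mB) -muleA; congr (_ * _)%E.
rewrite [in RHS]big_mkord -prodEFin -big_split/=; apply: eq_bigr => k _.
have tlt : t k < t k.+1 by rewrite -subr_gt0 dt.
by rewrite (law _ _ _ (t0 k) tlt (mB k)) !dt.
Qed.

Lemma grid_tail_system (r : R) : is_generator Q -> 0 < r -> forall mu sigma : 'rV[R]_m,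
  tail_system mu sigma Q r
    (@tail _ _ _ P _ _ (measurableTypeR R) mu sigma (r ^+ 2) idfun (fun k => phi (k%:R * r ^+ 2))
      (fun k => increment W (k%:R * r ^+ 2) (k.+1%:R * r ^+ 2)))
    (fun k i => fine (P [set w | phi (k%:R * r ^+ 2) w = i])).
Proof.
move=> hQ r0 mu sigma.
have h0 : 0 < r ^+ 2 by rewrite exprn_gt0.
have [mphi _ _] := hphi.
have mX k l : measurable [set w | phi (k%:R * r ^+ 2) w = l].
  by apply: mphi; rewrite mulr_ge0// ltW.
have me : measurable_fun setT (idfun : measurableTypeR R -> R).
  by move=> _ B mB; rewrite setTI.
have mN k : measurable_fun setT
    (increment W (k%:R * r ^+ 2) (k.+1%:R * r ^+ 2) : Omega -> measurableTypeR R).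
  exact: measurable_funB.
have Pm0 i j : 0 <= expmx (r ^+ 2 *: Q) i j.
  by apply: metzler_expmx_ge0 (generator_metzler hQ) (ltW h0).
have joint := grid_law h0.
rewrite sqrtr_sqr gtr0_norm// in joint.
split.
- by move=> k j; exact: measurable_tail.
- by move=> k j y; exact: tail_01.
- move=> k j y y0; congr (fine (P _)); apply/seteqP; split=> [w []//|w /= Xw]; split=> //.
  exact: lt_le_trans (reflected_ge0 _ _ _ _ _ _ _ _).
- move=> j y y0; rewrite /tail (_ : [set w | _] = set0) ?measure0//.
  by apply/seteqP; split=> // w /= [/lt_geF]; rewrite y0.
- move=> k i y y0; rewrite (@tail_step _ _ _ P _ _ (measurableTypeR R) mu sigma _ (normal_prob 0 r) _ _ _ _ Pm0 mX me mN joint); last exact: y0.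
  by apply: eq_bigr => j _; rewrite /gexp.
Qed.

End GridLaw.

(** * Convergence of the chain to stationarity *)

Section Ergodic.
Context {R : realType} d (Omega : measurableType d) (P : probability Omega R) (m : nat).
Variables (Q : 'M[R]_m) (alpha : 'rV[R]_m) (phi : R -> Omega -> 'I_m).
Hypotheses (hQ : is_generator Q) (hirr : is_irreducible Q)
  (halpha : is_stationary Q alpha) (hphi : is_ctmc P Q phi).

Definition state_law (t : R) (j : 'I_m) : R := fine (P [set w | phi t w = j]).

Let mphi t i : 0 <= t -> measurable [set w | phi t w = i].
Proof. by case: hphi => h _ _; exact: h. Qed.

Lemma state_lawE t j : 0 <= t -> (state_law t j)%:E = P [set w | phi t w = j].
Proof. by move=> t0; rewrite /state_law fineK// fin_num_measure//; exact: mphi. Qed.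

Lemma state_law_01 t j : 0 <= t -> 0 <= state_law t j <= 1.
Proof.
by move=> t0; rewrite -!lee_fin state_lawE// measure_ge0/=; apply: probability_le1; exact: mphi.
Qed.

Lemma state_law_sum t : 0 <= t -> \sum_j state_law t j = 1.
Proof.
move=> t0; apply: EFin_inj; rewrite -sumEFin -(probability_setT P).
rewrite (@probability_partition _ _ _ P _ (phi t))//; last by move=> l; exact: mphi.
by apply: eq_bigr => j _; rewrite state_lawE// setTI.
Qed.

Lemma state_law_flow t s j : 0 <= t -> 0 <= s ->
  state_law (t + s) j = \sum_i state_law t i * expmx (s *: Q) i j.
Proof.
move=> t0 s0; have ts0 : 0 <= t + s by rewrite addr_ge0.
apply: EFin_inj; rewrite state_lawE// -sumEFin.
rewrite (@probability_partition _ _ _ P _ (phi t)); last 2 first.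
- by move=> l; exact: mphi.
- exact: mphi.
apply: eq_bigr => i _; rewrite EFinM state_lawE//.
have [_ chain _] := hphi.
pose tt k := if k is 0%N then t else t + s.
pose ii k := if k is 0%N then i else j.
have := chain 1%N tt ii t0 _.
rewrite big_ord1 /= addrAC subrr add0r => <-.
  congr (P _); apply/seteqP; split=> w /= => [[h1 h2] [|[|]]//|h].
  by split; [exact: (h 1%N)|exact: (h 0%N)].
by case=> [|k] //=; rewrite lerDl.
Qed.

Let minorization : exists2 e : R, 0 < e & forall i j, e * alpha 0 j <= expmx ((1 : R) *: Q) i j.
Proof.
have a0 := stationary_gt0 hQ hirr halpha.
have Ppos i j : 0 < expmx ((1 : R) *: Q) i j.
  exact: metzler_expmx_gt0 (generator_metzler hQ) hirr ltr01.
have /choice[k kP] : forall i, exists k : R, 0 < k /\ forall j, k * alpha 0 j <= expmx ((1 : R) *: Q) i j.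
  by move=> i; have [k k0 kP] := strict_ratio a0 (Ppos i); exists k.
have [e e0 eP] := @strict_ratio _ _ (fun=> 1) k (fun=> ltr01) (fun i => (kP i).1).
exists e => // i j; apply: le_trans (_ : k i * alpha 0 j <= _); last exact: (kP i).2.
by rewrite ler_wpM2r ?(ltW (a0 j))//; have := eP i; rewrite mulr1.
Qed.

(* Doeblin: each unit of time moves a fixed fraction of the remaining mass to [alpha]. *)
Lemma state_law_cvg (eps : R) : 0 < eps -> exists2 s, 0 <= s & forall t, s <= t -> forall j,
  (1 - eps) * alpha 0 j <= state_law t j <= (1 + eps) * alpha 0 j.
Proof.
move=> eps0; have [e e0 eP] := minorization; have [_ aQ a1] := halpha.
have a0 := stationary_gt0 hQ hirr halpha.
have [k k0 kP] := @strict_ratio _ _ (fun=> 1) (alpha 0) (fun=> ltr01) a0.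
have [m0|/card_gt0P[i0 _]] := posnP #|'I_m|.
  by exists 0 => // t _ j; have := card0_eq m0 j.
have e1 : e <= 1.
  rewrite -(expmx_generator_rowsum hQ 1 i0) -[e in leLHS]mulr1 -[in leLHS]a1 mulr_sumr.
  by apply: ler_sum => j _; exact: eP.
have low n t j : 0 <= t -> (1 - (1 - e) ^+ n) * alpha 0 j <= state_law (t + n%:R) j.
  move=> t0; elim: n j => [|n IH] j.
    by rewrite expr0 subrr mul0r addr0; case/andP: (state_law_01 j t0).
  have tn0 : 0 <= t + n%:R by rewrite addr_ge0.
  rewrite -natr1 addrA state_law_flow//.
  set a := 1 - (1 - e) ^+ n.
  (* The mass not yet known to follow alpha; it totals 1 - a, and one unit of time sends at least
     the fraction e of it to alpha. *)
  pose u i := state_law (t + n%:R) i - a * alpha 0 i.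
  have u0 i : 0 <= u i by rewrite subr_ge0 IH.
  have -> : \sum_i state_law (t + n%:R) i * expmx ((1 : R) *: Q) i j =
      a * alpha 0 j + \sum_i u i * expmx ((1 : R) *: Q) i j.
    have /rowP/(_ j) := expmx_left_null 1 aQ; rewrite mxE => aE.
    rewrite -aE mulr_sumr -big_split/=; apply: eq_bigr => i _.
    by rewrite /u; ring.
  have us : \sum_i u i = 1 - a by rewrite sumrB state_law_sum// -mulr_sumr a1 mulr1.
  apply: le_trans (_ : a * alpha 0 j + \sum_i u i * (e * alpha 0 j) <= _).
    rewrite -mulr_suml us exprS /a le_eqVlt; apply/orP; left; apply/eqP; ring.
  by rewrite lerD2l; apply: ler_sum => i _; rewrite ler_wpM2l.
(* All alpha_j are at least k, so dl <= eps alpha_j. The upper bound at j comes from the lower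
   bounds at the other states, with an additive error of at most dl. *)
pose dl := eps * Num.min k 1.
have dl0 : 0 < dl by rewrite mulr_gt0// lt_min k0 ltr01.
have [n nP] : exists n, (1 - e) ^+ n < dl.
  have : (fun n => (1 - e) ^+ n) @ \oo --> (0 : R).
    by apply: cvg_expr; rewrite ger0_norm ?subr_ge0// gtrBl.
  move=> /cvgrPdist_lt/(_ _ dl0)[n _ nP]; exists n.
  by have := nP n (leqnn n); rewrite sub0r normrN; apply: le_lt_trans (ler_norm _).
exists n%:R => // t nt j; have tn0 : 0 <= t - n%:R by rewrite subr_ge0.
have t0 : 0 <= t by exact: le_trans nt.
have lowj i : (1 - dl) * alpha 0 i <= state_law t i.
  have := low n _ i tn0; rewrite subrK; apply: le_trans.
  by rewrite ler_wpM2r ?(ltW (a0 i))// lerB// ltW.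
apply/andP; split.
  apply: le_trans (lowj j); rewrite ler_wpM2r ?(ltW (a0 j))// lerB//.
  by rewrite ler_piMr ?(ltW eps0)// ge_min lexx orbT.
have := state_law_sum t0; rewrite (bigD1 j)//= => /(canRL (addrK _)) ->.
apply: le_trans (_ : 1 - (1 - dl) * (1 - alpha 0 j) <= _).
  have -> : 1 - alpha 0 j = \sum_(i | i != j) alpha 0 i.
    by rewrite -[in LHS]a1 (bigD1 j)//= [alpha 0 j + _]addrC addrK.
  rewrite lerB// mulr_sumr.
  by apply: ler_sum => i _; exact: lowj.
have kj : dl <= eps * alpha 0 j.
  rewrite ler_wpM2l ?(ltW eps0)//; have := kP j; rewrite mulr1.
  by apply: le_trans; rewrite ge_min lexx.
have := ltW (a0 j); nra.
Qed.

End Ergodic.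

(** * Pathwise limits *)

Section IntervalInduction.
Context {R : realType}.

(** Continuous induction: the supremum of the points where [Pr] is reached can be crossed by the
    local step, so it is B itself. *)
Lemma interval_induction (Pr : R -> Prop) (B : R) : 0 <= B -> Pr 0 ->
  (forall s, 0 <= s <= B -> exists2 r, 0 < r & forall a b, 0 <= a -> a <= b ->
     s - r < a -> a <= s -> b < s + r -> b <= B -> Pr a -> Pr b) -> Pr B.
Proof.
move=> B0 P0 step; pose E := [set b | 0 <= b <= B /\ Pr b].
have E0 : E 0 by split=> //; rewrite lexx B0.
have supE : has_sup E by split; [exists 0|exists B => b [/andP[]]].
have s0 : 0 <= sup E by apply: ub_le_sup => //; exact: supE.2.
have sB : sup E <= B by apply: ge_sup => [|b [/andP[]]//]; exists 0.
have [|r r0 rP] := step (sup E); first by rewrite s0.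
have [a [/andP[a0 aB] Pa] sa] := sup_adherent r0 supE.
have as_ : a <= sup E by apply: ub_le_sup => //; [exact: supE.2|split=> //; rewrite a0].
pose b := Num.min (sup E + r / 2) B.
have ab : a <= b by rewrite le_min aB andbT (le_trans as_)// lerDl divr_ge0// ltW.
have bs : b < sup E + r by rewrite gt_min ltrD2l ltr_pdivrMr// ltr_pMr// ltr1n.
have bB : b <= B by rewrite ge_min lexx orbT.
have Pb : Pr b by apply: (rP a).
have : b <= sup E.
  by apply: ub_le_sup; [exact: supE.2|split=> //; rewrite bB (le_trans a0)].
rewrite ge_min => /orP[h|Bs]; first by exfalso; move: h; rewrite gerDl leNgt divr_gt0.
by have <- : b = B by apply/min_idPr; rewrite (le_trans Bs)// lerDl divr_ge0// ltW.
Qed.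

(** Induction along a path of the chain that replaces an enumeration of its jumps. The path is
    constant only on the open interval, so both endpoints may be jump times. *)
Lemma step_path_ind (m : nat) (f : R -> 'I_m) (Pr : R -> Prop) : cadlag_step f -> Pr 0 ->
  (forall a b i, 0 <= a -> a < b -> (forall s, a < s < b -> f s = i) -> Pr a -> Pr b) ->
  forall b, 0 <= b -> Pr b.
Proof.
move=> [fr fl] P0 ext B B0; apply: (interval_induction B0 P0) => s /andP[s0 sB].
have [r1 r10 r1P] : exists2 r, 0 < r & forall u, s < u < s + r -> f u = f s.
  have [r/= r0 rP] := fr s s0; exists r => // u /andP[su ur].
  by apply: rP => //=; rewrite ltr_norml; apply/andP; split; lra.
have [r2 r20 [i r2P]] : exists2 r, 0 < r &
    exists i, forall u, 0 <= u -> s - r < u < s -> f u = i.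
  have [s_gt0|] := ltP 0 s; last first.
    by exists 1 => //; exists (f s) => u u0 /andP[_ us]; exfalso; lra.
  have [i [r/= r0 rP]] := fl s s_gt0; exists r => //; exists i => u _ /andP[ur us].
  by apply: rP => //=; rewrite ltr_norml; apply/andP; split; lra.
exists (Num.min r1 r2); first by rewrite lt_min r10.
move=> a b a0 ab sa as_ bs bB Pa.
have [sa1 sa2] : s - r1 < a /\ s - r2 < a.
  by move: sa; rewrite ltrBlDr -ltrBlDl lt_min => /andP[]; lra.
have bs1 : b < s + r1 by move: bs; rewrite -ltrBlDl lt_min => /andP[]; lra.
have Pas c : a <= c -> c <= s -> Pr c.
  move=> ac cs; move: ac; rewrite le_eqVlt => /predU1P[<-//|ac].
  apply: (ext a c i) => // u /andP[au uc]; apply: r2P; first by lra.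
  by apply/andP; split; lra.
have [bs2|sb] := leP b s; first exact: Pas.
apply: (ext s b (f s)) => //; last exact: Pas.
by move=> u /andP[su ub]; apply: r1P; rewrite su; lra.
Qed.

End IntervalInduction.

Section UniformContinuity.
Context {R : realType}.
Implicit Types (w y : R -> R).

Definition ucont y (b : R) := forall eps, 0 < eps -> exists2 dl, 0 < dl &
  forall s s', 0 <= s <= b -> 0 <= s' <= b -> `|s - s'| < dl -> `|y s - y s'| < eps.

Lemma within_continuous_ucont w (b : R) :
  {within `[0, +oo[, continuous w} -> 0 <= b -> ucont w b.
Proof.
move=> /subspace_continuousP cw b0 eps e0.
pose Pr b := exists2 dl, 0 < dl &
  forall s s', 0 <= s <= b -> 0 <= s' <= b -> `|s - s'| < dl -> `|w s - w s'| < eps.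
apply: (@interval_induction _ Pr _ b0).
  by exists 1 => // s s' /le_anti <- /le_anti <- _; rewrite subrr normr0.
move=> s /andP[s0 sb].
have /cvgrPdist_lt/(_ (eps / 2)) : w @ within `[0, +oo[ (nbhs s) --> w s.
  by apply: cw; rewrite /= in_itv/= s0.
rewrite divr_gt0// => /(_ isT)[r/= r0 rP].
have near_s u : 0 <= u -> `|s - u| < r -> `|w s - w u| < eps / 2.
  by move=> u0 ur; apply: rP => //=; rewrite in_itv/= u0.
exists (r / 2); first by rewrite divr_gt0.
move=> a c a0 ac sa as_ cs cb [dl dl0 dlP].
exists (Num.min dl (r / 2)); first by rewrite lt_min dl0 divr_gt0.
move=> u u' /andP[u0 uc] /andP[u'0 u'c]; rewrite lt_min => /andP[ud ur].
have [ua|au] := leP u a; have [u'a|au'] := leP u' a.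
- by apply: dlP => //; rewrite ?u0 ?u'0.
- have h1 : `|s - u| < r by move: ur; rewrite !ltr_norml; lra.
  have h2 : `|s - u'| < r by move: ur; rewrite !ltr_norml; lra.
  have := near_s _ u0 h1; have := near_s _ u'0 h2; rewrite !ltr_norml; lra.
- have h1 : `|s - u| < r by move: ur; rewrite !ltr_norml; lra.
  have h2 : `|s - u'| < r by move: ur; rewrite !ltr_norml; lra.
  have := near_s _ u0 h1; have := near_s _ u'0 h2; rewrite !ltr_norml; lra.
- have h1 : `|s - u| < r by move: ur; rewrite !ltr_norml; lra.
  have h2 : `|s - u'| < r by move: ur; rewrite !ltr_norml; lra.
  have := near_s _ u0 h1; have := near_s _ u'0 h2; rewrite !ltr_norml; lra.
Qed.

Lemma ucont_id (b : R) : ucont id b.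
Proof. by move=> eps e0; exists eps. Qed.

Lemma ucontD y y' (b : R) : ucont y b -> ucont y' b -> ucont (fun s => y s + y' s) b.
Proof.
move=> uy uy' eps e0; have e2 : 0 < eps / 2 by rewrite divr_gt0.
have [d1 d10 P1] := uy _ e2; have [d2 d20 P2] := uy' _ e2.
exists (Num.min d1 d2); first by rewrite lt_min d10.
move=> s s' hs hs'; rewrite lt_min => /andP[/(P1 _ _ hs hs') + /(P2 _ _ hs hs')].
by rewrite !ltr_norml; lra.
Qed.

End UniformContinuity.

Section GridLimit.
Context {R : realType} (m : nat).
Implicit Types (c : 'rV[R]_m) (f : R -> 'I_m) (w y : R -> R).

Definition grid_sum c f w (h : R) (j : nat) : R :=
  \sum_(k < j) c 0 (f (k%:R * h)) * (w (k.+1%:R * h) - w (k%:R * h)).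

(** Convergence is uniform over all grid points up to b and all small meshes, because the reflection
    depends on the whole path through its infimum. *)
Definition grid_limit c f w y (b : R) : Prop :=
  [/\ ucont y b, y 0 = 0 & forall eps, 0 < eps -> exists2 dl, 0 < dl &
    forall h, 0 < h -> h < dl -> forall j, j%:R * h <= b ->
      `|grid_sum c f w h j - y (j%:R * h)| < eps].

Lemma grid_limit0 c f w : grid_limit c f w (fun=> 0) 0.
Proof.
split=> // eps e0; first by exists 1 => // *; rewrite subrr normr0.
exists 1 => // h h0 _ j jh.
have : j%:R * h == 0 by rewrite eq_le jh mulr_ge0// ltW.
rewrite mulf_eq0 (gt_eqF h0) orbF pnatr_eq0 => /eqP ->.
by rewrite /grid_sum big_ord0 subrr normr0.
Qed.

Lemma eq_grid_limit c f w y y' (b : R) : 0 <= b -> (forall s, 0 <= s <= b -> y s = y' s) ->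
  grid_limit c f w y b -> grid_limit c f w y' b.
Proof.
move=> b0 yy' [uy y0 gy]; split=> [eps /uy[dl dl0 dlP]||eps /gy[dl dl0 dlP]].
- by exists dl => // s s' hs hs'; rewrite -!yy'//; exact: dlP.
- by rewrite -yy' ?lexx.
- exists dl => // h h0 hd j jh; rewrite -yy'; first exact: dlP.
  by rewrite jh mulr_ge0// ltW.
Qed.

(** Past a the path stays in state i, so the integral grows by c_i times the increment of w. *)
Lemma grid_limit_ext c f w y (a b : R) i : 0 <= a -> a < b ->
  (forall s, a < s < b -> f s = i) -> ucont w b -> grid_limit c f w y a ->
  grid_limit c f w (fun s => y (Num.min s a) + c 0 i * (w (Num.max s a) - w a)) b.
Proof.
move=> a0 ab fi uw [uy y0 gy]; pose C := 1 + \sum_j `|c 0 j|.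
have C0 : 0 < C by rewrite ltr_pwDl// sumr_ge0.
have cC j : `|c 0 j| <= C.
  by rewrite /C (bigD1 j)//= addrCA lerDl addr_ge0// sumr_ge0.
have cw j eps u : `|u| < eps / C -> `|c 0 j * u| < eps.
  move=> h; rewrite normrM; apply: le_lt_trans (_ : C * `|u| < _).
    by rewrite ler_wpM2r.
  by rewrite -ltr_pdivlMl// mulrC.
have lip s s' : `|Num.min s a - Num.min s' a| <= `|s - s'| /\
    `|Num.max s a - Num.max s' a| <= `|s - s'|.
  split; rewrite ?minEle ?maxEle; case: ifPn => h1; case: ifPn => h2;
    rewrite -?ltNge in h1 h2; rewrite ler_norml; have := ler_norm (s - s');
    have := ler_norm (- (s - s')); rewrite normrN; lra.
have rg s : 0 <= s <= b -> (0 <= Num.min s a <= a) /\ (0 <= Num.max s a <= b).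
  move=> /andP[s0 sb]; rewrite le_min s0 a0 ge_min lexx orbT le_max s0.
  by rewrite ge_max sb (ltW ab).
split.
- move=> eps e0; have e2 : 0 < eps / 2 by rewrite divr_gt0.
  have [d1 d10 P1] := uy _ e2.
  have [d2 d20 P2] := uw _ (divr_gt0 e2 C0).
  exists (Num.min d1 d2); first by rewrite lt_min d10.
  move=> s s' hs hs'; rewrite lt_min => /andP[h1 h2].
  have [rs1 rs2] := rg s hs; have [rs1' rs2'] := rg s' hs'.
  have [l1 l2] := lip s s'.
  have := P1 _ _ rs1 rs1' (le_lt_trans l1 h1).
  have := cw i _ _ (P2 _ _ rs2 rs2' (le_lt_trans l2 h2)).
  by rewrite !ltr_norml; lra.
- by rewrite (min_idPl a0) y0 (max_idPr a0) subrr mulr0 addr0.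
- move=> eps e0; have e4 : 0 < eps / 4 by rewrite divr_gt0.
  have [d1 d10 P1] := uy _ e4.
  have [d2 d20 P2] := uw _ (divr_gt0 e4 C0).
  have [d3 d30 P3] := gy _ e4.
  exists (Num.min d1 (Num.min d2 d3)); first by rewrite !lt_min d10 d20.
  move=> h h0; rewrite !lt_min => /and3P[hd1 hd2 hd3].
  have jh0 j : 0 <= j%:R * h by rewrite mulr_ge0// ltW.
  have Sh j : j.+1%:R * h = j%:R * h + h by rewrite -natr1 mulrDl mul1r.
  elim=> [|j IH] jb.
    by rewrite mul0r (min_idPl a0) y0 (max_idPr a0) subrr mulr0 addr0 /grid_sum big_ord0
      subrr normr0.
  have jb' : j%:R * h <= b by apply: le_trans jb; rewrite Sh lerDl ltW.
  have [j1a|aj1] := leP (j.+1%:R * h) a.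
    rewrite subrr mulr0 addr0; apply: lt_trans (P3 h h0 hd3 _ j1a) _.
    by rewrite ltr_pdivrMr// ltr_pMr// ltr1n.
  rewrite /grid_sum big_ord_recr/= -/(grid_sum c f w h j).
  (* The step that straddles a uses a coefficient taken at or before a, possibly not c_i; it is a
     single term, small by the uniform continuity of w. *)
  have [ja|aj] := leP (j%:R * h) a.
    have g3 := P3 h h0 hd3 _ ja.
    have g1 : `|y (j%:R * h) - y a| < eps / 4.
      apply: P1; rewrite ?jh0 ?ja ?a0 ?lexx// distrC ger0_norm ?subr_ge0//.
      by move: aj1; rewrite Sh; lra.
    have g2 : `|c 0 (f (j%:R * h)) * (w (j.+1%:R * h) - w (j%:R * h))| < eps / 4.
      apply: cw; apply: P2; rewrite ?jh0 ?jb ?jb'// Sh addrAC subrr add0r ger0_norm//.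
      exact: ltW.
    have g4 : `|c 0 i * (w (j.+1%:R * h) - w a)| < eps / 4.
      apply: cw; apply: P2; rewrite ?jh0 ?jb ?a0 ?(ltW ab)// ger0_norm ?subr_ge0 ?(ltW aj1)//.
      by move: ja; rewrite Sh; lra.
    move: g1 g2 g3 g4; rewrite !ltr_norml; lra.
  have -> : f (j%:R * h) = i.
    by apply: fi; rewrite aj/=; apply: lt_le_trans jb; rewrite Sh ltrDl.
  move: (IH jb'); rewrite (min_idPr (ltW aj)) (max_idPl (ltW aj)).
  by congr (`|_| < _); ring.
Qed.

Lemma grid_limit_exists c f w (b : R) : cadlag_step f -> 0 <= b ->
  (forall a, 0 <= a -> ucont w a) -> exists y, grid_limit c f w y b.
Proof.
move=> sf + uw; move: b; apply: (step_path_ind sf) => [|b b' i a0 ab fi [y gy]].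
  by exists (fun=> 0); exact: grid_limit0.
exists (fun s => y (Num.min s b) + c 0 i * (w (Num.max s b) - w b)).
by apply: grid_limit_ext => //; apply: uw; rewrite (le_trans a0)// ltW.
Qed.

(** The case of the identity integrator. Measurability of the integrand is carried along the same
    induction, since the integral over a longer interval is split at a. *)
Lemma grid_limit_integral c f (b : R) : cadlag_step f -> 0 <= b ->
  grid_limit c f id (fun s => \int[lebesgue_measure]_(u in `[0, s]) c 0 (f u)) b.
Proof.
move=> sf b0; pose g u := c 0 (f u); pose I s := (\int[lebesgue_measure]_(u in `[0, s]) g u : R).
suff [] : measurable_fun `[0, b] g /\ grid_limit c f id I b by [].
move: b b0; apply: (step_path_ind sf) => [|a b i a0 ab fi [ma ga]].
  split; first by rewrite set_itv1; exact: measurable_fun_set1.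
  apply: eq_grid_limit (grid_limit0 _ _ _) => // s /le_anti <-.
  by rewrite /I set_itv1 Rintegral_set1.
have gi : {in `]a, b[, g =1 cst (c 0 i)} by move=> u; rewrite in_itv/= /g => /fi ->.
have mg : measurable_fun `]a, b[ g.
  by apply: (eq_measurable_fun (cst (c 0 i))) => // u /set_mem; move=> /gi.
have split_itv : `[0, b]%classic = `[0, a] `|` `]a, b] :> set R.
  by apply: itv_bndbnd_setU; rewrite bnd_simp ?(ltW ab).
have mb : measurable_fun `[0, b] g.
  rewrite split_itv; apply/measurable_funU => //; split=> //.
  exact: (@measurable_fun_itv_oc _ a b false true).
split=> //.
have intg s : s <= b -> lebesgue_measure.-integrable `[0, s] (EFin \o g).
  move=> sb; apply: measurable_bounded_integrable => //.
  - by rewrite /= lebesgue_measure_itv//=; case: ifPn => // _; exact: ltry.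
  - by apply: measurable_funS mb => //; apply: subset_itvl; rewrite bnd_simp.
  - exists (\sum_j `|c 0 j|); split; first exact: num_real.
    move=> M hM u _; apply: le_trans (ltW hM).
    by rewrite /g (bigD1 (f u))//= lerDl sumr_ge0.
apply: eq_grid_limit (grid_limit_ext a0 ab fi (ucont_id b) ga) => [|s /andP[s0 sb]].
  by rewrite (le_trans a0)// ltW.
have [sa|as_] := leP s a; first by rewrite subrr mulr0 addr0.
apply/eqP; rewrite eq_sym addrC -subr_eq /I; apply/eqP.
rewrite Rintegral_itvB ?bnd_simp ?(ltW as_)//; last exact: intg.
rewrite /Rintegral (@eq_integral_itv_bounded _ _ _ (cst (c 0 i)) g)//.
- rewrite -[LHS]/(\int[lebesgue_measure]_(z in `]a, s]) (c 0 i)) Rintegral_cst//=.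
  by rewrite lebesgue_measure_itv/= lte_fin as_.
- by apply: measurable_funS mg => //; apply: subset_itvl; rewrite bnd_simp.
- move=> u; rewrite in_itv/= => /andP[au us]; apply: gi; rewrite in_itv/= au.
  exact: lt_le_trans sb.
Qed.

End GridLimit.

Section Reflection.
Context {R : realType}.

(** Discrete Skorokhod reflection: Y_n is the maximum over k <= n of S_n - S_k, stated as an upper
    bound together with a point where it is attained. *)
Lemma reflection_formula (S Y : nat -> R) : Y 0%N = 0 ->
  (forall k, Y k.+1 = Num.max (Y k + (S k.+1 - S k)) 0) -> forall n,
  (forall k, (k <= n)%N -> S n - S k <= Y n) /\ exists2 k, (k <= n)%N & Y n = S n - S k.
Proof.
move=> Y0 YS; elim=> [|n [IH1 [k kn IH2]]].
  by split=> [k|]; [rewrite leqn0 => /eqP ->|exists 0%N => //]; rewrite subrr Y0.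
rewrite YS; split=> [j|].
  rewrite leq_eqVlt => /predU1P[->|jn]; first by rewrite subrr le_max lexx orbT.
  by rewrite le_max; apply/orP; left; have := IH1 j jn; lra.
rewrite maxEle; case: ifPn => _; first by exists n.+1; rewrite ?subrr.
by exists k; [exact: leqW|rewrite IH2; ring].
Qed.

Lemma regulate_approx (X : R -> R) (t : R) : 0 <= t -> X 0 = 0 -> ucont X t ->
  forall eps, 0 < eps -> exists2 dl, 0 < dl & forall (h : R) n (S Y : nat -> R),
  0 < h -> h < dl -> n%:R * h = t -> Y 0%N = 0 ->
  (forall k, Y k.+1 = Num.max (Y k + (S k.+1 - S k)) 0) ->
  (forall k, (k <= n)%N -> `|S k - X (k%:R * h)| < eps) ->
  `|Y n - regulate X t| < 4 * eps.
Proof.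
move=> t0 X0 uX eps e0; have [dl dl0 dlP] := uX _ e0.
exists dl => // h n S Y h0 hd nh Y0 YS SX.
have [Y1 [k0 k0n Y2]] := reflection_formula Y0 YS n.
have grid s : 0 <= s <= t -> exists2 k, (k <= n)%N & `|X (k%:R * h) - X s| < eps.
  move=> /andP[s0 st]; have sh0 : 0 <= s / h by rewrite divr_ge0// ltW.
  have /andP[k1 k2] := truncn_itv sh0; set k := Num.truncn _ in k1 k2.
  rewrite ler_pdivlMr// in k1; rewrite ltr_pdivrMr// in k2.
  have kh0 : 0 <= k%:R * h by rewrite mulr_ge0// ltW.
  exists k.
    by rewrite -(ler_nat R) -(ler_pM2r h0) nh (le_trans k1).
  apply: dlP; rewrite ?kh0 ?s0 ?(le_trans k1)//.
  by move: k2; rewrite -natr1 mulrDl mul1r distrC ger0_norm ?subr_ge0//; lra.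
set E := [set X s | s in `[0, t]].
have E0 : E 0 by exists 0 => //; rewrite /= in_itv/= lexx.
have lb : lbound E (X t - Y n - 3 * eps).
  move=> z [s /=]; rewrite in_itv/= => hs <-; have [k kn] := grid s hs.
  have := SX k kn; have := SX n (leqnn n); have := Y1 k kn; rewrite nh !ltr_norml; lra.
have hE : has_inf E by split; [exists 0|exists (X t - Y n - 3 * eps)].
have i0 : inf E <= 0 by apply: ge_inf => //; exact: hE.2.
have i1 : X t - Y n - 3 * eps <= inf E by apply: lb_le_inf => //; exact: hE.1.
have i2 : inf E <= X (k0%:R * h).
  apply: ge_inf; first exact: hE.2.
  exists (k0%:R * h) => //=; rewrite in_itv/= mulr_ge0 ?(ltW h0)//= -nh.
  by rewrite ler_wpM2r ?(ltW h0)// ler_nat.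
rewrite /regulate -/E (ler0_norm i0).
have := SX k0 k0n; have := SX n (leqnn n); rewrite nh !ltr_norml; lra.
Qed.

End Reflection.

Section PathLimit.
Context {R : realType} (m : nat).
Implicit Types (c : 'rV[R]_m) (f : R -> 'I_m) (w y : R -> R).

(** The n-th sum is the grid sum of mesh s / n, so the [limn] that defines the stochastic integral
    is a true limit, with value y(s). *)
Lemma step_sum_limit c f w y (b s : R) : grid_limit c f w y b -> 0 <= s <= b ->
  limn (fun n : nat => \sum_(k < n) c 0 (f (s * k%:R / n%:R)) *
    (w (s * k.+1%:R / n%:R) - w (s * k%:R / n%:R))) = y s.
Proof.
move=> [_ y0 gy] /andP[s0 sb]; apply/cvg_lim => //.
move: s0; rewrite le_eqVlt => /predU1P[<-|s0].
  rewrite y0 (_ : (fun n : nat => _) = cst 0); first exact: cvg_cst.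
  by apply/funext => n; rewrite big1// => k _; rewrite !mul0r subrr mulr0.
apply/cvgrPdist_lt => eps e0; have [dl dl0 dlP] := gy _ e0.
near=> n.
have n0 : 0 < n%:R :> R by rewrite ltr0n; near: n; exact: nbhs_infty_gt.
have hn : n%:R * (s / n%:R) = s by rewrite mulrCA divff ?mulr1// gt_eqF.
have e (k : nat) : s * k%:R / n%:R = k%:R * (s / n%:R) by ring.
have hd : s / n%:R < dl.
  rewrite ltr_pdivrMr// -ltr_pdivrMl//; near: n; exact: nbhs_infty_gtr.
rewrite distrC; have := dlP (s / n%:R) (divr_gt0 s0 n0) hd n; rewrite hn => /(_ sb).
by congr (`|_ - _| < _); apply: eq_bigr => k _; rewrite !e.
Unshelve. all: by end_near. Qed.

End PathLimit.

Section Discretization.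
Context {R : realType} d (Omega : measurableType d) (P : probability Omega R) (m : nat).
Variables (mu sigma : 'rV[R]_m) (phi : R -> Omega -> 'I_m) (W : R -> {RV P >-> R}) (w : Omega).
Hypotheses (hf : cadlag_step (phi ^~ w))
  (hw : {within `[0, +oo[, continuous (fun t : R => W t w : R)}).

Let X := fun s => mmbm mu sigma phi W s w.
Let f := phi ^~ w.
Let b := fun s => W s w : R.

Lemma mmbm_grid (t : R) : 0 <= t -> [/\ X 0 = 0, ucont X t &
  forall eps, 0 < eps -> exists2 dl, 0 < dl & forall h, 0 < h -> h < dl ->
    forall j, j%:R * h <= t ->
    `|grid_sum mu f id h j + grid_sum sigma f b h j - X (j%:R * h)| < eps].
Proof.
move=> t0; pose I s : R := \int[lebesgue_measure]_(u in `[0, s]) mu 0 (f u).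
have gmu : grid_limit mu f id I t := grid_limit_integral mu hf t0.
have [y gy] : exists y, grid_limit sigma f b y t.
  by apply: grid_limit_exists => // a a0; exact: within_continuous_ucont.
have XE s : 0 <= s <= t -> X s = I s + y s.
  by move=> hs; rewrite /X /mmbm /step_stoch_integral /increment (step_sum_limit gy hs).
have [uI I0 gI] := gmu; have [uy y0 gy'] := gy.
split.
- by rewrite XE ?lexx// I0 y0 addr0.
- move=> eps /(ucontD uI uy)[dl dl0 dlP]; exists dl => // s s' hs hs'.
  by rewrite !XE//; exact: dlP.
- move=> eps e0; have e2 : 0 < eps / 2 by rewrite divr_gt0.
  have [d1 d10 P1] := gI _ e2; have [d2 d20 P2] := gy' _ e2.
  exists (Num.min d1 d2); first by rewrite lt_min d10.
  move=> h h0; rewrite lt_min => /andP[hd1 hd2] j jt.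
  rewrite XE ?jt ?mulr_ge0 ?(ltW h0)//.
  have := P1 h h0 hd1 j jt; have := P2 h h0 hd2 j jt; rewrite !ltr_norml; lra.
Qed.

Lemma reflected_cvg (t : R) : 0 < t ->
  (fun n : nat => @reflected _ _ _ m _ (measurableTypeR R) mu sigma (t / n.+1%:R) idfun
    (fun k => phi (k%:R * (t / n.+1%:R)))
    (fun k => increment W (k%:R * (t / n.+1%:R)) (k.+1%:R * (t / n.+1%:R))) n.+1 w) @ \oo
  --> regulate X t.
Proof.
move=> t0; have [X0 uX gX] := mmbm_grid (ltW t0).
apply/cvgrPdist_lt => eps e0; have e4 : 0 < eps / 4 by rewrite divr_gt0.
have [d1 d10 P1] := regulate_approx (ltW t0) X0 uX e4.
have [d2 d20 P2] := gX _ e4.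
near=> n; have n0 : 0 < n.+1%:R :> R by [].
set h := t / n.+1%:R.
have h0 : 0 < h by rewrite divr_gt0.
have hd : h < Num.min d1 d2.
  have dm : 0 < Num.min d1 d2 by rewrite lt_min d10.
  rewrite /h ltr_pdivrMr// -ltr_pdivrMl//.
  apply: lt_trans (_ : n%:R < _); last by rewrite ltr_nat.
  near: n; exact: nbhs_infty_gtr.
move: hd; rewrite lt_min => /andP[hd1 hd2].
have nh : n.+1%:R * h = t by rewrite /h mulrCA divff ?mulr1// gt_eqF.
rewrite distrC (_ : eps = 4 * (eps / 4)); last by field.
apply: (P1 h n.+1 (fun j => grid_sum mu f id h j + grid_sum sigma f b h j)
  (fun k => @reflected _ _ _ m _ (measurableTypeR R) mu sigma h idfun
    (fun k => phi (k%:R * h)) (fun k => increment W (k%:R * h) (k.+1%:R * h)) k w)) => //.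
- move=> k /=; congr (Num.max _ _); rewrite /grid_sum !big_ord_recr/=.
  by rewrite /increment /f /b -natr1; ring.
- move=> k kn; apply: P2 => //.
  by rewrite -nh ler_wpM2r ?(ltW h0)// ler_nat.
Unshelve. all: by end_near. Qed.

End Discretization.

(** * The limit law *)

Section AlmostSureTails.
Context {R : realType} d (Omega : measurableType d) (P : probability Omega R).

(* Continuous, and between the indicators of ]y', +oo[ and ]y, +oo[. *)
Let ramp (y y' z : R) : R := Num.min (Num.max ((z - y) / (y' - y)) 0) 1.

Let ramp_01 y y' z : 0 <= ramp y y' z <= 1.
Proof. by rewrite /ramp le_min le_max lexx orbT ler01 ge_min lexx orbT. Qed.

Let ramp_continuous y y' : continuous (ramp y y').
Proof.
move=> z; apply: (@continuous_min R R (fun z => Num.max ((z - y) / (y' - y)) 0) (cst 1)).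
  apply: (@continuous_max R R (fun z => (z - y) / (y' - y)) (cst 0)); last exact: cst_continuous.
  apply: cvgM; last exact: cvg_cst.
  by apply: cvgB; [exact: cvg_id|exact: cvg_cst].
exact: cst_continuous.
Qed.

Let measurable_ramp y y' (V : Omega -> R) (D : set Omega) : measurable_fun setT V ->
  measurable_fun D (fun w => (ramp y y' (V w))%:E).
Proof.
move=> mV; apply/measurable_EFinP; apply: (measurable_funS measurableT) => //.
apply: measurableT_comp => //; apply: continuous_measurable_fun; exact: ramp_continuous.
Qed.

Let ramp_bounds y y' (V : Omega -> R) (D : set Omega) : y < y' ->
  measurable_fun setT V -> measurable D ->
  (P [set w | (y' < V w)%R /\ D w] <= \int[P]_(w in D) (ramp y y' (V w))%:E /\
   \int[P]_(w in D) (ramp y y' (V w))%:E <= P [set w | (y < V w)%R /\ D w])%E.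
Proof.
move=> yy' mV mD.
have mA z : measurable [set w | z < V w] by exact: measurable_above.
have mI z : measurable_fun D (fun w => (\1_[set w | z < V w] w : R)%:E).
  by apply/measurable_EFinP; apply: measurable_indic; exact: mA.
have PI z : (P [set w | (z < V w)%R /\ D w] = \int[P]_(w in D) (\1_[set w | (z < V w)%R] w)%:E)%E.
  by rewrite integral_indic.
have yp : 0 < y' - y by rewrite subr_gt0.
rewrite !PI; split; apply: ge0_le_integral => //.
- exact: measurable_ramp.
- move=> w _; rewrite lee_fin indicE; have [h|h] := ltP y' (V w); last first.
    have nh : ~ (y' < V w) by apply/negP; rewrite -leNgt.
    by rewrite memNset//; case/andP: (ramp_01 y y' (V w)).
  by rewrite mem_set// /ramp le_min lexx andbT le_max ler_pdivlMr// mul1r lerB// ltW.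
- by move=> w _; rewrite lee_fin; case/andP: (ramp_01 y y' (V w)).
- exact: measurable_ramp.
- move=> w _; rewrite lee_fin indicE; have [h|h] := ltP y (V w).
    by rewrite mem_set//; case/andP: (ramp_01 y y' (V w)).
  have nh : ~ (y < V w) by apply/negP; rewrite -leNgt.
  rewrite memNset//= /ramp ge_min ge_max lexx andbT ler_pdivrMr// mul0r subr_le0.
  by rewrite h.
Qed.

(** Nothing is known about atoms of the law of Z, so tails are compared at two thresholds y < y',
    with a continuous ramp between the two indicators and dominated convergence. *)
Lemma ae_cvg_tails (Y : nat -> Omega -> R) (Z : Omega -> R) (D : set Omega) (y y' eps : R) :
  (forall n, measurable_fun setT (Y n)) -> measurable_fun setT Z -> measurable D ->
  {ae P, forall w, Y ^~ w @ \oo --> Z w} -> y < y' -> 0 < eps -> \forall n \near \oo,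
  fine (P [set w | y' < Z w /\ D w]) <= fine (P [set w | y < Y n w /\ D w]) + eps /\
  fine (P [set w | y' < Y n w /\ D w]) <= fine (P [set w | y < Z w /\ D w]) + eps.
Proof.
move=> mY mZ mD YZ yy' e0.
have mA (V : Omega -> R) z : measurable_fun setT V -> measurable [set w | z < V w /\ D w].
  by move=> mV; apply: measurableI => //; exact: measurable_above.
pose J (V : Omega -> R) := (\int[P]_(w in D) (ramp y y' (V w))%:E)%E.
have [_ _ cJ] : [/\ P.-integrable D (fun w => (ramp y y' (Z w))%:E),
    (fun n => \int[P]_(w in D) `|(ramp y y' (Y n w))%:E - (ramp y y' (Z w))%:E|)%E @ \oo --> 0%E
    & (fun n => J (Y n)) @ \oo --> J Z].
  apply: (@dominated_convergence _ _ _ P D mD _ _ (cst 1%E)).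
  - by move=> n; exact: measurable_ramp.
  - exact: measurable_ramp.
  - apply: filterS YZ => w cw _; apply: cvg_EFin; first exact: nearW.
    have := @ramp_continuous y y' (Z w); exact: cvg_comp.
  - exact: finite_measure_integrable_cst.
  - apply: aeW => w n _; rewrite abse_EFin lee_fin.
    by have /andP[r0 r1] := ramp_01 y y' (Y n w); rewrite ger0_norm.
have Jfin V : measurable_fun setT V -> J V \is a fin_num.
  move=> mV; have [_ h] := ramp_bounds yy' mV mD.
  rewrite ge0_fin_numE; first by apply: le_lt_trans h _; rewrite ltey_eq fin_num_measure//; exact: mA.
  by apply: integral_ge0 => w _; rewrite lee_fin; case/andP: (ramp_01 y y' (V w)).
have B V : measurable_fun setT V -> fine (P [set w | y' < V w /\ D w]) <= fine (J V) /\
    fine (J V) <= fine (P [set w | y < V w /\ D w]).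
  move=> mV; have [h1 h2] := ramp_bounds yy' mV mD.
  by split; apply: fine_le => //; rewrite ?Jfin// fin_num_measure//; exact: mA.
have /cvgrPdist_lt/(_ _ e0) : (fun n => fine (J (Y n))) @ \oo --> fine (J Z).
  by apply: fine_cvg; rewrite fineK ?Jfin.
apply: filterS => n; have [h1 h2] := B _ mZ; have [h3 h4] := B _ (mY n).
by rewrite ltr_norml => /andP[h5 h6]; split; lra.
Qed.

End AlmostSureTails.

Section LimitLaw.
Context {R : realType} d (Omega : measurableType d) (P : probability Omega R) (m : nat).
Variables (Q : 'M[R]_m) (alpha mu sigma : 'rV[R]_m)
  (phi : R -> Omega -> 'I_m) (W Z : R -> {RV P >-> R}) (U : 'M[R]_m).
Hypotheses (hQ : is_generator Q) (hirr : is_irreducible Q)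
  (halpha : is_stationary Q alpha)
  (hsigma : forall i, 0 < sigma 0 i)
  (hdrift : \sum_i alpha 0 i * mu 0 i < 0)
  (hphi : is_ctmc P Q phi) (hW : is_brownian W)
  (hind : independent_processes phi W)
  (hZ : is_regulated_mmbm mu sigma phi W Z)
  (hU : is_U0 mu sigma Q U).

Local Notation F := (limit_tail mu sigma U alpha).

Let Zt (t y : R) i := fine (P [set w | y < Z t w /\ phi t w = i]).

Let mphi t i : 0 <= t -> measurable [set w | phi t w = i].
Proof. by case: hphi => h _ _; exact: h. Qed.

(** With t fixed and mesh t / (n + 1), the bounds for the walk pass to Z. The gap between y and y'
    is the price of almost sure convergence. *)
Lemma regulated_tail_bounds : exists d0 kappa D, [/\ 0 < d0, 0 < kappa, 0 <= D &
  forall eps dl, 0 < eps -> eps < 1 -> 0 < dl -> dl <= d0 -> exists2 s, 0 <= s &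
  forall t y y' i, 0 < t -> 0 <= y -> y < y' ->
    Zt t y' i <= (1 + eps) * F y i + D * (1 + kappa * s) / (1 + kappa * t) /\
    (1 - eps) * F (y' + dl) i - D * (1 + kappa * s) / (1 + kappa * t) <= Zt t y i].
Proof.
have [d0 [kappa [D [d00 k0 D0 bounds]]]] := tail_bounds hQ hirr halpha hsigma hdrift hU.
exists d0, kappa, D; split=> // eps dl e0 e1 dl0 dld.
have [s s0 sP] := state_law_cvg hQ hirr halpha hphi e0.
exists s => // t y y' i t0 y0 yy'.
have [C CP] := bounds eps dl s e0 e1 dl0 dld s0.
pose h n : R := t / n.+1%:R.
pose X n k := phi (k%:R * h n).
pose N n k : Omega -> measurableTypeR R := increment W (k%:R * h n) (k.+1%:R * h n).
pose Y n := @reflected _ _ _ m _ (measurableTypeR R) mu sigma (h n) idfun (X n) (N n).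
have h0 n : 0 < h n by rewrite divr_gt0.
have nh n : n.+1%:R * h n = t by rewrite /h mulrCA divff ?mulr1// pnatr_eq0.
have mX n k l : measurable [set w | X n k w = l] by apply: mphi; rewrite mulr_ge0// ltW.
have me : measurable_fun setT (idfun : measurableTypeR R -> R).
  by move=> _ B mB; rewrite setTI.
have mN n k : measurable_fun setT (N n k) by exact: measurable_funB.
have mYn n : measurable_fun setT (Y n n.+1) by exact: measurable_reflected.
have YZ : {ae P, forall w, (fun n => Y n n.+1 w) @ \oo --> (Z t w : R)}.
  have [_ _ ae1] := hphi; have [_ _ _ ae2] := hW.
  near=> w.
  have -> : Z t w = regulate (fun s => mmbm mu sigma phi W s w) t.
    by near: w; apply: filterS hZ => w; apply; exact: ltW.
  by apply: reflected_cvg => //; near: w; assumption.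
have near_tail e : 0 < e ->
    Zt t y' i <= (1 + eps) * F y i + D * (1 + kappa * s) / (1 + kappa * t) + e /\
    (1 - eps) * F (y' + dl) i - D * (1 + kappa * s) / (1 + kappa * t) - e <= Zt t y i.
  move=> ee0; have e20 : 0 < e / 2 by rewrite divr_gt0.
  near \oo => n.
  have [c1 c2] : Zt t y' i <= fine (P [set w | y < Y n n.+1 w /\ phi t w = i]) + e / 2 /\
      fine (P [set w | y' < Y n n.+1 w /\ phi t w = i]) <= Zt t y i + e / 2.
    near: n; apply: (ae_cvg_tails (Y := fun n => Y n n.+1)) => //.
    by apply: mphi; exact: ltW.
  pose r := Num.sqrt (h n).
  have r0 : 0 < r by rewrite sqrtr_gt0.
  have rr : r ^+ 2 = h n by rewrite sqr_sqrtr// ltW.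
  have r1 : r <= 1.
    rewrite -(@expr_le1 _ 2)// ?rr ?(ltW r0)// /h ler_pdivrMr// mul1r.
    apply: le_trans (_ : n%:R <= _); last by rewrite ler_nat.
    near: n; exact: nbhs_infty_ger.
  have rC : t * r * `|C| <= e / 2.
    have c0 : 0 < t * (`|C| + 1) by rewrite mulr_gt0// ltr_wpDl.
    apply: le_trans (_ : r * (t * (`|C| + 1)) <= _).
      by rewrite [t * r]mulrC -mulrA ler_wpM2l ?(ltW r0)// ler_wpM2l ?(ltW t0)// lerDl.
    rewrite -ler_pdivlMr// -(@ler_pXn2r _ 2)// ?nnegrE ?(ltW r0) ?divr_ge0 ?(ltW c0) ?(ltW e20) ?(ltW ee0)//.
    have q0 : 0 < (e / 2 / (t * (`|C| + 1))) ^+ 2 by rewrite exprn_gt0// divr_gt0.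
    rewrite rr /h ler_pdivrMr// -ler_pdivrMl//.
    apply: le_trans (_ : n%:R <= _); last by rewrite ler_nat.
    near: n; exact: nbhs_infty_ger.
  have ts := grid_tail_system hphi hW hind hQ r0 mu sigma.
  have pE k j : fine (P [set w | phi (k%:R * r ^+ 2) w = j]) = state_law P phi (k%:R * r ^+ 2) j by [].
  have kr0 k : 0 <= k%:R * r ^+ 2 by rewrite mulr_ge0// exprn_ge0// ltW.
  have p01 k j : 0 <= fine (P [set w | phi (k%:R * r ^+ 2) w = j]) <= 1.
    exact: (state_law_01 hphi).
  have Tb := CP r _ _ r0 r1 ts p01 (fun k hk j => sP _ hk j) n.+1 i.
  have TE z : @tail _ _ _ P _ _ (measurableTypeR R) mu sigma (r ^+ 2) idfun
      (fun k => phi (k%:R * r ^+ 2))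
      (fun k => increment W (k%:R * r ^+ 2) (k.+1%:R * r ^+ 2)) n.+1 i z =
      fine (P [set w | z < Y n n.+1 w /\ phi t w = i]).
    by rewrite /tail rr -[in phi t](nh n).
  have y'0 : 0 <= y' by rewrite (le_trans y0)// ltW.
  have /andP[_] := Tb y y0; have /andP[+ _] := Tb y' y'0; rewrite !TE rr nh.
  (* The accumulated discretization error, t sqrt h C, which [rC] makes smaller than e / 2. *)
  have -> : n.+1%:R * r ^+ 3 * C = t * r * C by rewrite exprS rr -(nh n); ring.
  have : t * r * C <= t * r * `|C| by rewrite ler_wpM2l ?ler_norm// mulr_ge0 ?(ltW t0) ?(ltW r0).
  move: c1 c2 rC; lra.
split; apply/ler_addgt0Pr => e ee0; have [H1 H2] := near_tail e ee0 => //.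
by rewrite -lerBlDr.
Unshelve. all: by end_near. Qed.

(** The distribution function is the law of the chain minus the tail; the continuity of F closes the
    gaps between thresholds and the shift of the lower barrier. *)
Lemma regulated_limit_law x : 0 <= x ->
  limit_law phi Z x (alpha *m (1%:M - expmx (x *: Lmx mu sigma U))).
Proof.
move=> x0 i.
have apos := stationary_gt0 hQ hirr halpha.
have a1 := alpha_le1 hQ hirr halpha i.
have [d0 [kappa [D [d00 k0 D0 bounds]]]] := regulated_tail_bounds.
have -> : (alpha *m (1%:M - expmx (x *: Lmx mu sigma U))) 0 i = alpha 0 i - F x i.
  by rewrite mulmxBr mulmx1 mxE [in X in _ + X]mxE.
have FE y : F y i = \sum_j alpha 0 j * expmx (y *: Lmx mu sigma U) j i by rewrite /limit_tail mxE.
have cF : {for x, continuous (fun y => F y i)}.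
  rewrite (_ : (fun y => _) = (fun y => \sum_j alpha 0 j * expmx (y *: Lmx mu sigma U) j i)).
    apply: cvg_big => [|j _]; [exact: add_continuous|]; apply: cvgM; first exact: cvg_cst.
    exact: expmx_entry_continuous.
  by apply/funext.
apply/cvgrPdist_lt => e e0; have e8 : 0 < e / 8 by rewrite divr_gt0.
have [rho /= rho0 rhoP] : \forall y \near x, `|F x i - F y i| < e / 8.
  by move/cvgrPdist_lt : cF; apply.
have Fnear y : `|x - y| < rho -> `|F x i - F y i| < e / 8 by move=> h; exact: rhoP.
have F0 y : 0 <= y -> F y i <= 1.
  by move=> y0; apply: le_trans (limit_tail_le hQ hirr halpha hsigma hdrift hU i y0) a1.
have Fx0 y : 0 <= y -> 0 <= F y i.
  have [c _ cP] := limit_tail_decay hQ hirr halpha hsigma hdrift hU.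
  by move=> y0; case/andP: (cP y i y0).
pose eps := Num.min (1 / 2) (e / 8).
have eps0 : 0 < eps by rewrite lt_min e8 divr_gt0.
have eps1 : eps < 1 by rewrite gt_min ltr_pdivrMr// mul1r ltr1n.
have epse : eps <= e / 8 by rewrite ge_min lexx orbT.
pose dl := Num.min d0 (rho / 4).
have dl0 : 0 < dl by rewrite lt_min d00 divr_gt0.
have dld : dl <= d0 by rewrite ge_min lexx.
have dlr : dl <= rho / 4 by rewrite ge_min lexx orbT.
have [s s0 sP] := bounds eps dl eps0 eps1 dl0 dld.
have [s' s'0 s'P] := state_law_cvg hQ hirr halpha hphi eps0.
pose c := D * (1 + kappa * s).
have c0 : 0 <= c by rewrite mulr_ge0// addr_ge0// mulr_ge0// ltW.
near=> t.
have t0 : 0 < t by near: t; exact: nbhs_pinfty_gt.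
have ct : c / (1 + kappa * t) <= e / 8.
  have k1 : 0 < 1 + kappa * t by rewrite ltr_pwDl// mulr_ge0// ltW.
  rewrite ler_pdivrMr// -ler_pdivrMl//.
  apply: le_trans (_ : kappa * t <= _); last by rewrite lerDr.
  rewrite -ler_pdivrMl//; near: t; exact: nbhs_pinfty_ge.
have pt : `|state_law P phi t i - alpha 0 i| <= e / 8.
  have /andP[p1 p2] : (1 - eps) * alpha 0 i <= state_law P phi t i <= (1 + eps) * alpha 0 i.
    by apply: s'P; near: t; apply: nbhs_pinfty_ge; exact: num_real.
  have ea : eps * alpha 0 i <= e / 8.
    by apply: le_trans epse; rewrite ler_piMr ?(ltW eps0).
  by rewrite ler_norml; apply/andP; split; lra.
have split_law : fine (P [set w | Z t w <= x /\ phi t w = i]) = state_law P phi t i - Zt t x i.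
  have mphit := mphi i (ltW t0).
  have mlt : measurable [set w | x < Z t w /\ phi t w = i].
    by apply: measurableI => //; exact: measurable_above.
  rewrite /state_law /Zt.
  have -> : [set w | Z t w <= x /\ phi t w = i] =
      [set w | phi t w = i] `\` [set w | x < Z t w /\ phi t w = i].
    apply/seteqP; split=> w /=; first by move=> [Zx ->]; split=> // -[]; rewrite ltNge Zx.
    by move=> [pw nw]; split=> //; rewrite leNgt; apply/negP => xZ; apply: nw.
  rewrite measureD//; last by rewrite ltey_eq fin_num_measure.
  have -> : [set w | phi t w = i] `&` [set w | x < Z t w /\ phi t w = i] =
      [set w | x < Z t w /\ phi t w = i] by apply/setIidPr => w [].
  by rewrite fineB// fin_num_measure.
rewrite split_law.
have upper : Zt t x i <= F x i + 3 * (e / 8).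
  have Fb y : 0 <= y -> (1 + eps) * F y i <= F y i + e / 8.
    move=> y0; rewrite mulrDl mul1r lerD2l; apply: le_trans epse.
    by rewrite ler_piMr ?(ltW eps0)// F0.
  have [xp|x_le0] := ltP 0 x.
    pose y := Num.max 0 (x - rho / 2).
    have y0 : 0 <= y by rewrite le_max lexx.
    have yx : y < x by rewrite gt_max xp ltrBlDr ltrDl divr_gt0.
    have xy : x - rho / 2 <= y by rewrite le_max lexx orbT.
    have [h1 _] := sP t y x i t0 y0 yx; rewrite -/c in h1.
    have := Fnear y _; rewrite ger0_norm ?subr_ge0 ?(ltW yx)// => /(_ ltac:(lra)).
    have := Fb y y0; rewrite ltr_norml; lra.
  (* At x = 0 there is no nonnegative threshold below x; the tail is bounded instead by the law of
     the chain, which tends to alpha = F(0). *)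
  have -> : x = 0 by apply/eqP; rewrite eq_le x0 x_le0.
  have -> : F 0 i = alpha 0 i by rewrite /limit_tail scale0r expmx0 mulmx1.
  apply: le_trans (_ : state_law P phi t i <= _).
    have mphit := mphi i (ltW t0).
    have mlt : measurable [set w | 0 < Z t w /\ phi t w = i].
      by apply: measurableI => //; exact: measurable_above.
    by apply: fine_le; rewrite ?fin_num_measure//; apply: le_measure; rewrite ?inE// => w [].
  by move: pt; rewrite ler_norml; lra.
have lower : F x i - 3 * (e / 8) <= Zt t x i.
  have xx : x < x + rho / 2 by rewrite ltrDl divr_gt0.
  have [_ h1] := sP t x (x + rho / 2) i t0 x0 xx; rewrite -/c in h1.
  have y0 : 0 <= x + rho / 2 + dl by rewrite !addr_ge0// ?divr_ge0// ltW.
  have : eps * F (x + rho / 2 + dl) i <= e / 8.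
    by apply: le_trans epse; rewrite ler_piMr ?(ltW eps0)// F0.
  have := Fnear (x + rho / 2 + dl) _.
  have -> : x - (x + rho / 2 + dl) = - (rho / 2 + dl) by ring.
  rewrite normrN ger0_norm ?addr_ge0 ?divr_ge0 ?(ltW rho0) ?(ltW dl0)// => /(_ ltac:(lra)).
  rewrite ltr_norml; lra.
move: pt; rewrite ler_norml ltr_norml; lra.
Unshelve. all: by end_near. Qed.

End LimitLaw.

Theorem theorem5p3 (R : realType) (d : measure_display)
    (Omega : measurableType d) (P : probability Omega R) (m : nat)
    (Q : 'M[R]_m) (alpha mu sigma : 'rV[R]_m)
    (phi : R -> Omega -> 'I_m) (W Z : R -> {RV P >-> R}) (U : 'M[R]_m)
    (hQ : is_generator Q) (hirr : is_irreducible Q)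
    (halpha : is_stationary Q alpha)
    (hsigma : forall i, 0 < sigma 0 i)
    (hdrift : \sum_i alpha 0 i * mu 0 i < 0)
    (hphi : is_ctmc P Q phi) (hW : is_brownian W)
    (hind : independent_processes phi W)
    (hZ : is_regulated_mmbm mu sigma phi W Z)
    (hU : is_U0 mu sigma Q U) :
  let Theta := diag_mx sigma in
  let K := Kmx mu sigma U in
  (forall (q : R) (Uq : 'M[R]_m) (rho : 'rV[R]_m),
     0 < q -> is_Uq mu sigma Q q Uq ->
     rho *m invmx (- Uq) *m U = 0 -> \sum_i rho 0 i = 1 ->
     forall x : R, 0 <= x ->
       limit_law phi Z x
         (gamma_rho sigma Uq K rho *:
            (rho *m invmx (- Uq) *m invmx Theta *m invmx (- K)
               *m (1%:M - expmx (x *: K)) *m invmx Theta)))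
  /\
  (forall nu : 'rV[R]_m,
     nu *m Theta *m U = 0 -> \sum_i nu 0 i = 1 ->
     forall x : R, 0 <= x ->
       limit_law phi Z x
         (gamma_nu sigma K nu *:
            (nu *m invmx (- K) *m (1%:M - expmx (x *: K)) *m invmx Theta))).
Proof.
move=> Theta K; split=> [q Uq rho _ [_ sUq] rhoU rho1 x x0|nu nuU nu1 x x0].
  by rewrite (closed_form_rho hQ hirr halpha)//; exact: (regulated_limit_law hQ hirr halpha hsigma hdrift hphi hW hind hZ hU).
have nu0 : nu != 0.
  apply/eqP => nu0; move/eqP: nu1; rewrite nu0 big1 ?(eq_sym 0) ?oner_eq0// => i _.
  by rewrite mxE.
by rewrite (closed_form hQ hirr halpha)//; exact: (regulated_limit_law hQ hirr halpha hsigma hdrift hphi hW hind hZ hU).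
Qed.
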